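(* Let $n\ge1$ and $m(r)=r^2+\varepsilon r^{-2\beta}$ with $0<\beta<1$ and $\varepsilon=\pm1$. Then, for dyadic $\lambda\gg1$, $$\big\|\mathrm{e}^{\mathrm{i}tm(D)}P_\lambda f\big\|_{L^\infty_x(\mathbb{R}^n)}\le C|t|^{-\frac n2}\|f\|_{L^1_x(\mathbb{R}^n)}$$ for all $f\in\mathcal{S}(\mathbb{R}^n)$ (and all $t\ne0$).
   Context: $m(D)$ is the Fourier multiplier with symbol $m(|\xi|)$, so $\mathrm{e}^{\mathrm{i}tm(D)}$ has symbol $\mathrm{e}^{\mathrm{i}tm(|\xi|)}$. Fix an even $\chi\in C_0^\infty(\mathbb{R})$ with $0\le\chi\le1$, $\chi=1$ on $[-1,1]$, $\operatorname{supp}\chi\subset[-2,2]$; set $\rho(s)=\chi(s)-\chi(2s)$ and, for $\lambda\in2^{\mathbb{Z}}$, $\rho_\lambda(s)=\rho(s/\lambda)$. The frequency projection $P_\lambda$ is defined by $\widehat{P_\lambda f}(\xi)=\rho_\lambda(|\xi|)\widehat f(\xi)$. ''$\lambda\gg1$'' means $\lambda\ge\lambda_0$ for a sufficiently large constant $\lambda_0$; $C$ and $\lambda_0$ are independent of $\lambda$, $t$ and $f$. *)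

(* Defs.v *)
From HB Require Import structures.
From mathcomp Require Import all_boot all_order all_algebra.
From mathcomp Require Import complex.
From mathcomp Require Import all_classical all_reals all_analysis.

Set Implicit Arguments.
Unset Strict Implicit.
Unset Printing Implicit Defensive.

Import Order.TTheory GRing.Theory Num.Theory.
Import numFieldNormedType.Exports.

Local Open Scope classical_set_scope.
Local Open Scope ring_scope.

(* 'rV[R]_n carries the product sigma-algebra, generated by the coordinates,
   exactly as n.-tuple R does in MathComp-Analysis. *)
Definition rV_display : measure_display -> measure_display.
Proof. exact. Qed.

Section measurable_rV.
Context {d} {T : sigmaRingType d} (n : nat).

Let coors : 'I_n -> 'rV[T]_n -> T := fun i x => x ord0 i.

Let rV_set0 : g_sigma_preimage coors set0.
Proof. exact: sigma_algebra0. Qed.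

Let rV_setC A : g_sigma_preimage coors A -> g_sigma_preimage coors (~` A).
Proof. exact: sigma_algebraC. Qed.

Let rV_bigcup (F : (set 'rV[T]_n)^nat) : (forall i, g_sigma_preimage coors (F i)) ->
  g_sigma_preimage coors (\bigcup_i (F i)).
Proof. exact: sigma_algebra_bigcup. Qed.

HB.instance Definition _ := @isMeasurable.Build (rV_display d)
  'rV[T]_n (g_sigma_preimage coors) rV_set0 rV_setC rV_bigcup.

End measurable_rV.

Lemma measurable_rV_coord d (T : sigmaRingType d) n (i : 'I_n) :
  measurable_fun [set: 'rV[T]_n] (fun x : 'rV[T]_n => x ord0 i).
Proof.
move=> _ Y mY; rewrite setTI; apply: sub_sigma_algebra => /=.
rewrite -bigcup_seq/=; exists i => /=; first by rewrite mem_index_enum.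
by exists Y => //; rewrite setTI.
Qed.

Lemma measurable_fun_rVP d1 d2 (T1 : measurableType d1) (T2 : measurableType d2)
    n (f : T1 -> 'rV[T2]_n) :
  (forall i, measurable_fun [set: T1] (fun x => f x ord0 i)) ->
  measurable_fun [set: T1] f.
Proof.
move=> mf _ A; rewrite setTI; move: A.
have sF : sigma_algebra setT [set A | measurable (f @^-1` A)].
  split => /=.
  - by rewrite preimage_set0.
  - by move=> A mA; rewrite setTD preimage_setC; exact: measurableC.
  - by move=> F mF; rewrite preimage_bigcup; exact: bigcupT_measurable.
apply: smallest_sub => //.
rewrite -bigcup_seq => A [i _] [B mB <-] /=; rewrite setTI.
by rewrite -[X in measurable X]setTI; exact: (mf i).
Qed.

Lemma sigma_finite_product d1 d2 (T1 : measurableType d1)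
    (T2 : measurableType d2) (R : realType)
    (m1 : {sigma_finite_measure set T1 -> \bar R})
    (m2 : {sigma_finite_measure set T2 -> \bar R}) :
  sigma_finite setT (m1 \x m2)%E.
Proof.
have /sigma_finiteP[F [TF ndF Foo]] := sigma_finiteT m1.
have /sigma_finiteP[G [TG ndG Goo]] := sigma_finiteT m2.
exists (fun n => F n `*` G n).
  rewrite -setXTT TF TG predeqE => -[x y]; split.
    move=> [/= [n _ Fnx] [k _ Gky]]; exists (maxn n k) => //; split.
    - by move: x Fnx; exact/subsetPset/ndF/leq_maxl.
    - by move: y Gky; exact/subsetPset/ndG/leq_maxr.
  by move=> [n _ []/= ? ?]; split; exists n.
move=> k; have [? ?] := Foo k; have [? ?] := Goo k.
split; first exact: measurableX.
by rewrite product_measure1E// lte_mul_pinfty// ge0_fin_numE.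
Qed.

Section lebesgue_rV.
Variable R : realType.

Definition rV_cons n (p : measurableTypeR R * 'rV[measurableTypeR R]_n) :
  'rV[measurableTypeR R]_n.+1 := row_mx (const_mx p.1) p.2 : 'rV_(1 + n).

Lemma measurable_rV_cons n : measurable_fun setT (@rV_cons n).
Proof.
apply: measurable_fun_rVP => i.
have [j ij|j ij] := @splitP 1 n i.
  rewrite (_ : (fun x => _) = fst) //.
  apply/funext => -[x v]; rewrite /rV_cons /=.
  by rewrite (_ : i = lshift n j) ?(@row_mxEl _ _ 1) ?mxE//; exact/val_inj.
rewrite (_ : (fun x => _) = (fun v : 'rV_n => v ord0 j) \o snd).
  by apply: measurableT_comp => //; exact: measurable_rV_coord.
apply/funext => -[x v]; rewrite /rV_cons /=.
by rewrite (_ : i = rshift 1 j) ?(@row_mxEr _ _ 1)//; exact/val_inj.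
Qed.

Definition rV_uncons n (v : 'rV[measurableTypeR R]_n.+1) :
    measurableTypeR R * 'rV[measurableTypeR R]_n :=
  (v ord0 ord0, \row_(i < n) v ord0 (lift ord0 i)).

Lemma rV_consK n : cancel (@rV_cons n) (@rV_uncons n).
Proof.
move=> [x v]; rewrite /rV_uncons /rV_cons; congr (_, _).
  by rewrite (_ : @ord0 n = lshift n (@ord0 0)) ?(@row_mxEl _ _ 1) ?mxE//; exact/val_inj.
apply/rowP => i; rewrite mxE.
by rewrite (_ : lift _ _ = rshift 1 i) ?(@row_mxEr _ _ 1)//; exact/val_inj.
Qed.

Lemma measurable_rV_uncons n : measurable_fun setT (@rV_uncons n).
Proof.
apply/measurable_fun_pairP; split; first exact: measurable_rV_coord.
apply: measurable_fun_rVP => i.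
rewrite (_ : (fun x => _) = (fun v : 'rV_n.+1 => v ord0 (lift ord0 i))).
  exact: measurable_rV_coord.
by apply/funext => v /=; rewrite mxE.
Qed.

Section step.
Variables (n : nat)
  (mu : {sigma_finite_measure set 'rV[measurableTypeR R]_n -> \bar R}).

Definition lebesgue_rVS :=
  pushforward (@lebesgue_measure R \x mu)%E (@rV_cons n).

Let mcons := @measurable_rV_cons n.

Let lebesgue_rVS0 : lebesgue_rVS set0 = 0%E.
Proof. by rewrite /lebesgue_rVS /pushforward preimage_set0 measure0. Qed.

Let lebesgue_rVS_ge0 A : (0 <= lebesgue_rVS A)%E.
Proof. exact: measure_ge0. Qed.

Let lebesgue_rVS_sigma_additive : semi_sigma_additive lebesgue_rVS.
Proof. by apply: measure_semi_sigma_additive. Qed.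

HB.instance Definition _ := isMeasure.Build _ _ _ lebesgue_rVS
  lebesgue_rVS0 lebesgue_rVS_ge0 lebesgue_rVS_sigma_additive.

Lemma lebesgue_rVS_sigma_finite : sigma_finite setT lebesgue_rVS.
Proof.
have [F FT Foo] := sigma_finite_product (@lebesgue_measure R) mu.
exists (fun k => @rV_uncons n @^-1` F k).
  by rewrite -preimage_bigcup -FT preimage_setT.
move=> k; have [mF Fk] := Foo k; split.
  by rewrite -[X in measurable X]setTI; exact: measurable_rV_uncons.
rewrite /lebesgue_rVS /pushforward.
rewrite (_ : _ @^-1` _ = F k)//.
by apply/funext => x /=; rewrite /preimage /= rV_consK.
Qed.

HB.instance Definition _ := Measure_isSigmaFinite.Build _ _ _ lebesgue_rVS
  lebesgue_rVS_sigma_finite.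

End step.

(* Lebesgue measure on R^n, as the n-fold product of [lebesgue_measure]; see
   [lebesgue_rV_box]. *)
Fixpoint lebesgue_rV n :
    {sigma_finite_measure set 'rV[measurableTypeR R]_n -> \bar R} :=
  if n is n'.+1 then lebesgue_rVS (lebesgue_rV n') else @dirac _ 'rV[measurableTypeR R]_0 (0 : 'rV[R]_0) R.

Lemma lebesgue_rV_box n (A : 'I_n -> set (measurableTypeR R)) :
  (forall i, measurable (A i)) ->
  lebesgue_rV n [set v : 'rV[measurableTypeR R]_n | forall i, A i (v ord0 i)] =
    (\prod_(i < n) (@lebesgue_measure R) (A i))%E.
Proof.
elim: n A => [|n ih] A mA.
  by rewrite big_ord0 /= diracE mem_set// => -[].
rewrite big_ord_recl -(ih (fun i => A (lift ord0 i)))//=.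
pose B := [set v : 'rV[measurableTypeR R]_n |
  forall i, A (lift ord0 i) (v ord0 i)].
rewrite -/B.
have mB : measurable B.
  rewrite (_ : B = \bigcap_(i in [set: 'I_n])
      (fun v : 'rV_n => v ord0 i) @^-1` A (lift ord0 i)).
    apply: fin_bigcap_measurable => // i _.
    by rewrite -[X in measurable X]setTI; exact: measurable_rV_coord.
  by apply/seteqP; split => v /= h i; [move=> _|]; exact: h.
rewrite /lebesgue_rVS /pushforward -product_measure1E//.
have e0 x v : @rV_cons n (x, v) ord0 ord0 = x.
  exact: (congr1 fst (rV_consK (x, v))).
have eS x v j : @rV_cons n (x, v) ord0 (lift ord0 j) = v ord0 j.
  by have /(congr1 snd)/rowP/(_ j) := rV_consK (x, v); rewrite mxE.
congr (_ _); apply/seteqP; split => -[x v] /= h.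
  split=> [|i]; first by have := h ord0; rewrite e0.
  by have := h (lift ord0 i); rewrite eS.
move=> i; case: (unliftP ord0 i) => [j ->|->]; rewrite ?eS ?e0.
- exact: h.2.
- exact: h.1.
Qed.

End lebesgue_rV.

Section fourier.
Variables (R : realType) (n : nat).

Local Notation V := 'rV[R]_n.

Definition dotp (x y : V) : R := \sum_(i < n) x ord0 i * y ord0 i.

(* The library norm [`|x|] on 'rV[R]_n is the sup norm, hence this one. *)
Definition enorm (x : V) : R := Num.sqrt (dotp x x).

(* exp(i theta) *)
Definition expi (theta : R) : R[i] := (cos theta +i* sin theta)%C.

Definition cintegral (f : V -> R[i]) : R[i] :=
  ((\int[lebesgue_rV R n]_x complex.Re (f x))
   +i* (\int[lebesgue_rV R n]_x complex.Im (f x)))%C.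

Definition fourier (f : V -> R[i]) (xi : V) : R[i] :=
  cintegral (fun x => expi (- dotp x xi) * f x).

Definition inv_fourier (g : V -> R[i]) (x : V) : R[i] :=
  (((2 * pi) ^- n)%:C)%C * cintegral (fun xi => expi (dotp x xi) * g xi).

(* a(D) f for a symbol a : R^n -> C *)
Definition multiplier (a : V -> R[i]) (f : V -> R[i]) : V -> R[i] :=
  inv_fourier (fun xi => a xi * fourier f xi).

Definition LnormC (p : \bar R) (f : V -> R[i]) : \bar R :=
  ('N[lebesgue_rV R n]_p [(fun x => (Normc.normc (f x))%:E)])%E.

Definition partial (s : seq 'I_n) (f : V -> R) : V -> R :=
  foldr (fun i g => 'D_(delta_mx ord0 i) g) f s.

(* f is smooth (all iterated partial derivatives are Frechet differentiable)
   and all the seminorms sup |x^a d^s f| are finite. *)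
Definition schwartzR (f : V -> R) : Prop :=
  (forall s x, differentiable (partial s f) x) /\
  (forall (a : 'I_n -> nat) s, exists M : R, forall x : V,
    `|(\prod_(i < n) x ord0 i ^+ a i) * partial s f x| <= M).

Definition schwartz (f : V -> R[i]) : Prop :=
  schwartzR (fun x => complex.Re (f x)) /\
  schwartzR (fun x => complex.Im (f x)).

End fourier.

Section littlewood_paley.
Variable R : realType.

Definition cutoff (chi : R -> R) : Prop :=
  [/\ (forall s, chi (- s) = chi s),
      (forall k s, derivable (chi^`(k))%classic s 1),
      (forall s, 0 <= chi s <= 1),
      (forall s, `|s| <= 1 -> chi s = 1)
    & closure [set s | chi s != 0] `<=` `[-2, 2]%classic].

Definition bump_rho (chi : R -> R) (s : R) : R := chi s - chi (2 * s).

Definition freq_proj n (chi : R -> R) (lambda : R) :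
    ('rV[R]_n -> R[i]) -> 'rV[R]_n -> R[i] :=
  multiplier (fun xi => ((bump_rho chi (enorm xi / lambda))%:C)%C).

Definition propagator n (m : R -> R) (t : R) :
    ('rV[R]_n -> R[i]) -> 'rV[R]_n -> R[i] :=
  multiplier (fun xi => expi (t * m (enorm xi))).

(* At r = 0 the second term takes the value 0 ([0 `^ a = 0] for a != 0); this
   only concerns the single frequency xi = 0. *)
Definition dispersion (eps beta : R) (r : R) : R :=
  r ^+ 2 + eps * r `^ (- (2 * beta)).

End littlewood_paley.

(* Main.v *)
Require Import Defs.
From mathcomp Require Import all_boot all_order all_algebra.
From mathcomp Require Import complex.
From mathcomp Require Import all_classical all_reals all_analysis.
From mathcomp Require Import measurable_realfun ess_sup_inf ring lra.

Set Implicit Arguments.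
Unset Strict Implicit.
Unset Printing Implicit Defensive.

Import Order.TTheory GRing.Theory Num.Theory.
Import numFieldNormedType.Exports.
Import Normc.

Local Open Scope classical_set_scope.
Local Open Scope ring_scope.

(** Both multipliers are convolutions.  If [b] is the symbol of the frequency
    projection and [K] its inverse Fourier transform, the projection of [f] is
    [K * f]; its Fourier transform is [b] times that of [f], by Fourier inversion
    for [b].  Hence the propagator applied to the projection is the convolution of
    [f] with the inverse transform [k] of [exp (i t m(|xi|)) b(xi)]
    ([ifourier_mul_fourier], [fourier_multiplier]), and everything reduces to
    [|k| <= C |t|^(-n/2)], uniformly in [lambda] ([kernel_bound]).

    The kernel.  The substitution [xi = lambda eta] turns the phase into
    [T (|eta|^2 + delta w(|eta|^2)) + y . eta], where [T = t lambda^2], where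
    [delta] has size [lambda^(-2 beta - 2)], hence is small for large [lambda],
    and where [w] is a smooth compactly supported function equal to
    [u^(-beta)] on the support of the amplitude.  The oscillatory integral [I]
    with this phase is estimated without locating stationary points.  Its
    modulus squared is the integral over [h] of its autocorrelation
    ([sqr_normc_cint]), an oscillatory integral whose phase is the increment
    [Phi(eta + h) - Phi(eta)].  Along the coordinate axis [j] for which [|h_j|] is
    largest, the derivative of this increment is [T h_j] times a smooth function
    between 1 and 3, because the Hessian of [Phi] is [2 T] up to a small
    perturbation.  Integrating by parts [2n] times in this single direction
    ([oscillatory_decay], [normc_cint_axis]) bounds the autocorrelation by
    [C / prod_i (1 + (T h_i)^2)] ([phase_increment_decay], [le_cauchy_prod]), and
    the integral of this in [h] is [C (pi / |T|)^n].  So [|I|^2 <= C |T|^(-n)], and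
    the factor [lambda^n] of the substitution turns this into the bound for [k].

    Uniformity.  On a line in a coordinate direction at distance [x] from the
    origin, a radial function is [F (x, s) = w (x^2 + s^2)].  The functions
    obtained from these by derivation in [x] and [s] are all bounded, so constants
    depend neither on the line nor on [h] ([radial2], [radial2_diff_Cb]).

    Inversion.  The same integrations by parts show that [K] is integrable
    ([radial_fourier_decay]).  Inserting [exp (- e |x|_1)] into the integral that
    defines the transform of [K] allows the order of integration to be exchanged;
    the transform of this weight is an explicit approximate identity, and [e]
    tends to 0 by dominated convergence ([fourier_inversion]). *)

(** * Integrals of complex-valued functions *)

Section complex_integral.
Context d (T : measurableType d) (R : realType).
Implicit Types (f g : T -> R[i]) (mu : {measure set T -> \bar R}).

Definition cmeas f :=
  measurable_fun setT (fun x => complex.Re (f x)) /\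
  measurable_fun setT (fun x => complex.Im (f x)).

Definition cintegrable mu f :=
  cmeas f /\ mu.-integrable setT (fun x => (normc (f x))%:E).

Definition cint mu f : R[i] :=
  ((\int[mu]_x complex.Re (f x)) +i* (\int[mu]_x complex.Im (f x)))%C.

Lemma normc_sqrt (z : R[i]) :
  normc z = Num.sqrt (complex.Re z ^+ 2 + complex.Im z ^+ 2).
Proof. by case: z. Qed.

Lemma normc_ge0 (z : R[i]) : 0 <= normc z.
Proof. by rewrite normc_sqrt sqrtr_ge0. Qed.

Lemma sqr_normcE (z : R[i]) :
  normc z ^+ 2 = complex.Re z ^+ 2 + complex.Im z ^+ 2.
Proof. by rewrite normc_sqrt sqr_sqrtr// addr_ge0// sqr_ge0. Qed.

Lemma le_Re_normc (z : R[i]) : `|complex.Re z| <= normc z.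
Proof.
rewrite -(@ler_pXn2r _ 2%N)// ?nnegrE ?normc_ge0//.
by rewrite real_normK ?num_real// sqr_normcE lerDl sqr_ge0.
Qed.

Lemma le_Im_normc (z : R[i]) : `|complex.Im z| <= normc z.
Proof.
rewrite -(@ler_pXn2r _ 2%N)// ?nnegrE ?normc_ge0//.
by rewrite real_normK ?num_real// sqr_normcE lerDr sqr_ge0.
Qed.

Lemma normc_real (x : R) : normc (x%:C)%C = `|x|.
Proof. by rewrite normc_sqrt /= expr0n /= addr0 sqrtr_sqr. Qed.

Lemma normc_expi (x : R) : normc (expi x) = 1.
Proof. by rewrite normc_sqrt /= cos2Dsin2 sqrtr1. Qed.

Lemma normc_conj (z : R[i]) : normc (conjc z) = normc z.
Proof. by case: z => a b; rewrite !normc_sqrt /= sqrrN. Qed.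

Lemma expiD (a b : R) : expi (a + b) = expi a * expi b.
Proof. by rewrite /expi cosD sinD; simpc; congr (_ +i* _)%C; rewrite addrC. Qed.

Lemma expi0 : expi (0 : R) = 1.
Proof. by rewrite /expi cos0 sin0. Qed.

Lemma conj_expi (a : R) : conjc (expi a) = expi (- a).
Proof. by rewrite /expi cosN sinN. Qed.

Lemma cmeasM f g : cmeas f -> cmeas g -> cmeas (fun x => f x * g x).
Proof.
move=> [fr fi] [gr gi]; split.
  rewrite (_ : (fun x => _) = (fun x => complex.Re (f x) * complex.Re (g x)
     - complex.Im (f x) * complex.Im (g x))).
    by apply: measurable_funB; exact: measurable_funM.
  by apply/funext => x; case: (f x); case: (g x).
rewrite (_ : (fun x => _) = (fun x => complex.Re (f x) * complex.Im (g x)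
     + complex.Im (f x) * complex.Re (g x))).
  by apply: measurable_funD; exact: measurable_funM.
by apply/funext => x; case: (f x) => a b; case: (g x).
Qed.

Lemma cmeas_real (f : T -> R) :
  measurable_fun setT f -> cmeas (fun x => ((f x)%:C)%C).
Proof. by move=> mf; split. Qed.

Lemma cmeas_expi (f : T -> R) :
  measurable_fun setT f -> cmeas (fun x => expi (f x)).
Proof.
move=> mf; split => /=.
  apply: (measurableT_comp _ mf) => //.
  apply: continuous_measurable_fun; exact: continuous_cos.
apply: (measurableT_comp _ mf) => //.
apply: continuous_measurable_fun; exact: continuous_sin.
Qed.

Lemma cmeas_cst (c : R[i]) : cmeas (fun _ => c).
Proof. by split. Qed.

Lemma cmeas_conj f : cmeas f -> cmeas (fun x => conjc (f x)).
Proof.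
move=> [fr fi]; split => /=.
  by rewrite (_ : (fun x => _) = (fun x => complex.Re (f x)))//; apply/funext => x; case: (f x).
rewrite (_ : (fun x => _) = (fun x => - complex.Im (f x))).
  exact: measurableT_comp.
by apply/funext => x; case: (f x).
Qed.

Lemma measurable_normc f : cmeas f -> measurable_fun setT (fun x => normc (f x)).
Proof.
move=> [fr fi].
rewrite (_ : (fun x => _) = (fun x : T => Num.sqrt (complex.Re (f x) ^+ 2 + complex.Im (f x)
  ^+ 2))).
  apply: (measurableT_comp (f := @Num.sqrt R)) => //.
    apply: continuous_measurable_fun; exact: sqrt_continuous.
  by apply: measurable_funD; exact: measurable_funX.
by apply/funext => x; rewrite normc_sqrt.
Qed.

Lemma le_cintegrable mu f (g : T -> R) : cmeas f ->
  (forall x, normc (f x) <= g x) -> mu.-integrable setT (EFin \o g) ->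
  cintegrable mu f.
Proof.
move=> mf fg ig; split => //; apply: le_integrable ig => //.
  by apply/measurable_EFinP; exact: measurable_normc.
move=> x _; rewrite lee_fin /= ger0_norm ?normc_ge0//.
by rewrite (le_trans (fg x))// ler_norm.
Qed.

Lemma cintegrable_norm mu f : cintegrable mu f ->
  mu.-integrable setT (EFin \o (fun x => normc (f x))).
Proof. by case. Qed.

Lemma cintegrable_Re mu f : cintegrable mu f ->
  mu.-integrable setT (EFin \o (fun x => complex.Re (f x))).
Proof.
move=> [[mf _] fi]; apply: le_integrable fi => //; first exact/measurable_EFinP.
by move=> x _; rewrite lee_fin (le_trans (le_Re_normc _))// ler_norm.
Qed.

Lemma cintegrable_Im mu f : cintegrable mu f ->
  mu.-integrable setT (EFin \o (fun x => complex.Im (f x))).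
Proof.
move=> [[_ mf] fi]; apply: le_integrable fi => //; first exact/measurable_EFinP.
by move=> x _; rewrite lee_fin (le_trans (le_Im_normc _))// ler_norm.
Qed.

Lemma integrableZ_EFin mu (D : set T) (k : R) (h : T -> R) : measurable D ->
  mu.-integrable D (EFin \o h) ->
  mu.-integrable D (EFin \o (fun x => k * h x)).
Proof.
move=> mD ih; rewrite (_ : _ \o _ = (fun x => k%:E * (EFin \o h) x)%E).
  exact: integrableZl.
by apply/funext => x /=; rewrite EFinM.
Qed.

Lemma integrableD_EFin mu (D : set T) (h k : T -> R) : measurable D ->
  mu.-integrable D (EFin \o h) -> mu.-integrable D (EFin \o k) ->
  mu.-integrable D (EFin \o (fun x => h x + k x)).
Proof.
move=> mD ih ik; rewrite (_ : _ \o _ = (EFin \o h) \+ (EFin \o k))%E.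
  exact: integrableD.
by apply/funext => x /=; rewrite EFinD.
Qed.

Lemma cintegrableMl mu f g (M : R) : cmeas g -> (forall x, normc (g x) <= M) ->
  cintegrable mu f -> cintegrable mu (fun x => g x * f x).
Proof.
move=> mg gM [mf fi]; apply: (@le_cintegrable _ _ (fun x => M * normc (f x))).
- exact: cmeasM.
- by move=> x; rewrite normcM ler_wpM2r ?normc_ge0.
- exact: integrableZ_EFin.
Qed.

Lemma cintZ mu (c : R[i]) f : cintegrable mu f ->
  cint mu (fun x => c * f x) = c * cint mu f.
Proof.
move=> fi; have fr := cintegrable_Re fi; have fim := cintegrable_Im fi.
case: c => a b; rewrite /cint; simpc; congr (_ +i* _)%C.
  rewrite -[in RHS]RintegralZl// -[in RHS]RintegralZl// -RintegralB//.
  - by apply: eq_Rintegral => x _; case: (f x).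
  - exact: integrableZ_EFin.
  - exact: integrableZ_EFin.
rewrite -[in RHS]RintegralZl// -[in RHS]RintegralZl// -RintegralD//.
- by apply: eq_Rintegral => x _; case: (f x).
- exact: integrableZ_EFin.
- exact: integrableZ_EFin.
Qed.

Lemma cintZr mu (c : R[i]) f : cintegrable mu f ->
  cint mu (fun x => f x * c) = cint mu f * c.
Proof.
by move=> fi; rewrite mulrC -cintZ//; congr cint; apply/funext => x; rewrite mulrC.
Qed.

Lemma cint_conj mu f : cintegrable mu f ->
  cint mu (fun x => conjc (f x)) = conjc (cint mu f).
Proof.
move=> fi; rewrite /cint /=; congr (_ +i* _)%C.
  by apply: eq_Rintegral => x _; case: (f x).
rewrite -mulN1r -RintegralZl//; last exact: cintegrable_Im.
by apply: eq_Rintegral => x _; case: (f x) => a b /=; rewrite mulN1r.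
Qed.

(** With [z] the value of the integral, [|z|^2] is the integral of
    [Re (conj z * f)], which the Cauchy-Schwarz inequality in the plane bounds
    pointwise by [|z| |f|]. *)
Lemma normc_cint mu f : cintegrable mu f ->
  normc (cint mu f) <= \int[mu]_x normc (f x).
Proof.
move=> fi; have fr := cintegrable_Re fi; have fim := cintegrable_Im fi.
have fn := cintegrable_norm fi.
set z := cint mu f; have [->|z0] := eqVneq z 0.
  by rewrite normc0 Rintegral_ge0// => x _; exact: normc_ge0.
have nz : 0 < normc z.
  rewrite lt_neqAle normc_ge0 andbT eq_sym; apply: contra z0 => /eqP nz.
  by apply/eqP; exact: eq0_normc.
rewrite -(ler_pM2l nz) -expr2 sqr_normcE.
rewrite [X in X ^+ 2 + _]/= [X in _ + X ^+ 2]/= !expr2.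
rewrite -[in leLHS]RintegralZl// -[in leLHS]RintegralZl// -RintegralZl// -RintegralD//; last 2
  first.
- exact: integrableZ_EFin.
- exact: integrableZ_EFin.
apply: le_Rintegral => //.
- by apply: integrableD_EFin => //; exact: integrableZ_EFin.
- exact: integrableZ_EFin.
move=> x _; rewrite -[X in X * _ + _]/(complex.Re z) -[X in _ + X * _]/(complex.Im z).
rewrite (normc_sqrt z) (normc_sqrt (f x)) -sqrtrM ?addr_ge0 ?sqr_ge0//.
set a := complex.Re z; set b := complex.Im z.
set p := complex.Re (f x); set q := complex.Im (f x).
rewrite (le_trans (ler_norm _))// -sqrtr_sqr ler_sqrt.
  have := sqr_ge0 (a * q - b * p); nra.
by apply: mulr_ge0; rewrite addr_ge0 ?sqr_ge0.
Qed.

Lemma cint_cvg mu (f_ : nat -> T -> R[i]) f (g : T -> R) :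
  (forall k, cmeas (f_ k)) -> cmeas f ->
  (forall x, (fun k => complex.Re (f_ k x)) @ \oo --> complex.Re (f x)) ->
  (forall x, (fun k => complex.Im (f_ k x)) @ \oo --> complex.Im (f x)) ->
  mu.-integrable setT (EFin \o g) ->
  (forall k x, normc (f_ k x) <= g x) ->
  (fun k => complex.Re (cint mu (f_ k))) @ \oo --> complex.Re (cint mu f) /\
  (fun k => complex.Im (cint mu (f_ k))) @ \oo --> complex.Im (cint mu f).
Proof.
have aux (u_ : nat -> T -> R) (u : T -> R) :
    (forall k, measurable_fun setT (u_ k)) -> measurable_fun setT u ->
    (forall x, (fun k => u_ k x) @ \oo --> u x) ->
    mu.-integrable setT (EFin \o g) ->
    (forall k x, `|u_ k x| <= g x) ->
    (fun k => \int[mu]_x u_ k x) @ \oo --> \int[mu]_x u x.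
  move=> mu_ mu' uu ig ug.
  have [| | | |iu _ cu] := @dominated_convergence _ _ _ mu setT measurableT
    (fun k => EFin \o u_ k) (EFin \o u) (EFin \o g) _ _ _ ig.
  - by move=> k; apply/measurable_EFinP.
  - exact/measurable_EFinP.
  - by apply: aeW => x _; apply: cvg_EFin (uu x); exact: nearW.
  - by apply: aeW => x k _; rewrite lee_fin.
  apply: fine_cvg; rewrite fineK; last exact: integrable_fin_num.
  exact: cu.
move=> mf_ mf cr ci ig fg; split => /=.
  apply: aux ig _ => //.
  - by move=> k; case: (mf_ k).
  - by case: mf.
  - by move=> k x; rewrite (le_trans (le_Re_normc _)).
apply: aux ig _ => //.
- by move=> k; case: (mf_ k).
- by case: mf.
- by move=> k x; rewrite (le_trans (le_Im_normc _)).
Qed.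

End complex_integral.

(** * Fubini's theorem and changes of variables *)

Section fubini_real.
Context d1 d2 (T1 : measurableType d1) (T2 : measurableType d2) (R : realType).
Variables (m1 : {sigma_finite_measure set T1 -> \bar R})
  (m2 : {sigma_finite_measure set T2 -> \bar R}).
Implicit Types F : T1 * T2 -> R.

Lemma integral_fine d (T : measurableType d) (mu : {measure set T -> \bar R})
    (g : T -> \bar R) : mu.-integrable setT g ->
  mu.-integrable setT (EFin \o (fine \o g)) /\
  (\int[mu]_x (fine (g x))%:E = \int[mu]_x g x)%E.
Proof.
move=> ig; have mg := measurable_int _ ig.
have mfg : measurable_fun setT (EFin \o (fine \o g)).
  by apply/measurable_EFinP; exact: measurableT_comp.
split.
  apply: le_integrable ig => // x _ /=; case: (g x) => //= *; rewrite ?normr0 ?leey//.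
apply: ae_eq_integral => //.
apply: filterS (integrable_ae measurableT ig) => x /= h _.
by rewrite fineK// h.
Qed.

Lemma Rintegral_prod1 F : (m1 \x m2)%E.-integrable setT (EFin \o F) ->
  m1.-integrable setT (EFin \o (fun x => \int[m2]_y F (x, y))) /\
  \int[m1]_x \int[m2]_y F (x, y) = \int[(m1 \x m2)%E]_z F z.
Proof.
move=> iF; have := integral_fine (integrable_fubini_F iF) => -[i1 i2]; split => //.
rewrite [RHS]/Rintegral [X in _ = fine X](_ : _ = \int[(m1 \x m2)%E]_z (EFin \o F) z)%E//.
by rewrite -integral12_prod_meas1// -i2.
Qed.

Lemma integrable_fubini_G (f : T1 * T2 -> \bar R) :
  (m1 \x m2)%E.-integrable setT f ->
  m2.-integrable setT (fun y => \int[m1]_x f (x, y))%E.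
Proof.
move=> imf; have mf := measurable_int _ imf.
have mG := measurable_fubini_G imf.
apply/integrableP; split => //.
apply: le_lt_trans ((integrable21ltyP m1 m2 mf).1 imf).
apply: ge0_le_integral => //.
- exact: measurableT_comp.
- by apply: (measurable_fun_fubini_tonelli_G (abse \o f)) => //=; exact: measurableT_comp.
- by move=> y _; apply: le_abse_integral => //; exact: measurableT_comp.
Qed.

Lemma Rintegral_prod2 F : (m1 \x m2)%E.-integrable setT (EFin \o F) ->
  m2.-integrable setT (EFin \o (fun y => \int[m1]_x F (x, y))) /\
  \int[m2]_y \int[m1]_x F (x, y) = \int[(m1 \x m2)%E]_z F z.
Proof.
move=> iF; have := integral_fine (integrable_fubini_G iF) => -[i1 i2]; split => //.
rewrite [RHS]/Rintegral [X in _ = fine X](_ : _ = \int[(m1 \x m2)%E]_z (EFin \o F) z)%E//.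
by rewrite -integral21_prod_meas1// -i2.
Qed.

End fubini_real.

Section fubini_complex.
Context d1 d2 (T1 : measurableType d1) (T2 : measurableType d2) (R : realType).
Variables (m1 : {sigma_finite_measure set T1 -> \bar R})
  (m2 : {sigma_finite_measure set T2 -> \bar R}).
Implicit Types F : T1 * T2 -> R[i].

Lemma cintegrable_ReIm d (T : measurableType d) (mu : {measure set T -> \bar R})
    (f : T -> R[i]) :
  mu.-integrable setT (EFin \o (fun x => complex.Re (f x))) ->
  mu.-integrable setT (EFin \o (fun x => complex.Im (f x))) ->
  cintegrable mu f.
Proof.
move=> fr fi; apply: (@le_cintegrable _ _ _ _ _
    (fun x => `|complex.Re (f x)| + `|complex.Im (f x)|)).
- by split; apply/measurable_EFinP; [exact: measurable_int fr|exact: measurable_int fi].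
- move=> x; rewrite -(@ler_pXn2r _ 2%N)// ?nnegrE ?normc_ge0 ?addr_ge0//.
  rewrite sqr_normcE sqrrD !real_normK ?num_real// -addrA.
  by rewrite lerD2l lerDr mulrn_wge0// mulr_ge0.
- by apply: integrableD_EFin => //; exact: integrable_norm.
Qed.

Lemma cint_prod1 F : cintegrable (m1 \x m2)%E F ->
  cintegrable m1 (fun x => cint m2 (fun y => F (x, y))) /\
  cint m1 (fun x => cint m2 (fun y => F (x, y))) = cint (m1 \x m2)%E F.
Proof.
move=> iF; have [r1 r2] := Rintegral_prod1 (cintegrable_Re iF).
have [i1 i2] := Rintegral_prod1 (cintegrable_Im iF); split.
  exact: cintegrable_ReIm.
by rewrite /cint /= r2 i2.
Qed.

Lemma cint_prod2 F : cintegrable (m1 \x m2)%E F ->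
  cintegrable m2 (fun y => cint m1 (fun x => F (x, y))) /\
  cint m2 (fun y => cint m1 (fun x => F (x, y))) = cint (m1 \x m2)%E F.
Proof.
move=> iF; have [r1 r2] := Rintegral_prod2 (cintegrable_Re iF).
have [i1 i2] := Rintegral_prod2 (cintegrable_Im iF); split.
  exact: cintegrable_ReIm.
by rewrite /cint /= r2 i2.
Qed.

Lemma cint_swap F : cintegrable (m1 \x m2)%E F ->
  cint m1 (fun x => cint m2 (fun y => F (x, y))) =
  cint m2 (fun y => cint m1 (fun x => F (x, y))).
Proof. by move=> iF; rewrite (cint_prod1 iF).2 (cint_prod2 iF).2. Qed.

(** By Tonelli's theorem it is enough to dominate the inner integral of the
    modulus; for convolutions and autocorrelations the majorant [g] is an [L^1]
    norm times the modulus of the other factor. *)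
Lemma cintegrable_prod F (g : T2 -> R) : cmeas F ->
  (forall y, \int[m1]_x (normc (F (x, y)))%:E <= (g y)%:E)%E ->
  m2.-integrable setT (EFin \o g) ->
  cintegrable (m1 \x m2)%E F.
Proof.
move=> mF Fg ig; split => //.
have mnF : measurable_fun setT (fun z => (normc (F z))%:E).
  by apply/measurable_EFinP; exact: measurable_normc.
apply/(integrable21ltyP m1 m2 mnF).
under eq_integral => y _ do
  under eq_integral => x _ do rewrite /= ger0_norm ?normc_ge0//.
apply: le_lt_trans (integrable_lty measurableT (integrable_abse ig)).
apply: ge0_le_integral => //.
- by move=> y _; apply: integral_ge0 => x _; rewrite lee_fin normc_ge0.
- apply: (measurable_fun_fubini_tonelli_G (fun z => (normc (F z))%:E)) => //.
  by move=> z; rewrite lee_fin normc_ge0.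
- by apply: measurableT_comp => //; exact: measurable_int ig.
- by move=> y _; rewrite (le_trans (Fg y))//= lee_fin ler_norm.
Qed.

End fubini_complex.

(** The hypothesis [m12] says that [m2] is [a] times the image of [m1] by [phi];
    it covers translations, dilations and the splitting of [R^n] into a line and
    a hyperplane. *)
Section change_of_variables.
Context d1 d2 (T1 : measurableType d1) (T2 : measurableType d2) (R : realType).
Variables (m1 : {measure set T1 -> \bar R}) (m2 : {measure set T2 -> \bar R}).
Variables (phi : T1 -> T2) (mphi : measurable_fun setT phi) (a : R).
Hypothesis a0 : 0 < a.
Hypothesis m12 :
  forall A, measurable A -> (m2 A = a%:E * m1 (phi @^-1` A))%E.

Lemma ge0_integral_change (f : T2 -> \bar R) : measurable_fun setT f ->
  (forall x, 0 <= f x)%E ->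
  (\int[m2]_y f y = a%:E * \int[m1]_x f (phi x))%E.
Proof.
move=> mf f0.
pose a' : {nonneg R} := NngNum (ltW a0).
rewrite (@eq_measure_integral _ _ _ setT (mscale a' (pushforward m1 phi))); last first.
  by move=> A mA _; rewrite m12.
rewrite ge0_integral_mscale//=.
  by rewrite ge0_integral_pushforward.
Qed.

Lemma integrable_change (f : T2 -> \bar R) : measurable_fun setT f ->
  m2.-integrable setT f <-> m1.-integrable setT (f \o phi).
Proof.
move=> mf; have maf : measurable_fun setT (fun x => `|f x|)%E by exact: measurableT_comp.
have e := ge0_integral_change maf (fun x => abse_ge0 (f x)).
split => /integrableP[_ h]; apply/integrableP; split => //.
- exact: measurableT_comp.
- move: h; rewrite e /= => h; rewrite ltey; apply/eqP => h'; move: h.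
  by rewrite h' gt0_muley ?lte_fin// ltxx.
- by rewrite e lte_mul_pinfty// ?lee_fin// ltW.
Qed.

Lemma Rintegral_change (f : T2 -> R) : measurable_fun setT f ->
  m2.-integrable setT (EFin \o f) ->
  \int[m2]_y f y = a * \int[m1]_x f (phi x).
Proof.
move=> mf if2; have mfE : measurable_fun setT (EFin \o f) by exact/measurable_EFinP.
have if1 := (integrable_change mfE).1 if2.
rewrite /Rintegral -[a in RHS]/(fine a%:E) -fineM//; last first.
  by have := integrable_fin_num measurableT if1.
congr fine; rewrite integralE [in RHS]integralE.
rewrite muleBr//; last first.
  have i1 := integrable_fin_num measurableT (integrable_funepos measurableT if1).
  by apply: fin_num_adde_defr; exact: i1.
have mp := measurable_funepos mfE; have mn := measurable_funeneg mfE.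
rewrite (ge0_integral_change mp)// (ge0_integral_change mn)//.
by congr (_ * _ - _ * _)%E; apply: eq_integral => x _; rewrite ?funeposE ?funenegE.
Qed.

Lemma cintegrable_change (f : T2 -> R[i]) : cmeas f ->
  cintegrable m2 f <-> cintegrable m1 (f \o phi).
Proof.
move=> mf; have mn : measurable_fun setT (fun x => (normc (f x))%:E).
  by apply/measurable_EFinP; exact: measurable_normc.
have e := integrable_change mn; split => -[_ h].
  split; last exact/e.
  by case: mf => mr mi; split;
    [exact: (measurableT_comp mr mphi)|exact: (measurableT_comp mi mphi)].
by split => //; exact/e.
Qed.

Lemma cint_change (f : T2 -> R[i]) : cmeas f -> cintegrable m2 f ->
  cint m2 f = (a%:C)%C * cint m1 (f \o phi).
Proof.
move=> [mr mi] cf; rewrite /cint; simpc; congr (_ +i* _)%C.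
  by apply: Rintegral_change => //; exact: cintegrable_Re.
by apply: Rintegral_change => //; exact: cintegrable_Im.
Qed.

End change_of_variables.

(** * Lebesgue measure on [R^n] *)

Section lebesgue_box.
Variable R : realType.
Local Notation V n := 'rV[measurableTypeR R]_n.

(** The push-forward bundled with the measurability of the map, which is what
    makes it a measure. *)
Definition image_measure d1 d2 (T1 : measurableType d1) (T2 : measurableType d2)
    (m : {measure set T1 -> \bar R}) (phi : T1 -> T2)
    (mphi : measurable_fun setT phi) : {measure set T2 -> \bar R} :=
  measure_function_pushforward__canonical__measure_function_Measure m mphi.

Definition box n (A : 'I_n -> set (measurableTypeR R)) : set (V n) :=
  [set v | forall i, A i (v ord0 i)].

Lemma measurable_box n (A : 'I_n -> set (measurableTypeR R)) :
  (forall i, measurable (A i)) -> measurable (box A).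
Proof.
move=> mA; rewrite (_ : box A = \bigcap_(i in [set: 'I_n])
      (fun v : V n => v ord0 i) @^-1` A i).
  apply: fin_bigcap_measurable => // i _.
  by rewrite -[X in measurable X]setTI; exact: measurable_rV_coord.
by apply/seteqP; split => v /= h i; [move=> _|]; exact: h.
Qed.

Lemma lebesgue_boxE n (A : 'I_n -> set (measurableTypeR R)) :
  (forall i, measurable (A i)) ->
  (lebesgue_rV R n (box A) = \prod_(i < n) (@lebesgue_measure R) (A i))%E.
Proof. exact: lebesgue_rV_box. Qed.

(** The boxes are stable under intersection, generate the sigma-algebra, and
    the cubes of finite measure exhaust the space. *)
Lemma lebesgue_rV_unique n (m : {measure set V n -> \bar R}) :
  (forall A : 'I_n -> set (measurableTypeR R), (forall i, measurable (A i)) ->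
    (m (box A) = \prod_(i < n) (@lebesgue_measure R) (A i))%E) ->
  forall X, measurable X -> lebesgue_rV R n X = m X.
Proof.
move=> mE X mX.
pose G : set (set (V n)) := [set X | exists2 A, (forall i, measurable (A i)) & X = box A].
pose I k : set (measurableTypeR R) := `](- k%:R), k%:R]%classic.
apply: (measure_unique G (fun k => box (fun=> I k))) => //.
- apply/seteqP; split => Y.
    move: Y; apply: smallest_sub; first exact: smallest_sigma_algebra.
    rewrite -bigcup_seq => _ [i _] [B mB <-] /=; rewrite setTI.
    apply: sub_sigma_algebra; exists (fun j => if j == i then B else setT).
      by move=> j; case: ifP.
    apply/seteqP; split => v /=; last by move/(_ i); rewrite eqxx.
    by move=> Bv j; case: eqP => [->|].
  apply: smallest_sub; first exact: sigma_algebra_measurable.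
  by move=> _ [A mA ->]; exact: measurable_box.
- move=> _ _ [A mA ->] [B mB ->]; exists (fun i => A i `&` B i).
    by move=> i; exact: measurableI.
  apply/seteqP; split => v /=; first by move=> [a b] i; split; [exact: a|exact: b].
  by move=> h; split => i; have [] := h i.
- by move=> k; exists (fun=> I k) => // i; exact: measurable_itv.
- apply/seteqP; split => v // _.
  exists (Num.truncn (\sum_(i < n) `|v ord0 i|)).+1 => // i /=.
  have := truncnS_gt (\sum_(i < n) `|v ord0 i|).
  set k := (Num.truncn _).+1 => kS.
  have : `|v ord0 i| < k%:R.
    apply: le_lt_trans kS.
    by rewrite (bigD1 i)//= lerDl sumr_ge0.
  by rewrite ltr_norml /I /= in_itv /= => /andP[-> /ltW ->].
- by move=> _ [A mA ->]; rewrite mE//; exact: lebesgue_boxE.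
- move=> k; have mI : forall i : 'I_n, measurable (I k) by move=> i; exact: measurable_itv.
  apply: (@le_lt_trans _ _ (\prod_(i < n) (@lebesgue_measure R) (I k))%E).
    by rewrite -(lebesgue_boxE mI); exact: lexx.
  rewrite [ltLHS](_ : _ = ((\prod_(i < n) (k%:R + k%:R))%:E))%E ?ltry//.
  rewrite -prodEFin; apply: eq_bigr => i _; rewrite lebesgue_measure_itv /= lte_fin.
  case: ifPn => [_|]; first by rewrite -EFinD opprK.
  by rewrite -leNgt => h; congr EFin; have : 0 <= (k%:R : R) by []; lra.
Qed.

(** It is enough to compare both measures on half-open intervals. *)
Lemma lebesgue_measure_affine (c y : R) (A : set (measurableTypeR R)) : 0 < c ->
  measurable A ->
  (@lebesgue_measure R A =
    c%:E * @lebesgue_measure R ((fun x : measurableTypeR R => (y + c * x : measurableTypeR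
      R)%R) @^-1` A))%E.
Proof.
move=> c0 mA.
pose phi (x : measurableTypeR R) : measurableTypeR R := y + c * x.
have mphi : measurable_fun setT phi.
  by apply: measurable_funD => //; exact: measurable_funM.
pose c' : {nonneg R} := NngNum (ltW c0).
transitivity (mscale c' (image_measure (@lebesgue_measure R) mphi) A) => //.
apply: lebesgue_measure_unique => // _ [[a b]] _ <- /=.
rewrite /mscale /image_measure /= /pushforward (_ : phi @^-1` _ = `](a - y) / c, (b - y) /
  c]%classic).
  rewrite !lebesgue_measure_itv/= !lte_fin ltr_pM2r ?invr_gt0// ltrD2r.
  case: ifPn => _; last by rewrite mule0.
  by rewrite -!EFinD -EFinM; congr EFin; field; rewrite gt_eqF.
apply/seteqP; split => x; rewrite /phi /= !in_itv /= ltr_pdivrMr// ler_pdivlMr//;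
  by rewrite ltrBlDl lerBrDl [x * c]mulrC.
Qed.

Lemma lebesgue_rV_affine n (c : R) (y : V n) (A : set (V n)) : 0 < c ->
  measurable A ->
  (lebesgue_rV R n A =
    (c ^+ n)%:E * lebesgue_rV R n ((fun x : V n => (y + c *: (x : 'rV[R]_n) : V n)%R) @^-1` A))%E.
Proof.
move=> c0 mA.
pose phi (x : V n) : V n := y + c *: (x : 'rV[R]_n).
have mphi : measurable_fun setT phi.
  apply: measurable_fun_rVP => i.
  rewrite (_ : (fun x => _) = (fun x : V n => y ord0 i + c * x ord0 i)).
    by apply: measurable_funD => //; apply: measurable_funM => //; exact: measurable_rV_coord.
  by apply/funext => x; rewrite !mxE.
have cn0 : 0 <= c ^+ n by rewrite exprn_ge0// ltW.
pose c' : {nonneg R} := NngNum cn0.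
transitivity (mscale c' (image_measure (lebesgue_rV R n) mphi) A) => //.
apply: lebesgue_rV_unique => // B mB.
rewrite [LHS](_ : _ = (c ^+ n)%R%:E * lebesgue_rV R n (phi @^-1` box B))%E//.
pose B' i := (fun x : measurableTypeR R => (y ord0 i + c * x : measurableTypeR R)) @^-1` B i.
have mB' i : measurable (B' i).
  rewrite -[X in measurable X]setTI.
  have mf : measurable_fun setT (fun x : measurableTypeR R => (y ord0 i + c * x :
    measurableTypeR R)).
    by apply: measurable_funD => //; exact: measurable_funM.
  exact: mf.
rewrite (_ : phi @^-1` _ = box B').
  rewrite lebesgue_boxE//.
  under [RHS]eq_bigr => i _ do rewrite (lebesgue_measure_affine (y ord0 i) c0 (mB i)).
  rewrite big_split /= -/B'; congr (_ * _)%E.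
  by rewrite prodEFin prodr_const card_ord.
by apply/seteqP; split => v /= h i; have := h i; rewrite /phi /B' /= !mxE.
Qed.

(** As [p.1] varies this runs through a line in the direction [j], which [p.2]
    determines. *)
Definition rV_insert n (j : 'I_n.+1) (p : measurableTypeR R * V n) : V n.+1 :=
  \row_i (if unlift j i is Some k then p.2 ord0 k else p.1).

Lemma rV_insert_id n (j : 'I_n.+1) p : rV_insert j p ord0 j = p.1.
Proof. by rewrite mxE unlift_none. Qed.

Lemma rV_insert_lift n (j : 'I_n.+1) p k :
  rV_insert j p ord0 (lift j k) = p.2 ord0 k.
Proof. by rewrite mxE liftK. Qed.

Lemma measurable_rV_insert n (j : 'I_n.+1) : measurable_fun setT (@rV_insert n j).
Proof.
apply: measurable_fun_rVP => i; case: (unliftP j i) => [k ->|->].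
  rewrite (_ : (fun x => _) = (fun v : V n => v ord0 k) \o snd).
    by apply: measurableT_comp => //; exact: measurable_rV_coord.
  by apply/funext => x; rewrite rV_insert_lift.
by rewrite (_ : (fun x => _) = fst)//; apply/funext => x; rewrite rV_insert_id.
Qed.

Lemma lebesgue_rV_insert n (j : 'I_n.+1) (A : set (V n.+1)) : measurable A ->
  (lebesgue_rV R n.+1 A =
    1%:E * (@lebesgue_measure R \x lebesgue_rV R n) (rV_insert j @^-1` A))%E.
Proof.
move=> mA; rewrite mul1e; have mphi := @measurable_rV_insert n j.
transitivity (image_measure (@lebesgue_measure R \x lebesgue_rV R n)%E mphi A) => //.
apply: lebesgue_rV_unique => // B mB; rewrite [LHS](_ : _ = (@lebesgue_measure R \x
  lebesgue_rV R n) (rV_insert j @^-1` box B))%E//.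
rewrite (_ : _ @^-1` _ = B j `*` box (fun k => B (lift j k))).
  rewrite product_measure1E//; last exact: measurable_box.
  rewrite lebesgue_boxE// (bigD1_ord j)//=.
apply/seteqP; split => -[s v] /=.
  move=> h; split; first by have := h j; rewrite rV_insert_id.
  by move=> k; have := h (lift j k); rewrite rV_insert_lift.
move=> [h1 h2] i; case: (unliftP j i) => [k ->|->].
  by rewrite rV_insert_lift; exact: h2.
by rewrite rV_insert_id.
Qed.

End lebesgue_box.

Section integration_rV.
Variable R : realType.
Local Notation V n := 'rV[measurableTypeR R]_n.
Local Notation leb := (@lebesgue_measure R).

Lemma cmeas_comp d1 d2 (T1 : measurableType d1) (T2 : measurableType d2)
    (f : T2 -> R[i]) (phi : T1 -> T2) :
  cmeas f -> measurable_fun setT phi -> cmeas (f \o phi).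
Proof.
by move=> [mr mi] mphi; split;
  [exact: (measurableT_comp mr mphi)|exact: (measurableT_comp mi mphi)].
Qed.

Lemma measurable_affine n (c : R) (y : V n) :
  measurable_fun setT (fun x : V n => (y + c *: (x : 'rV[R]_n) : V n)).
Proof.
apply: measurable_fun_rVP => i.
rewrite (_ : (fun x => _) = (fun x : V n => y ord0 i + c * x ord0 i)).
  by apply: measurable_funD => //; apply: measurable_funM => //; exact: measurable_rV_coord.
by apply/funext => x; rewrite !mxE.
Qed.

Lemma cint_affine n (c : R) (y : V n) (f : V n -> R[i]) : 0 < c ->
  cmeas f -> cintegrable (lebesgue_rV R n) f ->
  cintegrable (lebesgue_rV R n) (fun x : V n => f (y + c *: (x : 'rV[R]_n))) /\
  cint (lebesgue_rV R n) f = ((c ^+ n)%:C)%C *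
    cint (lebesgue_rV R n) (fun x : V n => f (y + c *: (x : 'rV[R]_n))).
Proof.
move=> c0 mf fi; have cn0 : 0 < c ^+ n by rewrite exprn_gt0.
have h A := @lebesgue_rV_affine R n c y A c0.
split; last exact: (cint_change (@measurable_affine n c y) cn0 h).
exact: (cintegrable_change (@measurable_affine n c y) cn0 h mf).1.
Qed.

Lemma cint_translate n (y : V n) (f : V n -> R[i]) :
  cmeas f -> cintegrable (lebesgue_rV R n) f ->
  cintegrable (lebesgue_rV R n) (fun x : V n => f (x + y)) /\
  cint (lebesgue_rV R n) (fun x : V n => f (x + y)) = cint (lebesgue_rV R n) f.
Proof.
move=> mf fi; have [] := @cint_affine n 1 y f ltr01 mf fi.
rewrite expr1n mul1r.
have -> : (fun x : V n => f (y + 1 *: (x : 'rV[R]_n))) = (fun x : V n => f (x + y)).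
  by apply/funext => x; rewrite scale1r addrC.
by move=> ? ->.
Qed.

Lemma ge0_integral_translate n (y : V n) (f : V n -> \bar R) :
  measurable_fun setT f -> (forall x, 0 <= f x)%E ->
  (\int[lebesgue_rV R n]_x f (x + y)%R = \int[lebesgue_rV R n]_x f x)%E.
Proof.
move=> mf f0; have h A := @lebesgue_rV_affine R n 1 y A ltr01.
have h' A : measurable A -> (lebesgue_rV R n A = 1%:E * lebesgue_rV R n
   ((fun x : V n => (y + 1 *: (x : 'rV[R]_n) : V n)%R) @^-1` A))%E.
  by move=> mA; rewrite h// expr1n.
rewrite (ge0_integral_change (@measurable_affine n 1 y) ltr01 h' mf f0) mul1e.
by apply: eq_integral => x _; rewrite scale1r addrC.
Qed.

Lemma cint_insert n (j : 'I_n.+1) (F : V n.+1 -> R[i]) :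
  cmeas F -> cintegrable (lebesgue_rV R n.+1) F ->
  cintegrable (lebesgue_rV R n) (fun v => cint leb (fun s => F (rV_insert j (s, v)))) /\
  cint (lebesgue_rV R n.+1) F =
  cint (lebesgue_rV R n) (fun v => cint leb (fun s => F (rV_insert j (s, v)))).
Proof.
move=> mF iF.
have h A := @lebesgue_rV_insert R n j A.
have iF' := (cintegrable_change (@measurable_rV_insert R n j) ltr01 h mF).1 iF.
rewrite (cint_change (@measurable_rV_insert R n j) ltr01 h mF iF) mul1r.
have [h1 h2] := cint_prod2 iF'.
by split => //; rewrite -h2.
Qed.

Lemma cintegrable_tensor d1 d2 (T1 : measurableType d1) (T2 : measurableType d2)
    (m1 : {sigma_finite_measure set T1 -> \bar R})
    (m2 : {sigma_finite_measure set T2 -> \bar R}) (f : T1 -> R[i]) (g : T2 -> R[i]) :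
  cintegrable m1 f -> cintegrable m2 g ->
  cintegrable (m1 \x m2)%E (fun z => f z.1 * g z.2) /\
  cint (m1 \x m2)%E (fun z => f z.1 * g z.2) = cint m1 f * cint m2 g.
Proof.
move=> fi gi; have [mf _] := fi; have [mg _] := gi.
have nf := cintegrable_norm fi.
have i12 : cintegrable (m1 \x m2)%E (fun z => f z.1 * g z.2).
  apply: (@cintegrable_prod _ _ _ _ _ _ _ _ (fun y => (\int[m1]_x normc (f x)) * normc (g y))).
  - apply: cmeasM; first exact: (cmeas_comp mf).
    exact: (cmeas_comp mg).
  - move=> y; rewrite (_ : \int[m1]_x _ =
        \int[m1]_x ((EFin \o (fun x => normc (f x))) x * (normc (g y))%:E))%E; last first.
      by apply: eq_integral => x _; rewrite normcM EFinM.
    rewrite (integralZr measurableT nf) /Rintegral EFinM fineK//.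
    exact: (integrable_fin_num measurableT nf).
  - by apply: integrableZ_EFin => //; exact: cintegrable_norm.
split => //; rewrite -(cint_prod1 i12).2 /=.
rewrite -cintZr//; congr cint; apply/funext => x.
by rewrite cintZ.
Qed.

Lemma cintegrable_real d (T : measurableType d) (mu : {measure set T -> \bar R})
    (g : T -> R) : mu.-integrable setT (EFin \o g) ->
  cintegrable mu (fun x => ((g x)%:C)%C).
Proof.
move=> gi; apply: cintegrable_ReIm => //=.
by rewrite (_ : _ \o _ = cst 0%E)//; exact: integrable0.
Qed.

(** Induction on the dimension, splitting off the first coordinate. *)
Lemma cint_prod_coord n (f : 'I_n -> R -> R[i]) :
  (forall i, cintegrable leb (f i)) ->
  cintegrable (lebesgue_rV R n) (fun v : V n => \prod_(i < n) f i (v ord0 i)) /\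
  cint (lebesgue_rV R n) (fun v : V n => \prod_(i < n) f i (v ord0 i)) =
    \prod_(i < n) cint leb (f i).
Proof.
elim: n f => [|n IH] f fi.
  rewrite big_ord0; under eq_fun do rewrite big_ord0.
  split; last first.
    by rewrite /cint /= !Rintegral_cst//= indicE in_setT mul1r mul0r.
  apply: (@cintegrable_real _ _ _ (fun=> 1)).
  exact: finite_measure_integrable_cst.
have [iG cG] := IH (fun k => f (lift ord0 k)) (fun k => fi _).
set G := (fun v : V n => _) in iG cG.
have h A := @lebesgue_rV_insert R n ord0 A.
set F := (fun v : V n.+1 => _).
have FE : F \o (rV_insert ord0) = (fun z => f ord0 z.1 * G z.2).
  apply/funext => -[s v]; rewrite /F /= big_ord_recl rV_insert_id; congr (_ * _).
  by apply: eq_bigr => k _; rewrite rV_insert_lift.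
have mF : cmeas F.
  rewrite /F; elim: (index_enum 'I_n.+1) => [|i s IHs].
    by under eq_fun do rewrite big_nil; exact: cmeas_cst.
  under eq_fun do rewrite big_cons.
  apply: cmeasM => //.
  exact: (cmeas_comp (fi i).1 (@measurable_rV_coord _ _ _ i)).
have [iT cT] := cintegrable_tensor (m1 := leb) (m2 := lebesgue_rV R n) (fi ord0) iG.
have iF : cintegrable (lebesgue_rV R n.+1) F.
  by apply/(cintegrable_change (@measurable_rV_insert R n ord0) ltr01 h mF); rewrite FE.
split => //.
rewrite (cint_change (@measurable_rV_insert R n ord0) ltr01 h mF iF) mul1r FE.
by rewrite cT cG big_ord_recl.
Qed.

Lemma cint_real d (T : measurableType d) (mu : {measure set T -> \bar R})
    (g : T -> R) : cint mu (fun x => ((g x)%:C)%C) = ((\int[mu]_x g x)%:C)%C.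
Proof. by rewrite /cint /= Rintegral_cst// mul0r. Qed.

Lemma Rintegral_prod_coord n (g : R -> R) : leb.-integrable setT (EFin \o g) ->
  (lebesgue_rV R n).-integrable setT (EFin \o (fun v : V n => \prod_(i < n) g (v ord0 i))) /\
  \int[lebesgue_rV R n]_v (\prod_(i < n) g (v ord0 i)) = (\int[leb]_x g x) ^+ n.
Proof.
move=> gi.
have [h1 h2] := @cint_prod_coord n (fun=> fun x => ((g x)%:C)%C) (fun=> cintegrable_real gi).
have e : (fun v : V n => \prod_(i < n) ((g (v ord0 i))%:C)%C) =
    (fun v : V n => ((\prod_(i < n) g (v ord0 i))%:C)%C).
  by apply/funext => v; rewrite rmorph_prod.
rewrite e in h1 h2; split; first exact: (cintegrable_Re h1).
move: h2; rewrite cint_real cint_real prodr_const card_ord -rmorphXn /=.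
by move/complexI.
Qed.

End integration_rV.

Section continuous_rV.
Variable R : realType.
Local Notation V n := 'rV[measurableTypeR R]_n.

(** An open set is the countable union of the rational cubes that it contains. *)
Lemma open_measurable_rV n (U : set 'rV[R]_n) : open U -> measurable (U : set (V n)).
Proof.
move=> oU.
pose C (q : 'rV[rat]_n) (k : nat) : set (V n) :=
  box (fun i => `](ratr (q ord0 i) - k.+1%:R^-1), (ratr (q ord0 i) + k.+1%:R^-1)[%classic).
have mC q k : measurable (C q k) by apply: measurable_box => i; exact: measurable_itv.
pose D (m : nat) : set (V n) :=
  if unpickle m is Some (q, k) then (if `[< C q k `<=` U >] then C q k else set0) else set0.
rewrite (_ : (U : set (V n)) = \bigcup_m D m).
  apply: bigcupT_measurable => m; rewrite /D; case: (unpickle m) => [[q k]|//].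
  by case: ifP.
apply/seteqP; split => x; last first.
  move=> [m _]; rewrite /D; case: (unpickle m) => [[q k]|//].
  by case: ifPn => // /asboolP; exact.
move=> Ux; have : nbhs (x : 'rV[R]_n) U by exact: open_nbhs_nbhs.
rewrite -nbhs_ballE => -[e /= e0 xeU].
have [k ke] : exists k : nat, k.+1%:R^-1 < e / 2.
  have e2 : 0 < e / 2 by rewrite divr_gt0.
  exists (Num.truncn ((e / 2)^-1)).
  by rewrite invf_plt ?posrE// truncnS_gt.
have /choice[q qP] : forall i : 'I_n, exists q : rat,
    (ratr q : R) \in `](x ord0 i - k.+1%:R^-1), (x ord0 i + k.+1%:R^-1)[.
  move=> i; have [|q ?] := @rat_in_itvoo R (x ord0 i - k.+1%:R^-1) (x ord0 i + k.+1%:R^-1).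
    by rewrite ltrD2l -subr_gt0 opprK addr_gt0.
  by exists q.
have CU : C (\row_i q i) k `<=` U.
  move=> y Cy; apply: xeU; split => // i j; rewrite (ord1 i) /ball /=.
  have := Cy j; rewrite /= mxE in_itv /=; have := qP j; rewrite in_itv /=.
  move: (ratr (q j)) ke => p; move: (k.+1%:R^-1) => r ke /andP[a b] /andP[c d].
  by rewrite ltr_norml; apply/andP; split; lra.
exists (pickle (\row_i q i, k)) => //; rewrite /D pickleK; case: ifPn => [_|/asboolP//].
move=> i /=; rewrite mxE in_itv /=; have := qP i; rewrite in_itv /=.
move: (ratr (q i)) => p; move: (k.+1%:R^-1) => r /andP[a b].
by apply/andP; split; lra.
Qed.

Lemma continuous_measurable_rV n (f : 'rV[R]_n -> R) :
  continuous f -> measurable_fun setT (f : V n -> R).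
Proof.
move=> cf; apply: (measurability _ (RGenOpens.measurableE R)).
move=> _ [_ [a [b ->] <-]]; rewrite setTI; apply: open_measurable_rV.
move/continuousP : cf; apply; exact: interval_open.
Qed.

Lemma measurable_dotp d (T : measurableType d) n (f g : T -> V n) :
  measurable_fun setT f -> measurable_fun setT g ->
  measurable_fun setT (fun x => dotp (f x : 'rV[R]_n) (g x)).
Proof.
move=> mf mg; rewrite /dotp.
elim: (index_enum 'I_n) => [|i s IHs].
  by under eq_fun do rewrite big_nil; exact: measurable_cst.
under eq_fun do rewrite big_cons.
apply: measurable_funD => //; apply: measurable_funM.
  exact: (measurableT_comp (@measurable_rV_coord _ _ _ i) mf).
exact: (measurableT_comp (@measurable_rV_coord _ _ _ i) mg).
Qed.

Lemma measurable_addV d (T : measurableType d) n (f g : T -> V n) :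
  measurable_fun setT f -> measurable_fun setT g ->
  measurable_fun setT (fun x => ((f x : 'rV[R]_n) + g x : V n)).
Proof.
move=> mf mg; apply: measurable_fun_rVP => i.
rewrite (_ : (fun x => _) = (fun x => f x ord0 i + g x ord0 i)).
  apply: measurable_funD.
    exact: (measurableT_comp (@measurable_rV_coord _ _ _ i) mf).
  exact: (measurableT_comp (@measurable_rV_coord _ _ _ i) mg).
by apply/funext => x; rewrite mxE.
Qed.

Lemma measurable_scaleV d (T : measurableType d) n (c : R) (f : T -> V n) :
  measurable_fun setT f ->
  measurable_fun setT (fun x => (c *: (f x : 'rV[R]_n) : V n)).
Proof.
move=> mf; apply: measurable_fun_rVP => i.
rewrite (_ : (fun x => _) = (fun x => c * f x ord0 i)).
  apply: measurable_funM => //.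
  exact: (measurableT_comp (@measurable_rV_coord _ _ _ i) mf).
by apply/funext => x; rewrite mxE.
Qed.

Lemma measurable_oppV d (T : measurableType d) n (f : T -> V n) :
  measurable_fun setT f ->
  measurable_fun setT (fun x => (- (f x : 'rV[R]_n) : V n)).
Proof.
move=> mf; rewrite (_ : (fun x => _) = (fun x => (-1) *: (f x : 'rV[R]_n))).
  exact: measurable_scaleV.
by apply/funext => x; rewrite scaleN1r.
Qed.

End continuous_rV.

Section bounded_support.
Variable R : realType.
Local Notation V n := 'rV[measurableTypeR R]_n.
Local Notation leb := (@lebesgue_measure R).

Definition cube n (L : R) : set (V n) := box (fun=> `[(- L), L]%classic).

Lemma measurable_cube n (L : R) : measurable (@cube n L).
Proof. by apply: measurable_box => i; exact: measurable_itv. Qed.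

Lemma lebesgue_cube n (L : R) : 0 <= L ->
  lebesgue_rV R n (cube L) = ((2 * L) ^+ n)%:E.
Proof.
move=> L0; rewrite lebesgue_boxE; last by move=> i; exact: measurable_itv.
rewrite (_ : 2 * L = L + L); last by rewrite mulr2n mulrDl mul1r.
have -> : (L + L) ^+ n = \prod_(i < n) (L + L) by rewrite prodr_const card_ord.
rewrite -prodEFin.
apply: eq_bigr => i _; rewrite lebesgue_measure_itv /= lte_fin.
case: ifPn => [_|]; first by rewrite -EFinD opprK.
by rewrite -leNgt => h; congr EFin; lra.
Qed.

Lemma integrable_cst_cube n (M L : R) : 0 <= L ->
  (lebesgue_rV R n).-integrable setT (EFin \o (fun v => M * \1_(cube L) v)) /\
  \int[lebesgue_rV R n]_v (M * \1_(cube L) v) = M * (2 * L) ^+ n.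
Proof.
move=> L0; have i1 : (lebesgue_rV R n).-integrable setT (EFin \o \1_(@cube n L)).
  have mL := @measurable_cube n L.
  apply/integrableP; split; first by apply/measurable_EFinP; exact: measurable_indic.
  rewrite (eq_integral (fun x => (\1_(cube L) x)%:E)); last first.
    by move=> t _; rewrite /= ger0_norm.
  by rewrite integral_indic// setIT [X in (X < _)%E](lebesgue_cube n L0) ltry.
split; first exact: integrableZ_EFin.
rewrite RintegralZl//; congr (_ * _).
rewrite /Rintegral integral_indic//; last exact: measurable_cube.
by rewrite setIT [X in fine X](lebesgue_cube n L0).
Qed.

Lemma cintegrable_cube n (M L : R) (F : V n -> R[i]) : 0 <= L ->
  cmeas F -> (forall v, normc (F v) <= M) ->
  (forall v, ~ cube L v -> F v = 0) ->
  cintegrable (lebesgue_rV R n) F /\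
  normc (cint (lebesgue_rV R n) F) <= M * (2 * L) ^+ n.
Proof.
move=> L0 mF FM F0; have [i1 e1] := @integrable_cst_cube n M L L0.
have FL v : normc (F v) <= M * \1_(cube L) v.
  rewrite indicE; have [_|] := boolP (v \in cube L); first by rewrite mulr1.
  by rewrite notin_setE => /F0 ->; rewrite normc0 mulr0.
have iF : cintegrable (lebesgue_rV R n) F by exact: le_cintegrable i1.
split => //; rewrite (le_trans (normc_cint iF))// -e1.
apply: le_Rintegral => //; exact: cintegrable_norm.
Qed.

(** Fubini's theorem in the direction [j]: the integral along a line vanishes
    unless the remaining coordinates lie in the cube, whose volume is
    [(2 L)^n]. *)
Lemma normc_cint_slices n (j : 'I_n.+1) (M L B : R) (F : V n.+1 -> R[i]) :
  0 <= L -> cmeas F -> (forall v, normc (F v) <= M) ->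
  (forall v, ~ cube L v -> F v = 0) ->
  (forall v, normc (cint leb (fun s => F (rV_insert j (s, v)))) <= B) ->
  normc (cint (lebesgue_rV R n.+1) F) <= B * (2 * L) ^+ n.
Proof.
move=> L0 mF FM F0 FB.
have [iF _] := cintegrable_cube L0 mF FM F0.
have [[iG _] ->] := @cint_insert R n j F mF iF.
apply: (cintegrable_cube L0 iG _ _).2 => //.
move=> v nv; rewrite (_ : (fun s => _) = fun=> 0).
  by rewrite /cint /= !Rintegral_cst//= !mul0r.
apply/funext => s; apply: F0 => h; apply: nv => i.
by have := h (lift j i); rewrite rV_insert_lift.
Qed.

End bounded_support.

Section decay.
Variable R : realType.
Local Notation V n := 'rV[measurableTypeR R]_n.
Local Notation leb := (@lebesgue_measure R).

(** Half of the integral is the limit of [atan] at infinity. *)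
Lemma integrable_cauchy :
  leb.-integrable setT (EFin \o (fun x : R => (1 + x ^+ 2)^-1)) /\
  \int[leb]_x (1 + x ^+ 2)^-1 = pi.
Proof.
have e : (\int[leb]_x ((1 + x ^+ 2)^-1)%:E = pi%:E :> \bar R)%E.
  have := @ge0_symfun_integralT R (fun x => (1 + x ^+ 2)^-1) _ _ _.
  move=> ->.
  - rewrite -set_itvcy integral0y_oneDsqr -EFinM; congr EFin.
    by rewrite mulrC -mulrA mulVf ?mulr1.
  - by move=> x; rewrite invr_ge0 addr_ge0// sqr_ge0.
  - exact: continuous_oneDsqrV.
  - by move=> x /=; rewrite sqrrN.
split; last by rewrite /Rintegral e.
apply/integrableP; split.
  apply/measurable_EFinP; apply: continuous_measurable_fun; exact: continuous_oneDsqrV.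
under eq_integral => x _ do rewrite /= ger0_norm ?invr_ge0 ?addr_ge0 ?sqr_ge0//.
by rewrite e ltry.
Qed.

Definition cauchy_prod n (v : V n) : R := \prod_(i < n) (1 + (v ord0 i) ^+ 2)^-1.

Lemma integrable_cauchy_prod n :
  (lebesgue_rV R n).-integrable setT (EFin \o @cauchy_prod n) /\
  \int[lebesgue_rV R n]_v cauchy_prod v = pi ^+ n.
Proof.
have [h1 h2] := integrable_cauchy.
by have [] := Rintegral_prod_coord n h1; rewrite h2.
Qed.

Lemma cauchy_prod_gt0 n (v : V n) : 0 < cauchy_prod v.
Proof.
by apply: prodr_gt0 => i _; rewrite invr_gt0 ltr_pwDl// sqr_ge0.
Qed.

Lemma integral_cauchy_scale n (c : R) : 0 < c ->
  (lebesgue_rV R n).-integrable setT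
    (EFin \o (fun v : V n => cauchy_prod (c *: (v : 'rV[R]_n)))) /\
  \int[lebesgue_rV R n]_v cauchy_prod (c *: (v : 'rV[R]_n)) = (pi / c) ^+ n.
Proof.
move=> c0; have [i1 e1] := integrable_cauchy_prod n.
have ic := cintegrable_real i1.
have [mc _] := ic.
have [h1 h2] := @cint_affine R n c 0 _ c0 mc ic.
have E : (fun x : V n => ((cauchy_prod (0 + c *: (x : 'rV[R]_n)))%:C)%C) =
   (fun x : V n => ((cauchy_prod (c *: (x : 'rV[R]_n)))%:C)%C).
  by apply/funext => x; rewrite add0r.
rewrite E in h1 h2; split; first exact: (cintegrable_Re h1).
move: h2; rewrite !cint_real e1 -rmorphM /= => /complexI h2.
by rewrite exprMn exprVn h2 mulrAC divff ?mul1r// expf_neq0// gt_eqF.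
Qed.

(** Decay in the largest coordinate alone already gives a majorant that is
    integrable over [R^n]: with [m] the maximum of 1 and the largest [|v_i|],
    each factor [1 + v_i^2] is at most [2 m^2]. *)
Lemma le_cauchy_prod n (v : V n) (a C : R) : 0 <= a -> a <= C ->
  (forall j, (forall i, `|v ord0 i| <= `|v ord0 j|) ->
    a * `|v ord0 j| ^+ (2 * n) <= C) ->
  a <= 2 ^+ n * C * cauchy_prod v.
Proof.
case: n v => [|n] v a0 aC h; first by rewrite /cauchy_prod big_ord0 mulr1 mul1r.
pose j := [arg max_(i > ord0 : 'I_n.+1) `|v ord0 i|]%O.
have jmax i : `|v ord0 i| <= `|v ord0 j|.
  by rewrite /j; case: arg_maxP => // k _; exact.
pose m := Num.max 1 `|v ord0 j|.
have m1 : 1 <= m by rewrite le_max lexx.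
have m0 : 0 < m by rewrite (lt_le_trans ltr01).
have am : a * m ^+ (2 * n.+1) <= C.
  rewrite /m; case: (leP 1 `|v ord0 j|) => _; first exact: h.
  by rewrite expr1n mulr1.
have mP : ((2 * m ^+ 2) ^+ n.+1)^-1 <= cauchy_prod v.
  rewrite -exprVn -[X in _ ^+ X]card_ord -prodr_const; apply: ler_prod => i _.
  rewrite invr_ge0 mulr_ge0 ?sqr_ge0//= lef_pV2 ?posrE ?ltr_pwDl ?sqr_ge0//.
    have : v ord0 i ^+ 2 <= m ^+ 2.
      rewrite -real_normK ?num_real// lerXn2r ?nnegrE ?(ltW m0)//.
      by rewrite le_max jmax orbT.
    have : 1 <= m ^+ 2 by rewrite expr_ge1// ltW.
    lra.
  by rewrite mulr_gt0// exprn_gt0.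
apply: (@le_trans _ _ (2 ^+ n.+1 * C * ((2 * m ^+ 2) ^+ n.+1)^-1)); last first.
  by rewrite ler_wpM2l// mulr_ge0 ?exprn_ge0// (le_trans a0).
rewrite exprMn -exprM invfM mulrACA divff ?expf_neq0// mul1r.
by rewrite ler_pdivlMr// exprn_gt0.
Qed.

End decay.

(** * One-dimensional oscillatory integrals *)

Section calculus.
Variable R : realType.
Implicit Types f g p q a b : R -> R.
Local Notation leb := (@lebesgue_measure R).

Definition has_deriv f f' := forall s : R, is_derive s 1 f (f' s).

Lemma ctsD f g : continuous f -> continuous g -> continuous (fun s => f s + g s).
Proof. by move=> cf cg s; apply: continuousD; [exact: cf|exact: cg]. Qed.

Lemma ctsM f g : continuous f -> continuous g -> continuous (fun s => f s * g s).
Proof. by move=> cf cg s; apply: continuousM; [exact: cf|exact: cg]. Qed.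

Lemma cts_cst (c : R) : continuous (fun _ : R => c).
Proof. exact: cst_continuous. Qed.

Lemma cts_comp f g : continuous f -> continuous g -> continuous (fun s => f (g s)).
Proof. by move=> cf cg s; apply: (continuous_comp (cg s)); exact: cf. Qed.

Lemma has_deriv_cts f f' : has_deriv f f' -> continuous f.
Proof.
move=> h s; have [d _] := h s.
by apply: differentiable_continuous; exact/derivable1_diffP.
Qed.

Lemma has_deriv_cst (c : R) : has_deriv (fun=> c) (fun=> 0).
Proof. by move=> s; exact: is_derive_cst. Qed.

Lemma has_deriv_id : has_deriv id (fun=> 1).
Proof. by move=> s; exact: is_derive_id. Qed.

Lemma has_derivD f f' g g' : has_deriv f f' -> has_deriv g g' ->
  has_deriv (fun s => f s + g s) (fun s => f' s + g' s).
Proof. by move=> hf hg s; exact: is_deriveD. Qed.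

Lemma has_derivM f f' g g' : has_deriv f f' -> has_deriv g g' ->
  has_deriv (fun s => f s * g s) (fun s => f' s * g s + f s * g' s).
Proof.
move=> hf hg s; apply: is_derive_eq; first exact: (is_deriveM (hf s) (hg s)).
by rewrite /GRing.scale /= addrC mulrC.
Qed.

Lemma has_derivZ (c : R) f f' : has_deriv f f' ->
  has_deriv (fun s => c * f s) (fun s => c * f' s).
Proof.
move=> hf s; have := has_derivM (has_deriv_cst c) hf s.
by rewrite mul0r add0r.
Qed.

Lemma has_deriv_comp f f' g g' : has_deriv f f' -> has_deriv g g' ->
  has_deriv (fun s => f (g s)) (fun s => g' s * f' (g s)).
Proof.
move=> hf hg s; apply: is_derive_eq; first exact: (is_derive1_comp (hf (g s)) (hg s)).
by rewrite /GRing.scale /= mulrC.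
Qed.

Lemma has_derivV f f' : (forall s, f s != 0) -> has_deriv f f' ->
  has_deriv (fun s => (f s)^-1) (fun s => - (f' s * ((f s)^-1 * (f s)^-1))).
Proof.
move=> f0 hf s; apply: is_derive_eq; first exact: (is_deriveV (f0 s) (hf s)).
by rewrite /GRing.scale /= mulNr mulrC expr2 invfM.
Qed.

Lemma has_deriv_cos : has_deriv cos (fun s => - sin s).
Proof. by move=> s; exact: is_derive_cos. Qed.

Lemma has_deriv_sin : has_deriv sin cos.
Proof. by move=> s; exact: is_derive_sin. Qed.

Lemma has_deriv_uniq f f' f'' : has_deriv f f' -> has_deriv f f'' -> f' = f''.
Proof. by move=> h1 h2; apply/funext => s; have [_ <-] := h1 s; have [_ <-] := h2 s. Qed.

Lemma has_deriv_supp f f' (L : R) : has_deriv f f' ->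
  (forall s, L < `|s| -> f s = 0) -> forall s, L < `|s| -> f' s = 0.
Proof.
move=> hf f0 s sL; have [_ <-] := hf s.
rewrite (@near_eq_derive _ _ _ f (cst 0)) ?derive_cst//.
have : \forall t \near s, L < `|t|.
  have : (fun t => `|t|) @ s --> `|s| by apply: norm_continuous.
  by move/cvgr_gt; exact.
by apply: filterS => t; exact: f0.
Qed.

Lemma FTC_segment F f (u v : R) : u < v -> has_deriv F f -> continuous f ->
  \int[leb]_(s in `[u, v]) f s = F v - F u.
Proof.
move=> uv hF cf; rewrite /Rintegral (@continuous_FTC2 _ _ F)//.
- exact: continuous_subspaceT.
- have cF := has_deriv_cts hF; split.
  + by move=> s _; have [] := hF s.
  + by apply: cvg_at_right_filter; exact: cF.
  + by apply: cvg_at_left_filter; exact: cF.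
- by move=> s _; rewrite derive1E; have [_ ->] := hF s.
Qed.

Lemma integrable_segment f (u v : R) : continuous f ->
  leb.-integrable `[u, v] (EFin \o f).
Proof.
move=> cf; apply: continuous_compact_integrable; first exact: segment_compact.
exact: continuous_subspaceT.
Qed.

(** One constant [M] bounds all derivatives up to order [k], so that uniformity
    in parameters is uniformity of a single number.  The top derivative is
    required to be continuous so that the fundamental theorem of calculus
    applies to it. *)
Fixpoint Cb (k : nat) (M : R) f : Prop :=
  (forall s, `|f s| <= M) /\
  if k is k'.+1 then exists2 f', has_deriv f f' & Cb k' M f' else continuous f.

Lemma Cb_bound k M f : Cb k M f -> forall s, `|f s| <= M.
Proof. by case: k => [|k] []. Qed.

Lemma Cb_ge0 k M f : Cb k M f -> 0 <= M.
Proof. by move=> /Cb_bound/(_ 0); apply: le_trans. Qed.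

Lemma Cb_continuous k M f : Cb k M f -> continuous f.
Proof. by case: k => [|k] [_ //] [f' hf _]; exact: has_deriv_cts hf. Qed.

Lemma Cb_le k M M' f : M <= M' -> Cb k M f -> Cb k M' f.
Proof.
move=> MM; elim: k f => [|k IH] f [fM h]; split.
- by move=> s; exact: le_trans MM.
- by [].
- by move=> s; exact: le_trans MM.
- by case: h => f' hf /IH; exists f'.
Qed.

Lemma Cb_pred k M f : Cb k.+1 M f -> Cb k M f.
Proof.
elim: k f => [|k IH] f [fM [f' hf Hf']]; split => //.
  exact: has_deriv_cts hf.
by exists f' => //; exact: IH.
Qed.

Lemma Cb_cst k (c : R) : Cb k `|c| (fun=> c).
Proof.
elim: k c => [|k IH] c; split=> //; first exact: cst_continuous.
exists (fun=> 0); first exact: has_deriv_cst.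
by apply: (@Cb_le _ `|0|) (IH 0); rewrite normr0.
Qed.

Lemma CbD k M M' f g : Cb k M f -> Cb k M' g -> Cb k (M + M') (fun s => f s + g s).
Proof.
elim: k f g => [|k IH] f g [fM hf] [gM hg]; split.
- by move=> s; rewrite (le_trans (ler_normD _ _))// lerD.
- by move=> s; apply: continuousD; [exact: hf|exact: hg].
- by move=> s; rewrite (le_trans (ler_normD _ _))// lerD.
- case: hf => f' hf cf; case: hg => g' hg cg.
  by exists (fun s => f' s + g' s); [exact: has_derivD|exact: IH].
Qed.

Lemma CbZ k M (c : R) f : Cb k M f -> Cb k (`|c| * M) (fun s => c * f s).
Proof.
elim: k f => [|k IH] f [fM hf]; split.
- by move=> s; rewrite normrM ler_wpM2l.
- by move=> s; apply: continuousM; [exact: cst_continuous|exact: hf].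
- by move=> s; rewrite normrM ler_wpM2l.
- case: hf => f' hf cf.
  by exists (fun s => c * f' s); [exact: has_derivZ|exact: IH].
Qed.

(** The factor [2^k] counts the terms of the Leibniz rule. *)
Lemma CbM k M M' f g : Cb k M f -> Cb k M' g ->
  Cb k (2 ^+ k * (M * M')) (fun s => f s * g s).
Proof.
elim: k f g => [|k IH] f g Hf Hg.
  case: Hf (Cb_ge0 Hf) => fM hf M0; case: Hg => gM hg; split.
    by move=> s; rewrite expr0 mul1r normrM ler_pM.
  by move=> s; apply: continuousM; [exact: hf|exact: hg].
have M0 := Cb_ge0 Hf; have M0' := Cb_ge0 Hg.
have pf := Cb_pred Hf; have pg := Cb_pred Hg.
case: Hf => fM [f' hf cf]; case: Hg => gM [g' hg cg]; split.
  move=> s; rewrite normrM; apply: (@le_trans _ _ (M * M')); first exact: ler_pM.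
  by rewrite ler_peMl ?mulr_ge0// exprn_ege1// ler1n.
exists (fun s => f' s * g s + f s * g' s); first exact: has_derivM.
rewrite exprS -mulrA mulr_natl mulr2n.
by apply: CbD; exact: IH.
Qed.

(** The inverse [q = 1 / p] satisfies [q' = - p' q^2], so that bounds on [q] up
    to order [k] give bounds up to order [k + 1]. *)
Lemma CbV k M : exists M', forall p, (forall s, 1 <= p s) -> Cb k M p ->
  Cb k M' (fun s => (p s)^-1).
Proof.
elim: k => [|k [M' IH]].
  exists 1 => p p1 [pM cp]; split.
    move=> s; have p0 : 0 < p s by rewrite (lt_le_trans ltr01).
    by rewrite ger0_norm ?invr_ge0 ?(ltW p0)// invf_le1.
  by move=> s; apply: continuousV; [rewrite gt_eqF// (lt_le_trans ltr01)|exact: cp].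
exists (Num.max 1 (`|-1| * (2 ^+ k * (M * (2 ^+ k * (M' * M')))))) => p p1 Hp.
have p0 s : 0 < p s by rewrite (lt_le_trans ltr01).
have Hq := IH p p1 (Cb_pred Hp).
case: Hp => pM [p' hp cp]; split.
  move=> s; rewrite ger0_norm ?invr_ge0 ?(ltW (p0 s))// le_max; apply/orP; left.
  by rewrite invf_le1.
exists (fun s => -1 * (p' s * ((p s)^-1 * (p s)^-1))).
  move=> s; rewrite mulN1r; apply: has_derivV hp s => t.
  by rewrite gt_eqF.
apply: (@Cb_le _ (`|-1| * (2 ^+ k * (M * (2 ^+ k * (M' * M')))))).
  by rewrite le_max lexx orbT.
by apply: CbZ; apply: CbM => //; exact: CbM.
Qed.

End calculus.

Section oscillatory.
Variable R : realType.
Local Notation leb := (@lebesgue_measure R).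
Variables (L : R) (L0 : 0 <= L).
(* Amplitudes supported in [-L, L] vanish at the endpoints of [-K, K]. *)
Let K := L + 1.

Let K0 : 0 < K. Proof. by rewrite ltr_wpDl. Qed.
Let KE : - K < K. Proof. by rewrite (lt_trans _ K0)// oppr_lt0. Qed.

Let supp_endpoint (b : R -> R) : (forall s, L < `|s| -> b s = 0) ->
  b K = 0 /\ b (- K) = 0.
Proof.
by move=> b0; split; apply: b0; rewrite ?normrN ger0_norm ?(ltW K0)// ltrDl.
Qed.

(** The derivative of [exp (i g) q a] is [i A exp (i g) a + exp (i g) (q a)'],
    since [p q = 1], and its integral vanishes; the two identities are the real
    and imaginary parts of this. *)
Lemma oscillatory_by_parts (A : R) (g p q a b1 : R -> R) :
  has_deriv g (fun s => A * p s) -> continuous p ->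
  (forall s, p s * q s = 1) -> continuous a ->
  has_deriv (fun s => q s * a s) b1 -> continuous b1 ->
  (forall s, L < `|s| -> a s = 0) ->
  A * \int[leb]_(s in `[- K, K]) (sin (g s) * a s) =
    \int[leb]_(s in `[- K, K]) (cos (g s) * b1 s) /\
  A * \int[leb]_(s in `[- K, K]) (cos (g s) * a s) =
    - \int[leb]_(s in `[- K, K]) (sin (g s) * b1 s).
Proof.
move=> hg cp pq ca hb cb a0.
have cg := has_deriv_cts hg.
have ccos : continuous (fun s => cos (g s)).
  by move=> s; apply: (continuous_comp (cg s)); exact: continuous_cos.
have csin : continuous (fun s => sin (g s)).
  by move=> s; apply: (continuous_comp (cg s)); exact: continuous_sin.
have cm (u v : R -> R) : continuous u -> continuous v -> continuous (fun s => u s * v s).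
  by move=> cu cv s; apply: continuousM; [exact: cu|exact: cv].
have cd (u v : R -> R) : continuous u -> continuous v -> continuous (fun s => u s + v s).
  by move=> cu cv s; apply: continuousD; [exact: cu|exact: cv].
have cz (c : R) (u : R -> R) : continuous u -> continuous (fun s => c * u s).
  by move=> cu; apply: cm => //; exact: cst_continuous.
have [bK bNK] : (q K * a K = 0) /\ (q (- K) * a (- K) = 0).
  by have [-> ->] := supp_endpoint a0; rewrite !mulr0.
have i1 := integrable_segment (- K) K (cm _ _ csin ca).
have i2 := integrable_segment (- K) K (cm _ _ ccos ca).
have i3 := integrable_segment (- K) K (cm _ _ ccos cb).
have i4 := integrable_segment (- K) K (cm _ _ csin cb).
have mI : measurable (`[- K, K]%classic : set (measurableTypeR R)) by exact: measurable_itv.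
split.
  have h := has_derivM (has_deriv_comp (@has_deriv_cos R) hg) hb.
  have e : (fun s => A * p s * - sin (g s) * (q s * a s) + cos (g s) * b1 s) =
     (fun s => (- A) * (sin (g s) * a s) + cos (g s) * b1 s).
    by apply/funext => s; have := pq s; move: (p s) (q s) (sin _) => x y z xy; ring: xy.
  rewrite e in h.
  have ch : continuous (fun s => (- A) * (sin (g s) * a s) + cos (g s) * b1 s).
    by apply: cd; [apply: cz; exact: cm|exact: cm].
  have := FTC_segment KE h ch; rewrite bK bNK !mulr0 subr0.
  rewrite RintegralD//; last exact: integrableZ_EFin.
  by rewrite RintegralZl// mulNr => /eqP; rewrite addrC subr_eq0 => /eqP.
have h := has_derivM (has_deriv_comp (@has_deriv_sin R) hg) hb.
have e : (fun s => A * p s * cos (g s) * (q s * a s) + sin (g s) * b1 s) =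
   (fun s => A * (cos (g s) * a s) + sin (g s) * b1 s).
  by apply/funext => s; have := pq s; move: (p s) (q s) (cos _) => x y z xy; ring: xy.
rewrite e in h.
have ch : continuous (fun s => A * (cos (g s) * a s) + sin (g s) * b1 s).
  by apply: cd; [apply: cz; exact: cm|exact: cm].
have := FTC_segment KE h ch; rewrite bK bNK !mulr0 subr0.
rewrite RintegralD//; last exact: integrableZ_EFin.
by rewrite RintegralZl// => /eqP; rewrite addr_eq0 => /eqP.
Qed.

(** Each integration by parts gains a factor [1/A]; the constant depends only on
    the bounds for [q] and [a]. *)
Lemma oscillatory_decay (N : nat) (Mq Ma : R) : exists2 C, 0 <= C &
  forall (A : R) (g p q a : R -> R), A != 0 ->
  has_deriv g (fun s => A * p s) -> continuous p ->
  (forall s, p s * q s = 1) -> Cb N Mq q -> Cb N Ma a ->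
  (forall s, L < `|s| -> a s = 0) ->
  `|\int[leb]_(s in `[- K, K]) (cos (g s) * a s)| * `|A| ^+ N <= C /\
  `|\int[leb]_(s in `[- K, K]) (sin (g s) * a s)| * `|A| ^+ N <= C.
Proof.
have mI : measurable (`[- K, K]%classic : set (measurableTypeR R)) by exact: measurable_itv.
elim: N Ma => [|N IH] Ma.
  exists (`|Ma| * (2 * K)); first by rewrite mulr_ge0// mulr_ge0// ltW.
  move=> A g p q a A0 hg cp pq Hq [aM ca] a0; rewrite expr0 !mulr1.
  have key (u : R -> R) : continuous u -> (forall s, `|u s| <= 1) ->
      `|\int[leb]_(s in `[- K, K]) (u s * a s)| <= `|Ma| * (2 * K).
    move=> cu u1; have ci : continuous (fun s => u s * a s).
      by move=> s; apply: continuousM; [exact: cu|exact: ca].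
    rewrite (le_trans (le_normr_Rintegral mI (integrable_segment _ _ ci)))//.
    have i1 : leb.-integrable `[- K, K] (EFin \o (fun=> `|Ma|)).
      by apply: integrable_segment; exact: cst_continuous.
    apply: (@le_trans _ _ (\int[leb]_(s in `[- K, K]) `|Ma|)).
      apply: le_Rintegral => //.
        by apply: integrable_norm; exact: integrable_segment.
      by move=> s _; rewrite normrM -[leRHS]mul1r ler_pM// (le_trans (aM s))// ler_norm.
    rewrite Rintegral_cst// [X in fine X](lebesgue_measure_itv `[- K, K]) /= lte_fin KE /= opprK.
    by rewrite mulr2n mulrDl mul1r.
  have cg := has_deriv_cts hg.
  split; apply: key.
  - by move=> s; apply: (continuous_comp (cg s)); exact: continuous_cos.
  - by move=> s; rewrite ler_norml cos_geN1 cos_le1.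
  - by move=> s; apply: (continuous_comp (cg s)); exact: continuous_sin.
  - by move=> s; rewrite ler_norml sin_geN1 sin_le1.
have [C C0 {}IH] := IH (2 ^+ N.+1 * (Mq * Ma)).
exists C => // A g p q a A0 hg cp pq Hq Ha a0.
have [_ [b1 hb Hb]] := CbM Hq Ha.
have b10 : forall s, L < `|s| -> b1 s = 0.
  by apply: has_deriv_supp hb _ => s /a0 ->; rewrite mulr0.
have [e1 e2] := oscillatory_by_parts hg cp pq (Cb_continuous Ha) hb (Cb_continuous Hb) a0.
have [h1 h2] := IH A g p q b1 A0 hg cp pq (Cb_pred Hq) Hb b10.
rewrite exprS; split.
  by rewrite mulrA -normrM [_ * A]mulrC e2 normrN.
by rewrite mulrA -normrM [_ * A]mulrC e1.
Qed.

Lemma normc_oscillatory (N : nat) (Mq Ma : R) : exists2 C, 0 <= C &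
  forall (A : R) (g p q a : R -> R), A != 0 ->
  has_deriv g (fun s => A * p s) -> continuous p ->
  (forall s, p s * q s = 1) -> Cb N Mq q -> Cb N Ma a ->
  (forall s, L < `|s| -> a s = 0) ->
  normc (cint leb (fun s => expi (g s) * ((a s)%:C)%C)) * `|A| ^+ N <= C.
Proof.
have [C C0 HC] := oscillatory_decay N Mq Ma.
exists (C + C); first exact: addr_ge0.
move=> A g p q a A0 hg cp pq Hq Ha a0.
have [h1 h2] := HC A g p q a A0 hg cp pq Hq Ha a0.
have e (u : R -> R) : \int[leb]_(s in `[- K, K]) (u s * a s) = \int[leb]_s (u s * a s).
  rewrite Rintegral_mkcond; apply: eq_Rintegral => s _; rewrite patchE.
  case: ifPn => // /negP sK; rewrite a0 ?mulr0//.
  rewrite ltNge; apply/negP => sL; apply: sK; rewrite inE /= in_itv /=.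
  by rewrite -ler_norml (le_trans sL)// lerDl.
rewrite !e in h1 h2.
have -> : cint leb (fun s => expi (g s) * ((a s)%:C)%C) =
    ((\int[leb]_s (cos (g s) * a s)) +i* (\int[leb]_s (sin (g s) * a s)))%C.
  by congr (_ +i* _)%C; apply: eq_Rintegral => s _ /=; rewrite mulr0 ?subr0 ?add0r.
apply: (@le_trans _ _ ((`|\int[leb]_s (cos (g s) * a s)| + `|\int[leb]_s (sin (g s) * a s)|) *
  `|A| ^+ N)).
  rewrite ler_wpM2r ?exprn_ge0// -(@ler_pXn2r _ 2%N)// ?nnegrE ?normc_ge0 ?addr_ge0//.
  by rewrite sqr_normcE /= sqrrD !real_normK ?num_real// -addrA lerD2l lerDr mulrn_wge0//
    mulr_ge0.
by rewrite mulrDl lerD.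
Qed.

End oscillatory.

(** * Smooth compactly supported functions *)

Section smooth.
Variable R : realType.
Implicit Types (f g w zeta chi : R -> R).

Lemma Cb_shift k M (h : R) f : Cb k M f -> Cb k M (fun s => f (s + h)).
Proof.
elim: k f => [|k IH] f [fM hf]; split.
- by move=> s; exact: fM.
- move=> s; apply: (@continuous_comp _ _ _ (fun s => s + h)); last exact: hf.
  by apply: cvgD; [exact: cvg_id|exact: cvg_cst].
- by move=> s; exact: fM.
- case: hf => f' hf cf; exists (fun s => f' (s + h)); last exact: IH.
  have h1 : has_deriv (fun s => s + h) (fun=> 1 + 0).
    exact: (has_derivD (@has_deriv_id R) (has_deriv_cst h)).
  have := has_deriv_comp hf h1.
  rewrite (_ : (fun s => (1 + 0) * f' (s + h)) = (fun s => f' (s + h)))//.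
  by apply/funext => s; rewrite addr0 mul1r.
Qed.

Lemma has_deriv_dilate (c : R) f f' : has_deriv f f' ->
  has_deriv (fun s => f (c * s)) (fun s => c * f' (c * s)).
Proof.
move=> hf; have h1 := has_derivZ c (@has_deriv_id R).
have := has_deriv_comp hf h1.
rewrite (_ : (fun s => (c * 1) * f' (c * s)) = (fun s => c * f' (c * s)))//.
by apply/funext => s; rewrite mulr1.
Qed.

Lemma Cb_dilate k M (c : R) f : Cb k M f ->
  exists M', Cb k M' (fun s => f (c * s)).
Proof.
elim: k f => [|k IH] f [fM hf].
  exists M; split; first by move=> s; exact: fM.
  move=> s; apply: (@continuous_comp _ _ _ (fun s => c * s)); last exact: hf.
  by apply: cvgM; [exact: cvg_cst|exact: cvg_id].
case: hf => f' hf /IH[M' HM'].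
exists (Num.max M (`|c| * M')); split.
  by move=> s; rewrite le_max fM.
exists (fun s => c * f' (c * s)); first exact: has_deriv_dilate.
by apply: (@Cb_le _ _ (`|c| * M')); [rewrite le_max lexx orbT|exact: CbZ].
Qed.

Definition smoothc w :=
  (exists B, forall s, B < `|s| -> w s = 0) /\ (forall k, exists M, Cb k M w).

Lemma smoothc_deriv w : smoothc w -> exists2 w', has_deriv w w' & smoothc w'.
Proof.
move=> [[B wB] wk]; have [M [_ [w' hw _]]] := wk 1%N.
exists w' => //; split; first by exists B; exact: has_deriv_supp hw wB.
move=> k; have [M' [_ [w'' hw'' Hw'']]] := wk k.+1.
by exists M'; rewrite (has_deriv_uniq hw hw'').
Qed.

Lemma smoothcZ (c : R) w : smoothc w -> smoothc (fun s => c * w s).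
Proof.
move=> [[B wB] wk]; split; first by exists B => s /wB ->; rewrite mulr0.
by move=> k; have [M HM] := wk k; exists (`|c| * M); exact: CbZ.
Qed.

Lemma smoothcD w v : smoothc w -> smoothc v -> smoothc (fun s => w s + v s).
Proof.
move=> [[B wB] wk] [[B' vB] vk]; split.
  by exists (Num.max B B') => s; rewrite gt_max => /andP[/wB -> /vB ->]; rewrite addr0.
move=> k; have [M HM] := wk k; have [M' HM'] := vk k.
by exists (M + M'); exact: CbD.
Qed.

Lemma smoothc_dilate (c : R) w : 0 < c -> smoothc w -> smoothc (fun s => w (c * s)).
Proof.
move=> c0 [[B wB] wk]; split; last by move=> k; have [M /Cb_dilate] := wk k; exact.
exists (B / c) => s; rewrite ltr_pdivrMr// => h; apply: wB.
by rewrite normrM (gtr0_norm c0) mulrC.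
Qed.

Lemma continuous_supp_bounded f (L : R) : continuous f ->
  (forall s, L < `|s| -> f s = 0) -> exists M, forall s, `|f s| <= M.
Proof.
move=> cf f0; pose K := Num.max 0 L.
have K0 : 0 <= K by rewrite le_max lexx.
have NK : - K <= K by rewrite (le_trans _ K0)// oppr_le0.
have cn : {within `[- K, K], continuous (fun s => `|f s|)}.
  apply: continuous_subspaceT => s; apply: (continuous_comp (cf s)).
  exact: norm_continuous.
have [c _ hc] := EVT_max NK cn.
exists `|f c| => s; have [sK|sK] := leP `|s| K.
  by apply: hc; rewrite in_itv /= -ler_norml.
rewrite f0 ?normr0//; apply: le_lt_trans sK.
by rewrite le_max lexx orbT.
Qed.

Lemma cutoff_far chi s : cutoff chi -> 2 < `|s| -> chi s = 0.
Proof.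
move=> [_ _ _ _ supp] s2; apply/eqP; apply: contraTT s2 => cs.
have : closure [set s | chi s != 0] s by exact: subset_closure.
by move=> /supp; rewrite /= in_itv /= -leNgt -ler_norml.
Qed.

Lemma cutoff_smooth chi : cutoff chi -> smoothc chi.
Proof.
move=> hchi; have chi0 s : 2 < `|s| -> chi s = 0 by exact: cutoff_far.
have [_ dchi _ _ _] := hchi.
have hd k : has_deriv (chi^`(k))%classic (chi^`(k.+1))%classic.
  move=> s; rewrite derive1nS derive1E; apply: derivableP; exact: dchi.
have s0 k : forall s, 2 < `|s| -> (chi^`(k))%classic s = 0.
  elim: k => [|k IH]; first by rewrite derive1n0.
  exact: has_deriv_supp (hd k) IH.
split; first by exists 2.
move=> k; rewrite -(derive1n0 chi); move: 0%N.
elim: k => [|k IH] j.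
  have [M HM] := continuous_supp_bounded (has_deriv_cts (hd j)) (s0 j).
  by exists M; split=> //; exact: has_deriv_cts (hd j).
have [M HM] := continuous_supp_bounded (has_deriv_cts (hd j)) (s0 j).
have [M' HM'] := IH j.+1.
exists (Num.max M M'); split; first by move=> s; rewrite le_max HM.
exists (chi^`(j.+1))%classic; first exact: hd.
by apply: Cb_le HM'; rewrite le_max lexx orbT.
Qed.

(** The radial function [zeta(|xi|) |xi|^(2a)] as a function of [u = |xi|^2]. *)
Definition radial_cut zeta (a u : R) : R :=
  if 0 < u then zeta (Num.sqrt u) * u `^ a else 0.

Lemma radial_cut_supp zeta (a B u : R) : 0 <= B ->
  (forall s, B < `|s| -> zeta s = 0) -> B ^+ 2 < `|u| -> radial_cut zeta a u = 0.
Proof.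
move=> B0 zB Bu; rewrite /radial_cut; case: ifPn => // u0.
rewrite zB ?mul0r// ger0_norm ?sqrtr_ge0// -(@ltr_pXn2r _ 2%N)// ?nnegrE ?sqrtr_ge0//.
by rewrite sqr_sqrtr ?(ltW u0)// -(gtr0_norm u0).
Qed.

(** Since [zeta] vanishes near 0, so does [radial_cut zeta a] near [u <= 0];
    for [u > 0] the derivative is again a combination of functions of this
    form. *)
Lemma radial_cut_deriv zeta zeta' (a c : R) : 0 < c ->
  (forall s, `|s| < c -> zeta s = 0) -> has_deriv zeta zeta' ->
  has_deriv (radial_cut zeta a)
    (fun u => radial_cut (fun s => 2^-1 * zeta' s) (a - 2^-1) u +
              a * radial_cut zeta (a - 1) u).
Proof.
move=> c0 zc hz u; have [u0|u0] := ltP 0 u; last first.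
  rewrite /radial_cut !ltNge u0 /= mulr0 addr0.
  apply: near_eq_is_derive (has_deriv_cst 0 u).
  near=> v; rewrite /radial_cut; case: ifPn => // v0.
  rewrite zc ?mul0r// ger0_norm ?sqrtr_ge0// -(@ltr_pXn2r _ 2%N)// ?nnegrE ?sqrtr_ge0 ?(ltW c0)//.
  rewrite sqr_sqrtr ?(ltW v0)//; near: v.
  by apply: cvgr_lt; [exact: cvg_id|rewrite (le_lt_trans u0)// exprn_gt0].
have h1 := is_derive1_comp (hz (Num.sqrt u)) (is_derive1_sqrt u0).
have h2 := is_derive1_powR a u0.
apply: (near_eq_is_derive _ (is_derive_eq (is_deriveM h1 h2) _)).
  near=> v; rewrite /radial_cut ifT//; near: v.
  by apply: cvgr_gt; [exact: cvg_id|].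
rewrite /radial_cut u0.
rewrite /GRing.scale /= [u `^ (a - 2^-1)]powRB; last by rewrite (gt_eqF u0) implybT.
rewrite powR12_sqrt ?(ltW u0)// invfM.
by ring.
Unshelve. all: by end_near. Qed.

(** Differentiation shifts the exponent [a] and replaces [zeta] by its
    derivative, hence the induction on the order for all [zeta] and [a]
    simultaneously; the lowest order is bounded because it is continuous with
    compact support. *)
Lemma radial_cut_smooth zeta (a c : R) : 0 < c ->
  (forall s, `|s| < c -> zeta s = 0) -> smoothc zeta ->
  smoothc (radial_cut zeta a).
Proof.
move=> c0 zc hz; have supp (z : R -> R) b : smoothc z -> exists B,
    forall u, B < `|u| -> radial_cut z b u = 0.
  move=> [[B zB] _]; exists (Num.max 0 B ^+ 2) => u.
  apply: radial_cut_supp; first by rewrite le_max lexx.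
  by move=> s; rewrite gt_max => /andP[_ /zB].
split; first exact: supp.
have cts (z : R -> R) b : (forall s, `|s| < c -> z s = 0) -> smoothc z ->
    continuous (radial_cut z b).
  by move=> zc' /smoothc_deriv[z' hz' _]; apply: has_deriv_cts; exact: (radial_cut_deriv b c0
    zc' hz').
move=> k; elim: k zeta a zc hz => [|k IH] zeta a zc hz.
  have [B hB] := supp zeta a hz.
  have [M HM] := continuous_supp_bounded (cts _ a zc hz) hB.
  by exists M; split => //; exact: cts.
have [B hB] := supp zeta a hz.
have [M HM] := continuous_supp_bounded (cts _ a zc hz) hB.
have [z' hz' sz'] := smoothc_deriv hz.
have z'c t : `|t| < c -> z' t = 0.
  move=> tc; have [_ <-] := hz' t.
  rewrite (@near_eq_derive _ _ _ zeta (cst 0)) ?derive_cst//.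
  have : \forall v \near t, `|v| < c.
    have : (fun v => `|v|) @ t --> `|t| by apply: norm_continuous.
    by move/cvgr_lt; exact.
  by apply: filterS => v; exact: zc.
have [M1 HM1] := IH (fun s => 2^-1 * z' s) (a - 2^-1)
  (fun s sc => etrans (congr1 _ (z'c s sc)) (mulr0 _)) (smoothcZ _ sz').
have [M2 HM2] := IH zeta (a - 1) zc hz.
exists (Num.max M (M1 + `|a| * M2)); split; first by move=> s; rewrite le_max HM.
eexists; first exact: (radial_cut_deriv a c0 zc hz').
apply: (@Cb_le _ _ (M1 + `|a| * M2)); first by rewrite le_max lexx orbT.
by apply: CbD => //; exact: CbZ.
Qed.

End smooth.

(** * Radial functions along lines *)

Section slices.
Variable R : realType.
Implicit Types (F G : R -> R -> R) (w : R -> R).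

(** On a line in a coordinate direction, [w (|xi|^2)] is [w (x^2 + s^2)] with
    [x] the distance from the line to the origin.  This class is the closure of
    these functions of [(x, s)] under both partial derivatives; all its members
    are bounded, which makes every bound uniform in the line. *)
Inductive radial2 : (R -> R -> R) -> Prop :=
| radial2_base w of smoothc w : radial2 (fun x s => w (x ^+ 2 + s ^+ 2))
| radial2_mulx F of radial2 F : radial2 (fun x s => x * F x s)
| radial2_muls F of radial2 F : radial2 (fun x s => s * F x s)
| radial2_add F G of radial2 F & radial2 G : radial2 (fun x s => F x s + G x s).

Lemma radial2_swap F : radial2 F -> radial2 (fun x s => F s x).
Proof.
elim=> [w sw|F0 _ IH|F0 _ IH|F0 G _ IHF _ IHG].
- rewrite (_ : (fun x s => _) = (fun x s => w (x ^+ 2 + s ^+ 2))).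
    exact: radial2_base.
  by apply/funext => x; apply/funext => s; rewrite addrC.
- exact: radial2_muls IH.
- exact: radial2_mulx IH.
- exact: radial2_add.
Qed.

Lemma radial2_bound F : radial2 F -> exists B M, [/\ 0 <= B, 0 <= M,
  (forall x s, `|F x s| <= M) &
  forall x s, B < `|x| \/ B < `|s| -> F x s = 0].
Proof.
elim=> [w [[B0 wB] wk]|F0 _ [B [M [B0 M0 FM FB]]]|F0 _ [B [M [B0 M0 FM FB]]]|
    F0 G _ [B [M [B0 M0 FM FB]]] _ [B' [M' [B0' M0' GM GB]]]].
- have [M HM] := wk 0%N; exists (1 + `|B0|), M.
  have P : 1 <= 1 + `|B0| by rewrite lerDl.
  split=> [||x s|x s xs].
  + by rewrite addr_ge0.
  + exact: Cb_ge0 HM.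
  + exact: Cb_bound HM _.
  + apply: wB.
    have B1 : 1 + `|B0| <= (1 + `|B0|) ^+ 2 by rewrite expr2 ler_peMl// (le_trans _ P).
    have B2 : B0 < 1 + `|B0| by rewrite (le_lt_trans (ler_norm _))// ltrDr.
    rewrite ger0_norm ?addr_ge0 ?sqr_ge0//.
    have sq (z : R) : 1 + `|B0| < `|z| -> B0 < z ^+ 2.
      move=> h; rewrite (lt_le_trans B2)// (le_trans B1)// -[leRHS]real_normK ?num_real//.
      by rewrite ler_pXn2r ?nnegrE ?(ltW h) ?addr_ge0.
    by case: xs => /sq h; apply: (lt_le_trans h); rewrite ?lerDl ?lerDr sqr_ge0.
- exists B, (B * M); split=> //; first exact: mulr_ge0.
    move=> x s; rewrite normrM; have [xB|xB] := leP `|x| B; first exact: ler_pM.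
    by rewrite FB ?normr0 ?mulr0 ?mulr_ge0//; left.
  by move=> x s /FB ->; rewrite mulr0.
- exists B, (B * M); split=> //; first exact: mulr_ge0.
    move=> x s; rewrite normrM; have [xB|xB] := leP `|s| B; first exact: ler_pM.
    by rewrite FB ?normr0 ?mulr0 ?mulr_ge0//; right.
  by move=> x s /FB ->; rewrite mulr0.
- exists (Num.max B B'), (M + M'); split.
  + by rewrite le_max B0.
  + exact: addr_ge0.
  + by move=> x s; rewrite (le_trans (ler_normD _ _))// lerD.
  + move=> x s; rewrite !gt_max => h.
    rewrite FB ?GB ?addr0//; first by case: h => /andP[_ h]; [left|right].
    by case: h => /andP[h _]; [left|right].
Qed.

Lemma radial2_ds F : radial2 F ->
  exists2 F', radial2 F' & forall x, has_deriv (F x) (F' x).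
Proof.
elim=> [w sw|F0 _ [F' HF' h]|F0 HF [F' HF' h]|F0 G _ [F' HF' hF] _ [G' HG' hG]].
- have [w' hw sw'] := smoothc_deriv sw.
  exists (fun x s => s * (2 * w' (x ^+ 2 + s ^+ 2))).
    apply: radial2_muls; exact: (radial2_base (smoothcZ 2 sw')).
  move=> x.
  have h1 : has_deriv (fun s => x ^+ 2 + s ^+ 2) (fun s => 0 + (1 * s + s * 1)).
    apply: has_derivD; first exact: has_deriv_cst.
    exact: (has_derivM (@has_deriv_id R) (@has_deriv_id R)).
  have := has_deriv_comp hw h1.
  set u := (fun s => _ * _); rewrite (_ : u = (fun s => s * (2 * w' (x ^+ 2 + s ^+ 2))))//.
  by apply/funext => s; rewrite /u; ring.
- by exists (fun x s => x * F' x s); [exact: radial2_mulx|move=> x; exact: has_derivZ].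
- exists (fun x s => F0 x s + s * F' x s).
    by apply: radial2_add => //; exact: radial2_muls.
  move=> x; have := has_derivM (@has_deriv_id R) (h x).
  set u := (fun s => _ + _); rewrite (_ : u = (fun s => F0 x s + s * F' x s))//.
  by apply/funext => s; rewrite /u mul1r.
- exists (fun x s => F' x s + G' x s); first exact: radial2_add.
  by move=> x; exact: has_derivD.
Qed.

Lemma radial2_dx F : radial2 F ->
  exists2 F', radial2 F' & forall s, has_deriv (F^~ s) (F'^~ s).
Proof.
move=> /radial2_swap/radial2_ds[F' HF' h].
by exists (fun x s => F' s x); [exact: radial2_swap|].
Qed.

Lemma has_deriv_lipschitz (f f' : R -> R) (M : R) : has_deriv f f' ->
  (forall s, `|f' s| <= M) -> forall a b, `|f b - f a| <= M * `|b - a|.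
Proof.
move=> hf fM.
have key a b : a <= b -> `|f b - f a| <= M * `|b - a|.
  move=> ab; have [] := @MVT_segment R f f' a b ab.
  - by move=> x _; exact: hf.
  - by apply: continuous_subspaceT; exact: has_deriv_cts hf.
  by move=> c _ ->; rewrite normrM ler_wpM2r.
move=> a b; have [/key//|/ltW/key] := leP a b.
by rewrite distrC [`|a - b|]distrC.
Qed.

Lemma radial2_Cb F k : radial2 F -> exists M, forall x, Cb k M (F x).
Proof.
elim: k F => [|k IH] F HF.
  have [B [M [_ _ FM _]]] := radial2_bound HF.
  have [F' _ hF'] := radial2_ds HF.
  by exists M => x; split; [exact: FM|exact: has_deriv_cts (hF' x)].
have [B [M [_ _ FM _]]] := radial2_bound HF.
have [F' HF' hF'] := radial2_ds HF.
have [M' HM'] := IH F' HF'.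
exists (Num.max M M') => x; split; first by move=> s; rewrite le_max FM.
by exists (F' x) => //; apply: Cb_le (HM' x); rewrite le_max lexx orbT.
Qed.

(** The mean value theorem in each of the two variables, applied to the
    derivatives in [s], which belong to the same class. *)
Lemma radial2_diff_Cb F k : radial2 F -> exists2 M, 0 <= M &
  forall x x' h, Cb k (M * (`|x' - x| + `|h|)) (fun s => F x' (s + h) - F x s).
Proof.
have base F0 : radial2 F0 -> exists2 M, 0 <= M &
    forall x x' h s, `|F0 x' (s + h) - F0 x s| <= M * (`|x' - x| + `|h|).
  move=> HF; have [Fs HFs hs] := radial2_ds HF; have [Fx HFx hx] := radial2_dx HF.
  have [_ [Ms [_ Ms0 FsM _]]] := radial2_bound HFs.
  have [_ [Mx [_ Mx0 FxM _]]] := radial2_bound HFx.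
  exists (Ms + Mx); first exact: addr_ge0.
  (* Moving first the line, then the point on it. *)
  move=> x x' h s.
  have h1 := has_deriv_lipschitz (hx (s + h)) (fun y => FxM y (s + h)) x x'.
  have h2 := has_deriv_lipschitz (hs x) (FsM x) s (s + h).
  rewrite [s + h - s]addrC addKr in h2.
  have -> : F0 x' (s + h) - F0 x s =
      (F0 x' (s + h) - F0 x (s + h)) + (F0 x (s + h) - F0 x s) by rewrite addrA subrK.
  rewrite (le_trans (ler_normD _ _))// (le_trans (lerD h1 h2))//.
  have := normr_ge0 (x' - x); have := normr_ge0 h; nra.
elim: k F => [|k IH] F HF.
  have [M M0 HM] := base F HF; have [F' _ hF'] := radial2_ds HF.
  exists M => // x x' h; split => // s; apply: continuousB.
    apply: (@continuous_comp _ _ _ (fun s => s + h)).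
      by apply: cvgD; [exact: cvg_id|exact: cvg_cst].
    exact: (has_deriv_cts (hF' x')).
  exact: (has_deriv_cts (hF' x)).
have [M M0 HM] := base F HF; have [F' HF' hF'] := radial2_ds HF.
have [M' M0' HM'] := IH F' HF'.
exists (Num.max M M'); first by rewrite le_max M0.
move=> x x' h; have n0 : 0 <= `|x' - x| + `|h| by exact: addr_ge0.
split; first by move=> s; rewrite (le_trans (HM _ _ _ _))// ler_wpM2r// le_max lexx.
exists (fun s => F' x' (s + h) - F' x s); last first.
  by apply: Cb_le (HM' x x' h); rewrite ler_wpM2r// le_max lexx orbT.
have h1 : has_deriv (fun s => s + h) (fun=> 1 + 0).
  exact: (has_derivD (@has_deriv_id R) (has_deriv_cst h)).
have h2 := has_derivD (has_deriv_comp (hF' x') h1) (has_derivZ (-1) (hF' x)).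
rewrite (_ : (fun s => F x' (s + h) - F x s) =
  (fun s => F x' (s + h) + -1 * F x s)); last by apply/funext => s; rewrite mulN1r.
rewrite (_ : (fun s => F' x' (s + h) - F' x s) =
  (fun s => (1 + 0) * F' x' (s + h) + -1 * F' x s))//.
by apply/funext => s; rewrite mulN1r addr0 mul1r.
Qed.

End slices.

(** * Decay of oscillatory integrals over [R^n] *)

Section euclid.
Variables (R : realType) (n : nat).
Implicit Types x y z : 'rV[R]_n.

Lemma dotpC x y : dotp x y = dotp y x.
Proof. by apply: eq_bigr => i _; rewrite mulrC. Qed.

Lemma dotpDl x y z : dotp (x + y) z = dotp x z + dotp y z.
Proof.
by rewrite /dotp -big_split; apply: eq_bigr => i _; rewrite mxE mulrDl.
Qed.

Lemma dotpDr x y z : dotp z (x + y) = dotp z x + dotp z y.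
Proof. by rewrite dotpC dotpDl !(dotpC z). Qed.

Lemma dotpZl (c : R) x y : dotp (c *: x) y = c * dotp x y.
Proof.
by rewrite /dotp mulr_sumr; apply: eq_bigr => i _; rewrite mxE mulrA.
Qed.

Lemma dotpZr (c : R) x y : dotp x (c *: y) = c * dotp x y.
Proof. by rewrite dotpC dotpZl dotpC. Qed.

Lemma dotpNl x y : dotp (- x) y = - dotp x y.
Proof. by rewrite -scaleN1r dotpZl mulN1r. Qed.

Lemma dotpNr x y : dotp x (- y) = - dotp x y.
Proof. by rewrite dotpC dotpNl dotpC. Qed.

Lemma dotp_ge0 x : 0 <= dotp x x.
Proof. by apply: sumr_ge0 => i _; rewrite -expr2 sqr_ge0. Qed.

Lemma le_sqr_dotp x i : x ord0 i ^+ 2 <= dotp x x.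
Proof.
rewrite /dotp (bigD1 i)//= expr2 lerDl.
by apply: sumr_ge0 => k _; rewrite -expr2 sqr_ge0.
Qed.

Lemma enorm_ge0 x : 0 <= enorm x.
Proof. exact: sqrtr_ge0. Qed.

Lemma sqr_enorm x : enorm x ^+ 2 = dotp x x.
Proof. by rewrite sqr_sqrtr// dotp_ge0. Qed.

Lemma cauchy_schwarz x y : dotp x y ^+ 2 <= dotp x x * dotp y y.
Proof.
have := dotp_ge0 (dotp y y *: x - dotp x y *: y).
rewrite !(dotpDl, dotpDr, dotpNl, dotpNr, dotpZl, dotpZr) (dotpC y x).
have := dotp_ge0 y; rewrite le_eqVlt => /predU1P[y0 _|y0].
  rewrite -y0 mulr0.
  have y00 i : y ord0 i = 0.
    by apply/eqP; rewrite -sqrf_eq0 eq_le sqr_ge0 andbT y0 le_sqr_dotp.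
  by rewrite /dotp big1 ?expr0n// => i _; rewrite y00 mulr0.
set a := dotp x x; set b := dotp y y; set c := dotp x y => h.
have {}h : 0 <= b * (a * b - c ^+ 2) by move: h; lra.
by move: h; rewrite pmulr_rge0// subr_ge0.
Qed.

Lemma enormD x y : enorm (x + y) <= enorm x + enorm y.
Proof.
rewrite -(@ler_pXn2r _ 2%N)// ?nnegrE ?enorm_ge0 ?addr_ge0 ?enorm_ge0//.
rewrite sqrrD !sqr_enorm dotpDl !dotpDr (dotpC y x).
have : dotp x y <= enorm x * enorm y.
  rewrite (le_trans (ler_norm _))// -(@ler_pXn2r _ 2%N)// ?nnegrE ?mulr_ge0 ?enorm_ge0//.
  by rewrite real_normK ?num_real// exprMn !sqr_enorm cauchy_schwarz.
by rewrite mulr2n; lra.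
Qed.

Lemma enormN x : enorm (- x) = enorm x.
Proof. by rewrite /enorm dotpNl dotpNr opprK. Qed.

Lemma enorm_diff x y : `|enorm (x + y) - enorm x| <= enorm y.
Proof.
have h1 := enormD x y; have := enormD (x + y) (- y).
rewrite addrK enormN => h2; rewrite ler_norml; apply/andP; split; lra.
Qed.

Lemma enorm_le_max x (H : R) : (forall i, `|x ord0 i| <= H) -> enorm x <= n%:R * H.
Proof.
move=> xH; have [n0|[i0 _]] : #|'I_n| = 0%N \/ exists i : 'I_n, true.
- have [->|n0] := eqVneq n 0%N; first by left; rewrite card_ord.
  by right; rewrite -lt0n in n0; exists (Ordinal n0).
- rewrite card_ord in n0; rewrite /enorm /dotp big1 ?sqrtr0 ?n0 ?mul0r//.
  by move=> i; exfalso; case: i => i; rewrite n0.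
have H0 : 0 <= H by rewrite (le_trans _ (xH i0)).
rewrite -(@ler_pXn2r _ 2%N)// ?nnegrE ?enorm_ge0 ?mulr_ge0//.
rewrite sqr_enorm exprMn.
apply: (@le_trans _ _ (n%:R * H ^+ 2)).
  rewrite -[X in X%:R * _](card_ord n) mulr_natl -sumr_const; apply: ler_sum => i _.
  by rewrite -expr2 -real_normK ?num_real// ler_pXn2r ?nnegrE ?xH.
rewrite ler_wpM2r ?sqr_ge0// -natrX ler_nat.
by rewrite (expnD n 1 1) expn1 leq_pmulr// (leq_ltn_trans _ (ltn_ord i0)).
Qed.

End euclid.

Section insertion.
Variable R : realType.
Local Notation V n := 'rV[measurableTypeR R]_n.

Lemma rV_insertD n (j : 'I_n.+1) (s t : R) (u v : V n) :
  (rV_insert j (s, u) : 'rV[R]_n.+1) + rV_insert j (t, v) =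
  rV_insert j (s + t, (u : 'rV[R]_n) + v).
Proof.
apply/rowP => i; rewrite !mxE; case: (unliftP j i) => [k _|_] //=.
by rewrite mxE.
Qed.

Lemma rV_insertE n (j : 'I_n.+1) (x : V n.+1) :
  x = rV_insert j (x ord0 j, \row_k x ord0 (lift j k)).
Proof. by apply/rowP => i; rewrite mxE; case: (unliftP j i) => [k ->|->] /=; rewrite ?mxE. Qed.

Lemma dotp_insert n (j : 'I_n.+1) (s t : R) (u v : V n) :
  dotp (rV_insert j (s, u) : 'rV[R]_n.+1) (rV_insert j (t, v)) =
  s * t + dotp (u : 'rV[R]_n) v.
Proof.
rewrite /dotp (bigD1_ord j)//= !rV_insert_id; congr (_ + _).
by apply: eq_bigr => k _; rewrite !rV_insert_lift.
Qed.

Lemma sqr_insert n (j : 'I_n.+1) (s : R) (u : V n) :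
  dotp (rV_insert j (s, u) : 'rV[R]_n.+1) (rV_insert j (s, u)) =
  enorm (u : 'rV[R]_n) ^+ 2 + s ^+ 2.
Proof. by rewrite dotp_insert sqr_enorm addrC expr2. Qed.

End insertion.

Section decay_rV.
Variables (R : realType) (n : nat).
Local Notation V n := 'rV[measurableTypeR R]_n.
Local Notation leb := (@lebesgue_measure R).
Local Notation lam := (lebesgue_rV R n.+1).

(** Integrating by parts along the lines in a single direction suffices: the
    constant does not depend on the direction, on the phase or on the
    parameter [A] that measures its slope. *)
Lemma normc_cint_axis (N : nat) (L M Mq Ma : R) : 0 <= L -> exists2 C, 0 <= C &
  forall (j : 'I_n.+1) (A : R) (G b : V n.+1 -> R), A != 0 ->
  measurable_fun setT G -> measurable_fun setT b ->
  (forall x, `|b x| <= M) -> (forall x, ~ cube L x -> b x = 0) ->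
  (forall v : V n, exists p q, [/\ has_deriv (fun s => G (rV_insert j (s, v))) (fun s => A * p s),
     continuous p, (forall s, p s * q s = 1), Cb N Mq q &
     Cb N Ma (fun s => b (rV_insert j (s, v)))]) ->
  normc (cint lam (fun x => expi (G x) * ((b x)%:C)%C)) * `|A| ^+ N <= C.
Proof.
move=> L0; have [C C0 HC] := @normc_oscillatory R L L0 N Mq Ma.
exists (C * (2 * L) ^+ n); first by rewrite mulr_ge0// exprn_ge0// mulr_ge0.
move=> j A G b A0 mG mb bM b0 hyp.
have AN : 0 < `|A| ^+ N by rewrite exprn_gt0// normr_gt0.
rewrite -ler_pdivlMr// mulrAC.
apply: (@normc_cint_slices _ _ j M L (C / `|A| ^+ N)) => //.
- by apply: cmeasM; [exact: cmeas_expi|exact: cmeas_real].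
- by move=> x; rewrite normcM normc_expi mul1r normc_real.
- by move=> x /b0 ->; rewrite mulr0.
move=> v; have [p [q [hG cp pq Hq Hb]]] := hyp v.
rewrite ler_pdivlMr//; apply: (HC A _ p q) => //.
move=> s sL; apply: b0 => h; have := h j.
by rewrite rV_insert_id /= in_itv /= -ler_norml leNgt sL.
Qed.

Lemma radial_supp_cube (r : R -> R) : smoothc r -> exists2 L, 0 <= L &
  forall x : V n.+1, ~ cube L x -> r (dotp (x : 'rV[R]_n.+1) x) = 0.
Proof.
move=> [[B rB] _]; exists (1 + `|B|); first by rewrite addr_ge0.
move=> x nx; apply: rB; rewrite ger0_norm ?dotp_ge0//.
have [i xi] : exists i, 1 + `|B| < `|x ord0 i|.
  apply: contrapT => h; apply: nx => i /=; rewrite in_itv /= -ler_norml leNgt.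
  by apply/negP => xi; apply: h; exists i.
rewrite (lt_le_trans _ (le_sqr_dotp _ i))// -real_normK ?num_real//.
have := ler_norm B; have := normr_ge0 B; move: (`|B|) (`|x ord0 i|) xi => b t; nra.
Qed.

Lemma measurable_radial d (T : measurableType d) (r : R -> R) (f : T -> V n.+1) : smoothc r ->
  measurable_fun setT f ->
  measurable_fun setT (fun x => r (dotp (f x : 'rV[R]_n.+1) (f x))).
Proof.
move=> [_ /(_ 0%N)[M /Cb_continuous cr]] mf.
apply: (@measurableT_comp _ _ _ _ _ _ r).
  exact: continuous_measurable_fun.
exact: measurable_dotp.
Qed.

(** Non-stationary phase for the linear phase [x . xi], along the axis where
    [|x_j|] is largest; [2n] integrations by parts give integrability in [x]. *)
Lemma radial_fourier_decay (r : R -> R) : smoothc r -> exists2 C, 0 <= C &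
  forall x : V n.+1,
  normc (cint lam (fun xi => expi (dotp (x : 'rV[R]_n.+1) xi) * ((r (dotp (xi : 'rV[R]_n.+1)
    xi))%:C)%C))
    <= C * cauchy_prod x.
Proof.
move=> sr; have [L L0 rL] := radial_supp_cube sr.
have [M0 HM0] := sr.2 0%N; have rM := Cb_bound HM0.
have [Ma HMa] := radial2_Cb (2 * n.+1) (radial2_base sr).
have [C C0 HC] := @normc_cint_axis (2 * n.+1) L M0 `|1| Ma L0.
have mr : measurable_fun setT (fun xi : V n.+1 => r (dotp (xi : 'rV[R]_n.+1) xi)).
  by apply: measurable_radial => //; exact: measurable_id.
have mx (x : V n.+1) : measurable_fun setT (fun xi : V n.+1 => dotp (x : 'rV[R]_n.+1) xi).
  by apply: measurable_dotp; [exact: measurable_cst|exact: measurable_id].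
exists (2 ^+ n.+1 * Num.max (M0 * (2 * L) ^+ n.+1) C).
  by rewrite mulr_ge0 ?exprn_ge0// le_max C0 orbT.
move=> x; apply: le_cauchy_prod; first exact: normc_ge0.
  rewrite le_max; apply/orP; left.
  apply: (cintegrable_cube L0 _ _ _).2.
  - by apply: cmeasM; [exact: cmeas_expi|exact: cmeas_real].
  - by move=> v; rewrite normcM normc_expi mul1r normc_real.
  - by move=> v /rL ->; rewrite mulr0.
move=> j _; have [->|xj] := eqVneq (x ord0 j) 0.
  by rewrite normr0 expr0n /= mulr0 le_max C0 orbT.
rewrite le_max; apply/orP; right; apply: (HC j) => // v.
exists (fun=> 1), (fun=> 1); split.
- rewrite [x](rV_insertE j).
  have := has_derivD (has_derivZ (x ord0 j) (@has_deriv_id R))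
    (has_deriv_cst (dotp (\row_k x ord0 (lift j k) : 'rV[R]_n) v)).
  rewrite (_ : (fun s => x ord0 j * 1 + 0) = (fun s => x ord0 j * 1)).
    rewrite rV_insert_id.
    rewrite (_ : (fun s => _ + _) = (fun s => dotp (rV_insert j (x ord0 j, \row_k x ord0 (lift
      j k)) : 'rV[R]_n.+1) (rV_insert j (s, v))))//.
    by apply/funext => s; rewrite dotp_insert.
  by apply/funext => s; rewrite addr0.
- exact: cst_continuous.
- by move=> s; rewrite mulr1.
- exact: Cb_cst.
- rewrite (_ : (fun s => _) = (fun s => r (enorm (v : 'rV[R]_n) ^+ 2 + s ^+ 2))).
    exact: HMa.
  by apply/funext => s; rewrite sqr_insert.
Qed.

End decay_rV.

(** * The dispersive bound for the kernel *)

Section square.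
Variables (R : realType) (n : nat).
Local Notation V := 'rV[measurableTypeR R]_n.
Local Notation lam := (lebesgue_rV R n).

Lemma cintegrable_autocorrelation (f : V -> R[i]) : cintegrable lam f ->
  cintegrable (lam \x lam)%E (fun z : V * V => conjc (f z.2) * f ((z.2 : 'rV[R]_n) + z.1)).
Proof.
move=> fi; have [mf _] := fi; have nf := cintegrable_norm fi.
have mnf := measurable_normc mf.
have mfE : measurable_fun setT (fun x => (normc (f x))%:E) by exact/measurable_EFinP.
apply: (@cintegrable_prod _ _ _ _ _ _ _ _ (fun x => (\int[lam]_h normc (f h)) * normc (f x))).
- apply: cmeasM.
    by apply: cmeas_conj; apply: (@cmeas_comp _ _ _ _ _ f snd) => //; exact: measurable_snd.
  apply: (@cmeas_comp _ _ _ _ _ f (fun z : V * V => (z.2 : 'rV[R]_n) + z.1)) => //.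
  by apply: measurable_addV; [exact: measurable_snd|exact: measurable_fst].
- move=> x; rewrite (_ : \int[lam]_h _ =
      \int[lam]_h ((normc (f x))%:E * (normc (f ((h : 'rV[R]_n) + x)%R))%:E))%E; last first.
    by apply: eq_integral => h _; rewrite normcM normc_conj EFinM addrC.
  rewrite ge0_integralZl//; last 3 first.
  + apply/measurable_EFinP; apply: (measurableT_comp mnf).
    by apply: measurable_addV; [exact: measurable_id|exact: measurable_cst].
  + by move=> h _; rewrite lee_fin normc_ge0.
  + by rewrite lee_fin normc_ge0.
  rewrite (ge0_integral_translate x mfE); last by move=> h; rewrite lee_fin normc_ge0.
  rewrite /Rintegral EFinM fineK 1?muleC//.
  exact: (integrable_fin_num measurableT nf).
- exact: integrableZ_EFin.
Qed.

(** [|\int f|^2] is the integral over [h] of the autocorrelation of [f]. *)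
Lemma sqr_normc_cint (f : V -> R[i]) (g : V -> R) : cintegrable lam f ->
  lam.-integrable setT (EFin \o g) ->
  (forall h, normc (cint lam (fun x => conjc (f x) * f ((x : 'rV[R]_n) + h))) <= g h) ->
  normc (cint lam f) ^+ 2 <= \int[lam]_h g h.
Proof.
move=> fi gi hg; have [mf _] := fi.
have iF := cintegrable_autocorrelation fi.
have [iJ _] := cint_prod1 iF.
have fci : cintegrable lam (fun x => conjc (f x)).
  split; first exact: cmeas_conj.
  rewrite (_ : (fun x => _) = (fun x => (normc (f x))%:E)); first by case: fi.
  by apply/funext => x; rewrite normc_conj.
have e : cint lam (fun h => cint lam (fun x => conjc (f x) * f ((x : 'rV[R]_n) + h))) =
    conjc (cint lam f) * cint lam f.
  rewrite (cint_swap iF) -cint_conj// -cintZr//; congr cint; apply/funext => x /=.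
  have [i1 <-] := cint_translate x mf fi.
  rewrite -cintZ//; congr cint; apply/funext => h.
  by rewrite addrC.
rewrite expr2 -[X in X * _]normc_conj -normcM -e.
rewrite (le_trans (normc_cint iJ))//.
by apply: le_Rintegral => //; [exact: cintegrable_norm iJ|move=> h _; exact: hg].
Qed.

End square.

Section dispersive.
Variables (R : realType) (n : nat).
Local Notation V n := 'rV[measurableTypeR R]_n.
Local Notation lam := (lebesgue_rV R n.+1).

(** The phase of the rescaled propagator: a quadratic phase plus a small smooth
    radial perturbation and a linear term. *)
Definition phase (w : R -> R) (T delta : R) (y xi : 'rV[R]_n.+1) : R :=
  T * (dotp xi xi + delta * w (dotp xi xi)) + dotp y xi.

Lemma measurable_phase (w : R -> R) T delta y d (U : measurableType d) (f : U -> V n.+1) :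
  smoothc w -> measurable_fun setT f -> measurable_fun setT (fun u => phase w T delta y (f u)).
Proof.
move=> sw mf; apply: measurable_funD.
  apply: measurable_funM => //; apply: measurable_funD.
    exact: measurable_dotp.
  by apply: measurable_funM => //; exact: measurable_radial.
by apply: measurable_dotp => //; exact: measurable_cst.
Qed.

(** The increment of the phase in the direction [h] has, in the coordinate [j]
    where [h] is largest, a derivative comparable to [T h_j]; the perturbation
    contributes at most half of it when [delta] is small. *)
Lemma phase_increment_decay (r w : R -> R) : smoothc r -> smoothc w ->
  exists delta0 C, [/\ 0 < delta0, 0 <= C &
  forall (T delta : R) (y h : V n.+1), T != 0 -> `|delta| <= delta0 ->
  normc (cint lam (fun xi =>
    expi (phase w T delta y ((xi : 'rV[R]_n.+1) + h) - phase w T delta y xi) *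
    ((r (dotp (xi : 'rV[R]_n.+1) xi) *
      r (dotp ((xi : 'rV[R]_n.+1) + h) ((xi : 'rV[R]_n.+1) + h)))%:C)%C))
  <= C * cauchy_prod (T *: (h : 'rV[R]_n.+1))].
Proof.
move=> sr sw; pose N := (2 * n.+1)%N.
have [L L0 rL] := @radial_supp_cube R n r sr.
have [M0 HM0] := sr.2 0%N; have rM := Cb_bound HM0.
have [Ma HMa] := radial2_Cb N (radial2_base sr).
have [F' HF' hF'] := radial2_ds (radial2_base sw).
have [Mw Mw0 HMw] := radial2_diff_Cb N HF'.
have [Mq HMq] := @CbV R N 3.
have [C C0 HC] := @normc_cint_axis R n N L (M0 * M0) Mq (2 ^+ N * (Ma * Ma)) L0.
(* The distances to the origin of the two lines differ by at most [n |h_j|], so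
   [`|delta| <= K^-1] keeps the relative perturbation of the slope below 1. *)
pose K := 1 + Mw * (n%:R + 1).
have K0 : 0 < K by rewrite ltr_wpDr// mulr_ge0// addr_ge0.
exists K^-1, (2 ^+ n.+1 * Num.max (M0 * M0 * (2 * L) ^+ n.+1) C).
split; first by rewrite invr_gt0.
  by rewrite mulr_ge0 ?exprn_ge0// le_max C0 orbT.
move=> T delta y h T0 delta0.
pose G (xi : V n.+1) := phase w T delta y ((xi : 'rV[R]_n.+1) + h) - phase w T delta y xi.
pose b (xi : V n.+1) := r (dotp (xi : 'rV[R]_n.+1) xi) *
      r (dotp ((xi : 'rV[R]_n.+1) + h) ((xi : 'rV[R]_n.+1) + h)).
rewrite -[X in cint _ X]/(fun xi => expi (G xi) * ((b xi)%:C)%C).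
have mh : measurable_fun setT (fun xi : V n.+1 => ((xi : 'rV[R]_n.+1) + h : V n.+1)).
  by apply: measurable_addV; [exact: measurable_id|exact: measurable_cst].
have mG : measurable_fun setT G.
  apply: measurable_funB; apply: measurable_phase => //; exact: measurable_id.
have mb : measurable_fun setT b.
  apply: measurable_funM; apply: measurable_radial => //; exact: measurable_id.
have bM xi : `|b xi| <= M0 * M0 by rewrite normrM ler_pM.
have b0 xi : ~ cube L xi -> b xi = 0 by move=> nx; rewrite /b rL// mul0r.
apply: le_cauchy_prod; first exact: normc_ge0.
  rewrite le_max; apply/orP; left.
  apply: (cintegrable_cube L0 _ _ _).2.
  - by apply: cmeasM; [exact: cmeas_expi|exact: cmeas_real].
  - by move=> v; rewrite normcM normc_expi mul1r normc_real.
  - by move=> v /b0 ->; rewrite mulr0.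
move=> j jmax; rewrite mxE; rewrite le_max; have [->|hj] := eqVneq (h ord0 j) 0.
  by rewrite mulr0 normr0 expr0n /= mulr0 C0 orbT.
apply/orP; right; apply: (HC j) => //; first by rewrite mulf_neq0.
move=> v; pose hj' : V n := \row_k h ord0 (lift j k).
pose t := h ord0 j; pose x := enorm (v : 'rV[R]_n).
pose x' := enorm ((v : 'rV[R]_n) + hj').
have he : h = rV_insert j (t, hj') by exact: rV_insertE.
have hmax i : `|h ord0 i| <= `|t|.
  by have := jmax i; rewrite !mxE !normrM ler_pM2l// normr_gt0.
have xx' : `|x' - x| <= n%:R * `|t|.
  rewrite (le_trans (enorm_diff _ _))// enorm_le_max// => k.
  by rewrite mxE.
pose D s := F' x' (s + t) - F' x s.
pose p s := 2 + delta * t^-1 * D s.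
have t0 : 0 < `|t| by rewrite normr_gt0.
have HD : Cb N (Mw * (n%:R + 1) * `|t|) D.
  apply: Cb_le (HMw x x' t); rewrite -mulrA ler_wpM2l//.
  by rewrite mulrDl mul1r lerD2r.
have HE : Cb N 1 (fun s => delta * t^-1 * D s).
  apply: Cb_le (CbZ (delta * t^-1) HD).
  rewrite normrM normfV [X in _ * X]mulrC mulrA -(mulrA `|delta|).
  rewrite mulVf ?mulr1 ?gt_eqF//.
  apply: (@le_trans _ _ (K^-1 * K)); last by rewrite mulVf// gt_eqF.
  apply: ler_pM => //; first by rewrite mulr_ge0// addr_ge0.
  by rewrite /K lerDr.
have Hp : Cb N 3 p.
  have := CbD (Cb_cst N 2) HE; rewrite ger0_norm// => h2.
  by apply: Cb_le h2; rewrite -[X in X + 1]/(2%:R) natr1.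
have p1 s : 1 <= p s.
  have := Cb_bound HE s; rewrite ler_norml => /andP[h1 _]; rewrite /p; lra.
exists p, (fun s => (p s)^-1); split.
- pose U z s := (z ^+ 2 + s ^+ 2) + delta * w (z ^+ 2 + s ^+ 2).
  have hU z : has_deriv (U z) (fun s => (0 + (1 * s + s * 1)) + delta * F' z s).
    apply: has_derivD; last exact: has_derivZ.
    apply: has_derivD; first exact: has_deriv_cst.
    exact: (has_derivM (@has_deriv_id R) (@has_deriv_id R)).
  have h1 : has_deriv (fun s => s + t) (fun=> 1 + 0).
    exact: (has_derivD (@has_deriv_id R) (has_deriv_cst t)).
  have := has_derivD (has_derivZ T (has_derivD (has_deriv_comp (hU x') h1)
    (has_derivZ (-1) (hU x)))) (has_deriv_cst (dotp (y : 'rV[R]_n.+1) h)).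
  set P := (fun s => _ + _); set P' := (fun s => _ + 0).
  have -> : P = (fun s => G (rV_insert j (s, v))).
    apply/funext => s; rewrite /P /G /phase [dotp y (_ + h)]dotpDr [in RHS]he rV_insertD
      !sqr_insert.
    rewrite -he -/x -/x' /U.
    by move: (dotp y h) (dotp y _) => e1 e2; ring.
  have -> // : P' = (fun s => T * h ord0 j * p s).
  apply/funext => s; rewrite /P' /p /D -/t; move: (F' x' _) (F' x _) => e1 e2.
  by field.
- exact: Cb_continuous Hp.
- by move=> s; rewrite divff// gt_eqF// (lt_le_trans ltr01).
- exact: HMq.
- have := CbM (HMa x) (Cb_shift t (HMa x')).
  rewrite (_ : (fun s => _) = (fun s => b (rV_insert j (s, v))))//.
  by apply/funext => s; rewrite /b [in RHS]he rV_insertD !sqr_insert.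
Qed.

Lemma cauchy_prod_norm (T : R) (h : V n.+1) :
  cauchy_prod (T *: (h : 'rV[R]_n.+1)) = cauchy_prod (`|T| *: (h : 'rV[R]_n.+1)).
Proof.
apply: eq_bigr => i _; rewrite !mxE.
by rewrite !exprMn real_normK// num_real.
Qed.

(** The autocorrelation at [h] is at most [C / prod (1 + (T h_i)^2)], whose
    integral in [h] is [C (pi / |T|)^n], in dimension [n]. *)
Lemma dispersive_rescaled (r w : R -> R) : smoothc r -> smoothc w ->
  exists delta0 C, [/\ 0 < delta0, 0 <= C &
  forall (T delta : R) (y : V n.+1), T != 0 -> `|delta| <= delta0 ->
  normc (cint lam (fun xi => expi (phase w T delta y xi) *
    ((r (dotp (xi : 'rV[R]_n.+1) xi))%:C)%C)) ^+ 2 * `|T| ^+ n.+1 <= C].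
Proof.
move=> sr sw; have [delta0 [C [d0 C0 HC]]] := phase_increment_decay sr sw.
exists delta0, (C * pi ^+ n.+1); split => //.
  by rewrite mulr_ge0// exprn_ge0// pi_ge0.
move=> T delta y T0 dd.
have T0' : 0 < `|T| by rewrite normr_gt0.
have [i1 e1] := @integral_cauchy_scale R n.+1 _ T0'.
have [L L0 rL] := @radial_supp_cube R n r sr.
have [M0 HM0] := sr.2 0%N; have rM := Cb_bound HM0.
set f := (fun xi => _).
have mid : measurable_fun setT (fun xi : V n.+1 => xi) by exact: measurable_id.
have mf : cmeas f.
  by apply: cmeasM; [apply: cmeas_expi; exact: measurable_phase
    |apply: cmeas_real; exact: measurable_radial].
have [fi _] : cintegrable lam f /\ normc (cint lam f) <= M0 * (2 * L) ^+ n.+1.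
  apply: (cintegrable_cube L0) => //.
  - by move=> v; rewrite normcM normc_expi mul1r normc_real.
  - by move=> v /rL e; rewrite /f e mulr0.
have i2 := integrableZ_EFin C measurableT i1.
have := sqr_normc_cint fi i2; rewrite RintegralZl// e1.
move=> h; rewrite -ler_pdivlMr ?exprn_gt0//.
apply: (le_trans (h _)); last by rewrite expr_div_n mulrA.
move=> k; have := HC T delta y k T0 dd; rewrite cauchy_prod_norm; apply: le_trans.
rewrite le_eqVlt; apply/orP; left; apply/eqP; congr normc; congr cint.
apply/funext => xi; rewrite /f expiD -conj_expi.
move: (expi _) (expi _) (r _) (r _) => [a1 a2] [c1 c2] p q.
by simpc; congr (_ +i* _)%C; ring.
Qed.

End dispersive.

(** * Fourier inversion *)

Section exponential.
Variable R : realType.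
Local Notation leb := (@lebesgue_measure R).

(** Adding 1 to the cosine makes the integrand nonnegative, so that its integral
    over the half-line is the limit of an explicit primitive. *)
Lemma integral_exp_onepcos (s : R) :
  (\int[leb]_x (expR (- `|x|) * (1 + cos (x * s)))%:E = (2 + 2 / (1 + s ^+ 2))%:E)%E.
Proof.
have s1 : 0 < 1 + s ^+ 2 by rewrite ltr_pwDl// sqr_ge0.
have c0 x : 0 <= 1 + cos (x * s) by have := cos_geN1 (x * s); lra.
have cts (f : R -> R) : continuous f -> continuous (fun x => expR (f x) * (1 + cos (x * s))).
  move=> cf; apply: ctsM; first by apply: cts_comp => //; exact: continuous_expR.
  apply: ctsD; first exact: cts_cst.
  apply: cts_comp; first exact: continuous_cos.
  by move=> x; apply: cvgM; [exact: cvg_id|exact: cvg_cst].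
rewrite (@ge0_symfun_integralT R (fun x => expR (- `|x|) * (1 + cos (x * s)))); first last.
- by move=> x /=; rewrite normrN mulNr cosN.
- apply: (cts (fun x => - `|x|)) => x.
  by apply: continuousN; exact: norm_continuous.
- by move=> x; rewrite mulr_ge0 ?expR_ge0.
rewrite -set_itvcy [X in (2%:E * X)%E](_ : _ =
    \int[leb]_(x in `[0%R, +oo[) (expR (- x) * (1 + cos (x * s)))%:E)%E; last first.
  by apply: eq_integral => x; rewrite inE /= in_itv /= andbT => x0; rewrite ger0_norm.
pose h x := (1 + s ^+ 2)^-1 * (s * sin (s * x) + -1 * cos (s * x)) + -1.
pose F x := expR (- x) * h x.
have cf : continuous (fun x => expR (- x) * (1 + cos (x * s))).
  by apply: (cts -%R) => x; apply: continuousN; exact: cvg_id.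
have hF : has_deriv F (fun x => expR (- x) * (1 + cos (x * s))).
  have hs := has_deriv_dilate s (@has_deriv_sin R).
  have hc := has_deriv_dilate s (@has_deriv_cos R).
  have he := has_deriv_dilate (-1) (fun x : R => is_derive_expR x).
  have hh := has_derivD (has_derivZ (1 + s ^+ 2)^-1
    (has_derivD (has_derivZ s hs) (has_derivZ (-1) hc))) (has_deriv_cst (-1)).
  have := has_derivM he hh.
  set u := (fun x => _ * _); set u' := (fun x => _ + _).
  have -> : u = F by apply/funext => x; rewrite /u /F mulN1r.
  have -> // : u' = (fun x => expR (- x) * (1 + cos (x * s))).
  apply/funext => x; rewrite /u' !mulN1r [x * s]mulrC.
  move: (expR _) (sin _) (cos _) => e a b.
  by field; rewrite gt_eqF.
rewrite (@ge0_continuous_FTC2y _ _ F 0 0).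
- rewrite /F /h oppr0 expR0 mulr0 sin0 cos0 -EFinB -EFinM; congr EFin.
  by field; rewrite gt_eqF.
- by move=> x _; rewrite mulr_ge0 ?expR_ge0.
- exact: continuous_subspaceT.
- pose M := (1 + s ^+ 2)^-1 * (`|s| + 1) + 1.
  have hM x : `|h x| <= M.
    rewrite (le_trans (ler_normD _ _))// normrN1 lerD2r normrM gtr0_norm ?invr_gt0//.
    rewrite ler_pM2l ?invr_gt0// (le_trans (ler_normD _ _))// mulN1r normrN lerD//.
      by rewrite normrM ler_piMr// ler_norml sin_geN1 sin_le1.
    by rewrite ler_norml cos_geN1 cos_le1.
  have e0 : expR (- x) * M @[x --> +oo] --> (0 : R).
    rewrite -[X in _ --> X](mul0r M); apply: cvgM; last exact: cvg_cst.
    exact: cvgr_expR.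
  have eN : - (expR (- x) * M) @[x --> +oo] --> (0 : R).
    by rewrite -[X in _ --> X]oppr0; apply: cvgN.
  apply: (@squeeze_cvgr _ _ _ _ (fun x => - (expR (- x) * M)) (fun x => expR (- x) * M)) => //.
  apply: nearW => x; rewrite /F -ler_norml normrM ger0_norm ?expR_ge0//.
  by rewrite ler_wpM2l// expR_ge0.
- by move=> x _; have [] := hF x.
- by apply: cvg_at_right_filter; exact: (has_deriv_cts hF).
- by move=> x _; rewrite derive1E; have [_ ->] := hF x.
Qed.

(** The case [s = 0] of the preceding integral is subtracted; the imaginary part
    is the integral of an odd function. *)
Lemma fourier_exp (s : R) :
  cintegrable leb (fun x => expi (x * s) * ((expR (- `|x|))%:C)%C) /\
  cint leb (fun x => expi (x * s) * ((expR (- `|x|))%:C)%C) = ((2 / (1 + s ^+ 2))%:C)%C.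
Proof.
have ce : continuous (fun x : R => expR (- `|x|)).
  apply: cts_comp; first exact: continuous_expR.
  by move=> x; apply: continuousN; exact: norm_continuous.
have me : measurable_fun setT (fun x : measurableTypeR R => expR (- `|x|)).
  exact: continuous_measurable_fun.
have ms : measurable_fun setT (fun x : measurableTypeR R => x * s) by exact: measurable_funM.
have c1 t (x : R) : 0 <= expR (- `|x|) * (1 + cos (x * t)).
  by rewrite mulr_ge0 ?expR_ge0//; have := cos_geN1 (x * t); lra.
have i1 t : leb.-integrable setT (EFin \o (fun x => expR (- `|x|) * (1 + cos (x * t)))).
  apply/integrableP; split.
    apply/measurable_EFinP; apply: measurable_funM => //.
    apply: measurable_funD => //; apply: (measurableT_comp (f := cos)).
      apply: continuous_measurable_fun; exact: continuous_cos.
    exact: measurable_funM.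
  under eq_integral => x _ do rewrite /= ger0_norm//.
  by rewrite integral_exp_onepcos ltry.
have ie : leb.-integrable setT (EFin \o (fun x => expR (- `|x|))).
  have := integrableZ_EFin 2^-1 measurableT (i1 0).
  rewrite (_ : (fun x => _) = (fun x => expR (- `|x|)))//.
  by apply/funext => x; rewrite mulr0 cos0; field.
have e0 : \int[leb]_x expR (- `|x|) = 2.
  have := RintegralZl 2^-1 measurableT (i1 0).
  rewrite (_ : (fun x => _) = (fun x => expR (- `|x|))).
    by move=> ->; rewrite /Rintegral integral_exp_onepcos /= expr0n /= addr0; field.
  by apply/funext => x; rewrite mulr0 cos0; field.
have ci : cintegrable leb (fun x => expi (x * s) * ((expR (- `|x|))%:C)%C).
  apply: (le_cintegrable _ _ ie).
    by apply: cmeasM; [exact: cmeas_expi|exact: cmeas_real].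
  by move=> x; rewrite normcM normc_expi mul1r normc_real ger0_norm ?expR_ge0.
split=> //; have cr := cintegrable_Re ci; have cim := cintegrable_Im ci.
rewrite /cint; congr (_ +i* _)%C.
  have := RintegralD measurableT ie cr.
  rewrite (_ : (fun x => _) = (fun x => expR (- `|x|) * (1 + cos (x * s)))).
    rewrite e0 /Rintegral integral_exp_onepcos /= => h.
    by apply: (@addrI _ 2); rewrite h.
  by apply/funext => x /=; rewrite mulr0 subr0; ring.
have mi := (cmeasM (cmeas_expi ms) (cmeas_real me)).2.
have mN : measurable_fun setT (fun x : measurableTypeR R => (- x : measurableTypeR R)).
  exact: measurable_funN.
have hN (A : set (measurableTypeR R)) : measurable A ->
    (leb A = 1%:E * leb ((fun x : measurableTypeR R => (- x : measurableTypeR R)%R) @^-1` A))%E.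
  by move=> mA; rewrite mul1e -lebesgue_measureN.
have := Rintegral_change mN ltr01 hN mi cim; rewrite mul1r => h.
set I := (X in X = _); have : I = - I.
  rewrite {1}/I h -mulN1r -RintegralZl//; apply: eq_Rintegral => x _ /=.
  by rewrite normrN mulNr sinN; ring.
by move=> /eqP; rewrite -addr_eq0 -mulr2n mulrn_eq0 /= => /eqP.
Qed.

End exponential.

Section inversion.
Variables (R : realType) (n : nat).
Local Notation V := 'rV[measurableTypeR R]_n.
Local Notation lam := (lebesgue_rV R n).

Lemma expi_sum (I : Type) (s : seq I) (a : I -> R) :
  expi (\sum_(i <- s) a i) = \prod_(i <- s) expi (a i).
Proof. by elim/big_rec2: _ => [|i x y _ <-]; rewrite ?expi0 ?expiD. Qed.

Definition exp_l1 (x : V) : R := expR (- \sum_(i < n) `|x ord0 i|).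

Lemma exp_l1E (x : V) : exp_l1 x = \prod_(i < n) expR (- `|x ord0 i|).
Proof. by rewrite /exp_l1 -sumrN expR_sum. Qed.

Lemma fourier_exp_l1 (z : V) :
  cintegrable lam (fun x => expi (dotp (x : 'rV[R]_n) z) * ((exp_l1 x)%:C)%C) /\
  cint lam (fun x => expi (dotp (x : 'rV[R]_n) z) * ((exp_l1 x)%:C)%C) =
    ((2 ^+ n * cauchy_prod z)%:C)%C.
Proof.
have [] := @cint_prod_coord R n
  (fun i x => expi (x * z ord0 i) * ((expR (- `|x|))%:C)%C)
  (fun i => (fourier_exp (z ord0 i)).1).
have -> : (fun v : V => \prod_(i < n) (expi (v ord0 i * z ord0 i) * ((expR (- `|v ord0
  i|))%:C)%C)) =
   (fun x => expi (dotp (x : 'rV[R]_n) z) * ((exp_l1 x)%:C)%C).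
  by apply/funext => x; rewrite big_split /= -expi_sum exp_l1E rmorph_prod.
move=> i1 ->; split => //.
under eq_bigr => i _ do rewrite (fourier_exp (z ord0 i)).2.
rewrite -rmorph_prod /= big_split /= prodr_const card_ord.
by [].
Qed.

Lemma fourier_exp_l1_scale (z : V) (e : R) : 0 < e ->
  cintegrable lam (fun x => expi (dotp (x : 'rV[R]_n) z) * ((exp_l1 (e *: (x :
    'rV[R]_n)))%:C)%C) /\
  cint lam (fun x => expi (dotp (x : 'rV[R]_n) z) * ((exp_l1 (e *: (x : 'rV[R]_n)))%:C)%C) =
    ((e ^- n * 2 ^+ n * cauchy_prod (e^-1 *: (z : 'rV[R]_n)))%:C)%C.
Proof.
move=> e0; have [i1 c1] := fourier_exp_l1 (e^-1 *: (z : 'rV[R]_n)).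
have [] := @cint_affine R n e 0 _ e0 i1.1 i1; rewrite c1.
have -> : (fun x : V => expi (dotp (0 + e *: (x : 'rV[R]_n)) (e^-1 *: (z : 'rV[R]_n))) *
    ((exp_l1 (0 + e *: (x : 'rV[R]_n)))%:C)%C) =
  (fun x => expi (dotp (x : 'rV[R]_n) z) * ((exp_l1 (e *: (x : 'rV[R]_n)))%:C)%C).
  by apply/funext => x; rewrite add0r dotpZl dotpZr mulrA divff ?mul1r// gt_eqF.
move=> i2 h; split => //.
rewrite -mulrA rmorphM /= h mulrA -rmorphM /= mulVf ?mul1r//.
by rewrite expf_neq0// gt_eqF.
Qed.

Lemma cintegrable_exp_l1 (e : R) : 0 < e ->
  cintegrable lam (fun x => ((exp_l1 (e *: (x : 'rV[R]_n)))%:C)%C).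
Proof.
move=> e0; have [+ _] := fourier_exp_l1_scale 0 e0.
rewrite (_ : (fun x => _) = (fun x => ((exp_l1 (e *: (x : 'rV[R]_n)))%:C)%C))//.
apply/funext => x.
by rewrite (_ : dotp _ 0 = 0) ?expi0 ?mul1r// /dotp big1// => i _; rewrite mxE mulr0.
Qed.

Lemma exp_l1_gt0 (x : V) : 0 < exp_l1 x. Proof. exact: expR_gt0. Qed.

Lemma exp_l1_le1 (x : V) : exp_l1 x <= 1.
Proof. by rewrite -expR0 ler_expR oppr_le0 sumr_ge0. Qed.

Lemma exp_l1_cvg (x : V) :
  (fun k : nat => exp_l1 (k.+1%:R^-1 *: (x : 'rV[R]_n))) @ \oo --> (1 : R).
Proof.
have -> : (fun k : nat => exp_l1 (k.+1%:R^-1 *: (x : 'rV[R]_n))) =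
    (fun k => expR (- (k.+1%:R^-1 * \sum_(i < n) `|x ord0 i|))).
  apply/funext => k; rewrite /exp_l1 mulr_sumr; congr expR; congr (- _).
  by apply: eq_bigr => i _; rewrite mxE normrM ger0_norm.
rewrite -[X in _ --> X](expR0 R).
apply: continuous_cvg; first exact: continuous_expR.
rewrite -[X in _ --> X]oppr0; apply: cvgN.
rewrite -[X in _ --> X](mul0r (\sum_(i < n) `|x ord0 i|)).
by apply: cvgM; [exact: cvg_harmonic|exact: cvg_cst].
Qed.

Lemma exp_l1_cvgZ (a : R) (x : V) :
  (fun k : nat => a * exp_l1 (k.+1%:R^-1 *: (x : 'rV[R]_n))) @ \oo --> a.
Proof.
rewrite -[X in _ --> X](mulr1 a).
by apply: cvgM; [exact: cvg_cst|exact: exp_l1_cvg].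
Qed.

Lemma cmeas_expi_dotp d (U : measurableType d) (f g : U -> V) :
  measurable_fun setT f -> measurable_fun setT g ->
  cmeas (fun u => expi (dotp (f u : 'rV[R]_n) (g u))).
Proof. by move=> mf mg; apply: cmeas_expi; exact: measurable_dotp. Qed.

Definition ifourier (s : V -> R[i]) (x : V) : R[i] :=
  cint lam (fun xi => expi (dotp (x : 'rV[R]_n) xi) * s xi).

Lemma cintegrable_expiM (s : V -> R[i]) (x : V) : cintegrable lam s ->
  cintegrable lam (fun xi => expi (dotp (x : 'rV[R]_n) xi) * s xi).
Proof.
move=> si; apply: (@cintegrableMl _ _ _ _ _ _ 1) => //.
  by apply: cmeas_expi_dotp; [exact: measurable_cst|exact: measurable_id].
by move=> xi; rewrite normc_expi.
Qed.

(** A weight makes the integral defining the transform absolutely convergent on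
    the product space, whence its measurability by Fubini's theorem. *)
Lemma cmeas_ifourier (s : V -> R[i]) : cintegrable lam s -> cmeas (ifourier s).
Proof.
move=> si; have ei := cintegrable_exp_l1 ltr01.
have [ti _] := cintegrable_tensor ei si.
have : cintegrable (lam \x lam)%E (fun z : V * V => expi (dotp (z.1 : 'rV[R]_n) z.2) *
     (((exp_l1 (1 *: (z.1 : 'rV[R]_n)))%:C)%C * s z.2)).
  apply: (@cintegrableMl _ _ _ _ _ _ 1) => //.
    by apply: cmeas_expi_dotp; [exact: measurable_fst|exact: measurable_snd].
  by move=> xi; rewrite normc_expi.
move=> /cint_prod1[[mi _] _].
have me : measurable_fun setT (fun x : V => (exp_l1 (1 *: (x : 'rV[R]_n)))^-1).
  have [[mr _] _] := ei.
  rewrite (_ : (fun x => _) = (fun x : V => expR (- ln (exp_l1 (1 *: (x : 'rV[R]_n)))))).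
    apply: (measurableT_comp (@measurable_expR R)); apply: measurable_funN.
    exact: (measurableT_comp (@measurable_ln R) mr).
  by apply/funext => x; rewrite expRN lnK// posrE exp_l1_gt0.
rewrite (_ : ifourier s = (fun x => (((exp_l1 (1 *: (x : 'rV[R]_n)))^-1)%:C)%C *
   cint lam (fun xi => expi (dotp (x : 'rV[R]_n) xi) *
     (((exp_l1 (1 *: (x : 'rV[R]_n)))%:C)%C * s xi)))).
  by apply: cmeasM => //; exact: cmeas_real.
apply/funext => x; have si' := cintegrable_expiM x si.
rewrite (_ : (fun xi => _) = (fun xi => ((exp_l1 (1 *: (x : 'rV[R]_n)))%:C)%C *
   (expi (dotp (x : 'rV[R]_n) xi) * s xi))).
  rewrite cintZ// mulrA -rmorphM /= mulVf ?mul1r// gt_eqF//; exact: exp_l1_gt0.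
by apply/funext => xi; rewrite mulrCA.
Qed.

(** Regularised by [exp (- e |x|_1)], the double integral can be exchanged, and
    the transform of the regularisation is an approximate identity. *)
Lemma fourier_inversion (g : 'rV[R]_n -> R) (M : R) : continuous g ->
  (forall x, `|g x| <= M) -> lam.-integrable setT (EFin \o (g : V -> R)) ->
  cintegrable lam (ifourier (fun xi => ((g xi)%:C)%C)) ->
  forall eta : V,
  cint lam (fun x => expi (- dotp (x : 'rV[R]_n) eta) *
    ifourier (fun xi => ((g xi)%:C)%C) x) = (((2 * pi) ^+ n * g eta)%:C)%C.
Proof.
move=> cg gM ig; set K := ifourier _ => iK eta.
have mg := continuous_measurable_rV cg.
have gi := cintegrable_real ig.
have mid : measurable_fun setT (fun x : V => x) by exact: measurable_id.
have mK : cmeas (fun x : V => expi (- dotp (x : 'rV[R]_n) eta)).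
  apply: cmeas_expi; apply: measurable_funN.
  by apply: measurable_dotp => //; exact: measurable_cst.
have iK' : cintegrable lam (fun x : V => expi (- dotp (x : 'rV[R]_n) eta) * K x).
  by apply: (@cintegrableMl _ _ _ _ _ _ 1) => // x; rewrite normc_expi.
pose e (k : nat) : R := k.+1%:R^-1.
have e0 k : 0 < e k by rewrite invr_gt0.
(* The regularised left-hand side, and its value after exchanging the integrals
   and substituting [xi = eta + e s]. *)
pose Lk k x := expi (- dotp (x : 'rV[R]_n) eta) * K x * ((exp_l1 (e k *: (x : 'rV[R]_n)))%:C)%C.
pose Rk k (s : V) := ((g ((eta : 'rV[R]_n) + e k *: (s : 'rV[R]_n)) * (2 ^+ n * cauchy_prod
  s))%:C)%C : R[i].
have LR k : cint lam (Lk k) = cint lam (Rk k).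
  pose H (z : V * V) := (expi (- dotp (z.1 : 'rV[R]_n) eta) * expi (dotp (z.1 : 'rV[R]_n) z.2)) *
    (((exp_l1 (e k *: (z.1 : 'rV[R]_n)))%:C)%C * ((g z.2)%:C)%C).
  have iH : cintegrable (lam \x lam)%E H.
    have [ti _] := cintegrable_tensor (cintegrable_exp_l1 (e0 k)) gi.
    apply: (@cintegrableMl _ _ _ _ _ _ 1) => //.
      apply: cmeasM.
        exact: (@cmeas_comp _ _ _ _ _ _ fst mK measurable_fst).
      by apply: cmeas_expi_dotp; [exact: measurable_fst|exact: measurable_snd].
    by move=> z; rewrite normcM !normc_expi mulr1.
  transitivity (cint lam (fun x => cint lam (fun xi => H (x, xi)))).
    congr cint; apply/funext => x; rewrite /Lk /K /ifourier mulrAC.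
    rewrite -cintZ; last exact: cintegrable_expiM.
    by congr cint; apply/funext => xi; rewrite /H /=; ring.
  rewrite (cint_swap iH).
  pose f (xi : V) := ((g xi * (e k ^- n * 2 ^+ n * cauchy_prod ((e k)^-1 *: ((xi : 'rV[R]_n) -
    eta))))%:C)%C : R[i].
  have fE : (fun xi => cint lam (fun x => H (x, xi))) = f.
    apply/funext => xi.
    have [i1 c1] := fourier_exp_l1_scale ((xi : 'rV[R]_n) - eta) (e0 k).
    rewrite /f rmorphM /= -c1 -cintZ//; congr cint; apply/funext => x.
    by rewrite /H /= dotpDr dotpNr expiD; ring.
  rewrite fE; have [fi _] := cint_prod2 iH; rewrite fE in fi.
  have [i2 ->] := @cint_affine R n (e k) eta f (e0 k) fi.1 fi.
  rewrite -cintZ//; congr cint; apply/funext => s.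
  rewrite /f /Rk -rmorphM /=; congr (_ %:C)%C.
  rewrite addrAC subrr add0r scalerA mulVf ?gt_eqF// scale1r.
  rewrite mulrCA; congr (_ * _); rewrite !mulrA divff ?mul1r//.
  by rewrite expf_neq0// gt_eqF.
have [ic ec] := integrable_cauchy_prod R n.
have mgs (y : V) (c : R) : measurable_fun setT
    (fun s : V => g ((y : 'rV[R]_n) + c *: (s : 'rV[R]_n))).
  exact: (measurableT_comp mg (measurable_affine c y)).
have mc : measurable_fun setT (@cauchy_prod R n).
  by apply/measurable_EFinP; exact: measurable_int ic.
have ick : lam.-integrable setT (EFin \o (fun s => M * 2 ^+ n * cauchy_prod s)).
  exact: integrableZ_EFin.
have [Lr Li] : (fun k => complex.Re (cint lam (Lk k))) @ \oo --> complex.Re (cint lam (fun x :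
  V => expi (- dotp (x : 'rV[R]_n) eta) * K x)) /\
  (fun k => complex.Im (cint lam (Lk k))) @ \oo --> complex.Im (cint lam (fun x : V => expi (-
    dotp (x : 'rV[R]_n) eta) * K x)).
  apply: (cint_cvg _ _ _ _ (cintegrable_norm iK')).
  - move=> k; apply: cmeasM; first exact: iK'.1.
    exact: (cintegrable_exp_l1 (e0 k)).1.
  - exact: iK'.1.
  - move=> x; rewrite /Lk; move: (expi _ * K x) => [a b].
    have := @exp_l1_cvgZ a x.
    rewrite (_ : (fun k => complex.Re _) = (fun k => a * exp_l1 (e k *: (x : 'rV[R]_n))))//.
    by apply/funext => k /=; rewrite mulr0 subr0.
  - move=> x; rewrite /Lk; move: (expi _ * K x) => [a b].
    have := @exp_l1_cvgZ b x.
    rewrite (_ : (fun k => complex.Im _) = (fun k => b * exp_l1 (e k *: (x : 'rV[R]_n))))//.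
    by apply/funext => k /=; rewrite mulr0 add0r.
  - move=> k x; rewrite /Lk normcM normc_real ger0_norm ?(ltW (exp_l1_gt0 _))//.
    by rewrite ler_piMr ?normc_ge0// exp_l1_le1.
have [Rr Ri] : (fun k => complex.Re (cint lam (Rk k))) @ \oo --> complex.Re (cint lam (fun s :
  V => ((g eta * (2 ^+ n * cauchy_prod s))%:C)%C)) /\
  (fun k => complex.Im (cint lam (Rk k))) @ \oo --> complex.Im (cint lam (fun s : V => ((g eta
    * (2 ^+ n * cauchy_prod s))%:C)%C)).
  apply: (cint_cvg _ _ _ _ ick).
  - move=> k; apply: cmeas_real; apply: measurable_funM => //.
    exact: measurable_funM.
  - apply: cmeas_real; apply: measurable_funM => //.
    exact: measurable_funM.
  - move=> s /=; apply: cvgM; last exact: cvg_cst.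
    apply: continuous_cvg; first exact: cg.
    rewrite -[X in _ --> X]addr0; apply: cvgD; first exact: cvg_cst.
    rewrite -[X in _ --> X](scale0r (s : 'rV[R]_n)).
    by apply: cvgZr_tmp; exact: cvg_harmonic.
  - by move=> s /=; exact: cvg_cst.
  - move=> k s; rewrite /Rk normc_real normrM -mulrA; apply: ler_pM => //.
    by rewrite ger0_norm// mulr_ge0 ?exprn_ge0// ltW// cauchy_prod_gt0.
have e1 := cvg_unique _ Lr; have e2 := cvg_unique _ Li.
move: Rr Ri; under eq_fun do rewrite -LR; move=> /e1 h1.
under eq_fun do rewrite -LR; move=> /e2 h2.
have {}h1 := h1 (@Rhausdorff R); have {}h2 := h2 (@Rhausdorff R).
transitivity (cint lam (fun s : V => ((g eta * (2 ^+ n * cauchy_prod s))%:C)%C)).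
  apply/eqP; rewrite eq_complex; apply/andP; split; apply/eqP => //.
rewrite cint_real RintegralZl//; last exact: integrableZ_EFin.
by rewrite RintegralZl// ec exprMn mulrC.
Qed.

End inversion.

(** * Multipliers as convolutions *)

Section multipliers.
Variables (R : realType) (n : nat).
Local Notation V := 'rV[measurableTypeR R]_n.
Local Notation lam := (lebesgue_rV R n).

Lemma inv_fourierE (s : V -> R[i]) (x : V) :
  inv_fourier s x = (((2 * pi) ^- n)%:C)%C * ifourier s x.
Proof. by []. Qed.

Lemma multiplierE (a f : V -> R[i]) (x : V) :
  multiplier a f x = (((2 * pi) ^- n)%:C)%C * ifourier (fun xi => a xi * fourier f xi) x.
Proof. by []. Qed.

Lemma fourierE (f : V -> R[i]) (xi : V) :
  fourier f xi = cint lam (fun x => expi (- dotp (x : 'rV[R]_n) xi) * f x).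
Proof. by []. Qed.

(** Exchanging the integrals in [xi] and [y]: a multiplier is the convolution
    with the inverse transform of its symbol. *)
Lemma ifourier_mul_fourier (s f : V -> R[i]) (x : V) :
  cintegrable lam s -> cintegrable lam f ->
  cintegrable lam (fun y => ifourier s ((x : 'rV[R]_n) - y) * f y) /\
  ifourier (fun xi => s xi * fourier f xi) x =
    cint lam (fun y => ifourier s ((x : 'rV[R]_n) - y) * f y).
Proof.
move=> si fi.
pose H (z : V * V) := expi (dotp ((x : 'rV[R]_n) - z.2) z.1) * (s z.1 * f z.2).
have iH : cintegrable (lam \x lam)%E H.
  have [ti _] := cintegrable_tensor si fi.
  apply: (@cintegrableMl _ _ _ _ _ _ 1) => //.
    apply: cmeas_expi_dotp; last exact: measurable_fst.
    apply: measurable_addV; first exact: measurable_cst.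
    by apply: measurable_oppV; exact: measurable_snd.
  by move=> z; rewrite normc_expi.
have e2 : (fun y => cint lam (fun xi => H (xi, y))) =
    (fun y => ifourier s ((x : 'rV[R]_n) - y) * f y).
  apply/funext => y; rewrite /ifourier -cintZr; last exact: cintegrable_expiM.
  by congr cint; apply/funext => xi; rewrite /H /= mulrA.
have [] := cint_prod2 iH; rewrite e2 => i2 _; split => //.
rewrite -e2 -(cint_swap iH) /ifourier; congr cint; apply/funext => xi.
rewrite fourierE mulrA -cintZ; last first.
  apply: (@cintegrableMl _ _ _ _ _ _ 1) => //.
    apply: cmeas_expi; apply: measurable_funN.
    by apply: measurable_dotp; [exact: measurable_id|exact: measurable_cst].
  by move=> y; rewrite normc_expi.
congr cint; apply/funext => y.
by rewrite /H /= dotpDl dotpNl expiD; ring.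
Qed.

(** The multiplier is the convolution of [f] with the inverse transform [K] of
    [g]; exchanging the integrals, its transform is the product of those of [K]
    and [f], and the inversion hypothesis identifies the former with [g]. *)
Lemma fourier_multiplier (g : V -> R) (f : V -> R[i]) :
  lam.-integrable setT (EFin \o g) -> cintegrable lam f ->
  cintegrable lam (ifourier (fun xi => ((g xi)%:C)%C)) ->
  (forall eta : V, cint lam (fun x => expi (- dotp (x : 'rV[R]_n) eta) *
    ifourier (fun xi => ((g xi)%:C)%C) x) = (((2 * pi) ^+ n * g eta)%:C)%C) ->
  forall eta : V,
  fourier (multiplier (fun xi => ((g xi)%:C)%C) f) eta = ((g eta)%:C)%C * fourier f eta.
Proof.
move=> ig fi iK inv eta; have gi := cintegrable_real ig.
set K := ifourier _ in iK inv.
have [mK _] := iK; have [mf _] := fi.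
have mKn : measurable_fun setT (fun x => (normc (K x))%:E).
  by apply/measurable_EFinP; exact: measurable_normc.
have me : cmeas (fun x : V => expi (- dotp (x : 'rV[R]_n) eta)).
  apply: cmeas_expi; apply: measurable_funN.
  by apply: measurable_dotp; [exact: measurable_id|exact: measurable_cst].
have iKe : cintegrable lam (fun x : V => expi (- dotp (x : 'rV[R]_n) eta) * K x).
  by apply: (@cintegrableMl _ _ _ _ _ _ 1) => // x; rewrite normc_expi.
pose H (z : V * V) := expi (- dotp (z.1 : 'rV[R]_n) eta) *
  (K ((z.1 : 'rV[R]_n) - z.2) * f z.2).
have iH : cintegrable (lam \x lam)%E H.
  apply: (@cintegrable_prod _ _ _ _ _ _ _ _ (fun y => (\int[lam]_x normc (K x)) * normc (f y))).
  - apply: cmeasM; first exact: (@cmeas_comp _ _ _ _ _ _ fst me measurable_fst).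
    apply: cmeasM; last exact: (@cmeas_comp _ _ _ _ _ _ snd mf measurable_snd).
    apply: (@cmeas_comp _ _ _ _ _ K (fun z : V * V => (z.1 : 'rV[R]_n) - z.2)) => //.
    apply: measurable_addV; first exact: measurable_fst.
    by apply: measurable_oppV; exact: measurable_snd.
  - move=> y; rewrite (_ : \int[lam]_x _ =
        \int[lam]_x ((normc (f y))%:E * (normc (K ((x : 'rV[R]_n) + - (y :
          'rV[R]_n))%R))%:E))%E; last first.
      apply: eq_integral => x _; rewrite /H /= !normcM normc_expi mul1r mulrC.
      by rewrite EFinM.
    rewrite ge0_integralZl//; last 3 first.
    + apply/measurable_EFinP; apply: (measurableT_comp (measurable_normc mK)).
      by apply: measurable_addV; [exact: measurable_id|exact: measurable_cst].
    + by move=> h _; rewrite lee_fin normc_ge0.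
    + by rewrite lee_fin normc_ge0.
    rewrite (@ge0_integral_translate _ _ (- (y : 'rV[R]_n)) _ mKn); last by move=> h; rewrite
      lee_fin normc_ge0.
    rewrite /Rintegral EFinM fineK 1?muleC//.
    exact: (integrable_fin_num measurableT (cintegrable_norm iK)).
  - by apply: integrableZ_EFin => //; exact: cintegrable_norm.
have step y : cint lam (fun x => H (x, y)) =
    (((2 * pi) ^+ n * g eta)%:C)%C * (expi (- dotp (y : 'rV[R]_n) eta) * f y).
  rewrite -inv.
  have [i1 <-] := cint_translate (- (y : 'rV[R]_n)) iKe.1 iKe.
  rewrite -cintZr//; congr cint; apply/funext => x.
  rewrite /H /= dotpDl dotpNl opprD opprK expiD.
  have : expi (dotp (y : 'rV[R]_n) eta) * expi (- dotp (y : 'rV[R]_n) eta) = 1.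
    by rewrite -expiD subrr expi0.
  move: (expi (dotp _ _)) (expi (- _)) => u v uv.
  rewrite mulrA; move: (K _) (f _) (expi _) => a b c.
  by rewrite -[LHS]mulr1 -uv; ring.
have fe : cintegrable lam (fun y : V => expi (- dotp (y : 'rV[R]_n) eta) * f y).
  by apply: (@cintegrableMl _ _ _ _ _ _ 1) => // x; rewrite normc_expi.
have mult x : multiplier (fun xi => ((g xi)%:C)%C) f x =
    (((2 * pi) ^- n)%:C)%C * cint lam (fun y => K ((x : 'rV[R]_n) - y) * f y).
  by rewrite /multiplier inv_fourierE (ifourier_mul_fourier x gi fi).2.
have [i1 _] := cint_prod1 iH.
have inner x : cint lam (fun y => H (x, y)) = expi (- dotp (x : 'rV[R]_n) eta) *
     cint lam (fun y => K ((x : 'rV[R]_n) - y) * f y).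
  by rewrite -cintZ//; exact: (ifourier_mul_fourier x gi fi).1.
rewrite fourierE; under eq_fun do rewrite mult mulrCA -inner.
rewrite cintZ// (cint_swap iH).
rewrite [X in _ * X](_ : _ = cint lam (fun y => (((2 * pi) ^+ n * g eta)%:C)%C *
   (expi (- dotp (y : 'rV[R]_n) eta) * f y))); last by congr cint; apply/funext => y; rewrite
     step.
rewrite cintZ// -fourierE mulrA -rmorphM /= mulrA mulVf ?mul1r//.
by rewrite expf_neq0// mulf_neq0// gt_eqF// pi_gt0.
Qed.

End multipliers.

(** * The Littlewood-Paley piece of the propagator *)

Section symbols.
Variables (R : realType) (chi : R -> R).
Hypothesis hchi : cutoff chi.

Let chi1 s : `|s| <= 1 -> chi s = 1. Proof. by case: hchi => _ _ _ h _; exact: h. Qed.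

Let chi_dil c : 0 < c -> smoothc (fun s => chi (c * s)).
Proof. by move=> c0; exact: smoothc_dilate (cutoff_smooth hchi). Qed.

Lemma bump_rho_smooth : smoothc (bump_rho chi).
Proof.
have := smoothcD (cutoff_smooth hchi) (smoothcZ (-1) (chi_dil (ltr0n R 2))).
rewrite (_ : (fun s => _) = bump_rho chi)//.
by apply/funext => s; rewrite mulN1r.
Qed.

Lemma bump_rho_near s : `|s| < 2^-1 -> bump_rho chi s = 0.
Proof.
move=> h; have h2 : `|2 * s| <= 1 by rewrite normrM ger0_norm//; lra.
by rewrite /bump_rho (chi1 h2) chi1 ?subrr//; lra.
Qed.

Lemma bump_rho_far s : 2 < `|s| -> bump_rho chi s = 0.
Proof.
move=> h; have h2 : 2 < `|2 * s| by rewrite normrM ger0_norm//; lra.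
by rewrite /bump_rho (cutoff_far hchi h) (cutoff_far hchi h2) subrr.
Qed.

(** Multiplying by this bump, which is 1 where [bump_rho chi] does not vanish and
    0 near the origin, removes the singularity of [|xi|^(-2 beta)] without
    changing the localised propagator.  The factor 8 makes [chi (8 s)] vanish for
    [|s| > 1/4], well inside the gap [|s| < 1/2] of [bump_rho chi]. *)
Definition wide_bump (s : R) : R := chi (2^-1 * s) - chi (8 * s).

Lemma wide_bump_smooth : smoothc wide_bump.
Proof.
have h2 : (0 : R) < 2^-1 by rewrite invr_gt0.
have := smoothcD (chi_dil h2) (smoothcZ (-1) (chi_dil (ltr0n R 8))).
rewrite (_ : (fun s => _) = wide_bump)//.
by apply/funext => s; rewrite mulN1r.
Qed.

Lemma wide_bump_near s : `|s| < 8^-1 -> wide_bump s = 0.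
Proof.
move=> h; have h2 : `|2^-1 * s| <= 1 by rewrite normrM ger0_norm ?invr_ge0//; lra.
have h8 : `|8 * s| <= 1 by rewrite normrM ger0_norm//; lra.
by rewrite /wide_bump (chi1 h2) (chi1 h8) subrr.
Qed.

Lemma wide_bump1 s : bump_rho chi s != 0 -> wide_bump s = 1.
Proof.
move=> rs; have s2 : `|s| <= 2.
  by rewrite leNgt; apply: contra rs => /bump_rho_far ->.
have s1 : 2^-1 <= `|s|.
  by rewrite leNgt; apply: contra rs => /bump_rho_near ->.
have h2 : `|2^-1 * s| <= 1 by rewrite normrM ger0_norm ?invr_ge0//; lra.
have h8 : 2 < `|8 * s| by rewrite normrM ger0_norm//; lra.
by rewrite /wide_bump (chi1 h2) (cutoff_far hchi h8) subr0.
Qed.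

Lemma radial_cutE n (zeta : R -> R) (a : R) (x : 'rV[R]_n) : zeta 0 = 0 ->
  radial_cut zeta a (dotp x x) = zeta (enorm x) * dotp x x `^ a.
Proof.
move=> z0; rewrite /radial_cut; case: ifPn => // h.
have e : dotp x x = 0 by apply/eqP; rewrite eq_le dotp_ge0 andbT leNgt.
by rewrite /enorm e sqrtr0 z0 mul0r.
Qed.

(** The symbol of the frequency projection as a function of [|xi|^2]. *)
Definition symbol_cut (lambda : R) : R -> R :=
  radial_cut (fun s => bump_rho chi (lambda^-1 * s)) 0.

Lemma symbol_cut_smooth lambda : 0 < lambda -> smoothc (symbol_cut lambda).
Proof.
move=> l0; have l0' : 0 < lambda^-1 by rewrite invr_gt0.
apply: (@radial_cut_smooth _ _ _ (lambda * 2^-1)).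
- by rewrite mulr_gt0// invr_gt0.
- move=> s h; apply: bump_rho_near; rewrite normrM ger0_norm ?(ltW l0')//.
  by rewrite mulrC ltr_pdivrMr// mulrC.
- exact: smoothc_dilate bump_rho_smooth.
Qed.

Lemma symbol_cutE n lambda (x : 'rV[R]_n) :
  symbol_cut lambda (dotp x x) = bump_rho chi (enorm x / lambda).
Proof.
have z : bump_rho chi (lambda^-1 * 0) = 0.
  by rewrite mulr0 bump_rho_near// normr0 invr_gt0.
by rewrite /symbol_cut (radial_cutE 0 x z) powRr0 mulr1 mulrC.
Qed.

Lemma continuous_dotp n : continuous (fun x : 'rV[R]_n => dotp x x).
Proof.
suff h (s : seq 'I_n) : continuous (fun x : 'rV[R]_n => \sum_(i <- s) x ord0 i * x ord0 i).
  exact: h.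
elim: s => [|i s IH].
  rewrite (_ : (fun x => _) = cst 0); first exact: cst_continuous.
  by apply/funext => x; rewrite big_nil.
rewrite (_ : (fun x => _) =
  (fun x : 'rV[R]_n => x ord0 i * x ord0 i + \sum_(j <- s) x ord0 j * x ord0 j)).
  move=> x; have c := @coord_continuous R 1 n ord0 i x.
  have cc := @continuousM R _ _ _ _ c c.
  exact: (continuousD cc (IH x)).
by apply/funext => x; rewrite big_cons.
Qed.

Lemma enormZ n (c : R) (x : 'rV[R]_n) : 0 <= c -> enorm (c *: x) = c * enorm x.
Proof.
move=> c0; rewrite /enorm dotpZl dotpZr mulrA sqrtrM ?mulr_ge0//.
by rewrite -expr2 sqrtr_sqr ger0_norm.
Qed.

Lemma measurable_enorm d (T : measurableType d) n (f : T -> 'rV[measurableTypeR R]_n) :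
  measurable_fun setT f -> measurable_fun setT (fun x => enorm (f x : 'rV[R]_n)).
Proof.
move=> mf; rewrite /enorm.
apply: (measurableT_comp (f := @Num.sqrt R)); last exact: measurable_dotp.
apply: continuous_measurable_fun; exact: sqrt_continuous.
Qed.

End symbols.

Section kernel.
Variables (R : realType) (chi : R -> R) (n : nat) (beta eps : R).
Hypotheses (hchi : cutoff chi) (hbeta : 0 < beta < 1) (heps : eps = 1 \/ eps = -1).
Local Notation V := 'rV[measurableTypeR R]_n.+1.
Local Notation lam := (lebesgue_rV R n.+1).

Definition propagator_symbol (lambda t : R) (xi : V) : R[i] :=
  expi (t * dispersion eps beta (enorm (xi : 'rV[R]_n.+1))) *
  ((bump_rho chi (enorm (xi : 'rV[R]_n.+1) / lambda))%:C)%C.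

Lemma integrable_symbol (lambda : R) : 0 < lambda ->
  exists M, [/\ lam.-integrable setT
      (EFin \o (fun xi : V => bump_rho chi (enorm (xi : 'rV[R]_n.+1) / lambda))),
    continuous (fun xi : 'rV[R]_n.+1 => bump_rho chi (enorm xi / lambda)),
    (forall xi : V, `|bump_rho chi (enorm (xi : 'rV[R]_n.+1) / lambda)| <= M) &
    cintegrable lam (ifourier (fun xi : V =>
      ((bump_rho chi (enorm (xi : 'rV[R]_n.+1) / lambda))%:C)%C))].
Proof.
move=> l0; have sr := symbol_cut_smooth hchi l0.
have [L L0 rL] := @radial_supp_cube R n _ sr.
have [M HM] := sr.2 0%N; exists M.
have e : (fun xi : V => bump_rho chi (enorm (xi : 'rV[R]_n.+1) / lambda)) =
    (fun xi : V => symbol_cut chi lambda (dotp (xi : 'rV[R]_n.+1) xi)).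
  by apply/funext => xi; rewrite symbol_cutE.
rewrite e.
have mr : measurable_fun setT (fun xi : V => symbol_cut chi lambda (dotp (xi : 'rV[R]_n.+1) xi)).
  by apply: measurable_radial => //; exact: measurable_id.
have [iS _] : cintegrable lam (fun xi : V => ((symbol_cut chi lambda (dotp (xi : 'rV[R]_n.+1)
  xi))%:C)%C) /\
    normc (cint lam (fun xi : V => ((symbol_cut chi lambda (dotp (xi : 'rV[R]_n.+1)
      xi))%:C)%C)) <= M * (2 * L) ^+ n.+1.
  apply: (cintegrable_cube L0).
  - exact: cmeas_real.
  - by move=> v; rewrite normc_real (Cb_bound HM).
  - by move=> v /rL ->.
split.
- exact: (cintegrable_Re iS).
- rewrite (_ : (fun xi => _) = (fun xi : 'rV[R]_n.+1 => symbol_cut chi lambda (dotp xi xi)));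
  last first.
    by apply/funext => xi; rewrite symbol_cutE.
  move=> x; apply: (continuous_comp (@continuous_dotp R n.+1 x)).
  exact: (Cb_continuous HM).
- by move=> xi; rewrite -(symbol_cutE hchi) (Cb_bound HM).
have [C C0 HC] := @radial_fourier_decay R n _ sr.
have [ic _] := integrable_cauchy_prod R n.+1.
apply: (le_cintegrable _ _ (integrableZ_EFin C measurableT ic)).
  rewrite (_ : (fun xi => _) = (fun xi : V => ((symbol_cut chi lambda (dotp (xi : 'rV[R]_n.+1)
    xi))%:C)%C)); last first.
    by apply/funext => xi; rewrite symbol_cutE.
  exact: cmeas_ifourier.
move=> x; have := HC x; congr (normc (cint _ _) <= _).
by apply/funext => xi; rewrite symbol_cutE.
Qed.

Lemma cintegrable_propagator_symbol (lambda t : R) : 0 < lambda ->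
  cintegrable lam (propagator_symbol lambda t).
Proof.
move=> l0; have [M [ib _ _ _]] := integrable_symbol l0.
apply: (@cintegrableMl _ _ _ _ _ _ 1).
- apply: cmeas_expi; apply: measurable_funM => //.
  have me : measurable_fun setT (fun xi : V => enorm (xi : 'rV[R]_n.+1)).
    by apply: measurable_enorm; exact: measurable_id.
  apply: measurable_funD; first exact: measurable_funX.
  apply: measurable_funM => //.
  exact: (measurableT_comp (measurable_powR (- (2 * beta))) me).
- by move=> xi; rewrite normc_expi.
- exact: cintegrable_real.
Qed.

(** After the change of variables [xi = lambda eta], the phase is [t lambda^2]
    times a perturbation of [|eta|^2] of size [lambda^(-2 beta - 2)], which is
    small for large [lambda]. *)
Lemma kernel_bound : exists C lambda0 : R, [/\ 0 <= C, 0 < lambda0 &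
  forall lambda t : R, lambda0 <= lambda -> t != 0 -> forall z : V,
  normc (ifourier (propagator_symbol lambda t) z) ^+ 2 * `|t| ^+ n.+1 <= C].
Proof.
have sr := symbol_cut_smooth hchi (@ltr01 R).
have h8 : (0 : R) < 8^-1 by rewrite invr_gt0.
have sw := radial_cut_smooth (- beta) h8 (@wide_bump_near _ _ hchi) (wide_bump_smooth hchi).
have [delta0 [C [d0 C0 HC]]] := @dispersive_rescaled R n _ _ sr sw.
(* For [lambda >= 1] the size of [delta] is at most [1 / lambda]. *)
exists C, (Num.max 1 delta0^-1); split => //.
  by rewrite lt_max ltr01.
move=> lambda t; rewrite ge_max => /andP[l1 ld] t0 z.
have l0 : 0 < lambda by rewrite (lt_le_trans ltr01).
pose T := t * lambda ^+ 2; pose delta := eps * lambda `^ (- (2 * beta)) / lambda ^+ 2.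
have T0 : T != 0 by rewrite mulf_neq0// expf_neq0// gt_eqF.
have dd : `|delta| <= delta0.
  have e1 : `|eps| = 1 by case: heps => ->; rewrite ?normrN1 ?normr1.
  rewrite /delta !normrM e1 mul1r normfV ger0_norm ?powR_ge0// ger0_norm ?exprn_ge0 ?(ltW l0)//.
  have p1 : lambda `^ (- (2 * beta)) <= 1.
    rewrite -[leRHS](powRr0 lambda) ler_powR//.
    by case/andP: hbeta => b0 _; rewrite oppr_le0 mulr_ge0// ltW.
  apply: (@le_trans _ _ (1 * lambda^-1)).
    apply: ler_pM => //; first exact: powR_ge0.
      by rewrite invr_ge0 exprn_ge0// ltW.
    by rewrite expr2 invfM ler_piMr ?invr_ge0 ?(ltW l0)// invf_le1.
  by rewrite mul1r -[leRHS]invrK lef_pV2 ?posrE ?invr_gt0.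
have ik := cintegrable_expiM z (cintegrable_propagator_symbol t l0).
have [_ e] := @cint_affine R n.+1 lambda 0 _ l0 ik.1 ik.
have E : ifourier (propagator_symbol lambda t) z = ((lambda ^+ n.+1)%:C)%C *
   cint lam (fun xi => expi (phase (radial_cut (wide_bump chi) (- beta)) T delta (lambda *: (z
     : 'rV[R]_n.+1)) xi) *
    ((symbol_cut chi 1 (dotp (xi : 'rV[R]_n.+1) xi))%:C)%C).
  rewrite /ifourier e; congr (_ * cint _ _); apply/funext => xi.
  rewrite /propagator_symbol add0r enormZ ?(ltW l0)//.
  have -> : lambda * enorm (xi : 'rV[R]_n.+1) / lambda = enorm (xi : 'rV[R]_n.+1).
    by rewrite mulrAC divff ?mul1r// gt_eqF.
  rewrite symbol_cutE// divr1.
  have [->|rx] := eqVneq (bump_rho chi (enorm (xi : 'rV[R]_n.+1))) 0.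
    by rewrite !mulr0.
  rewrite mulrA -expiD; congr (expi _ * _).
  have wz : wide_bump chi 0 = 0 by rewrite wide_bump_near// normr0 invr_gt0.
  rewrite /phase (radial_cutE (- beta) (xi : 'rV[R]_n.+1) wz).
  rewrite (wide_bump1 hchi rx) mul1r -sqr_enorm dotpZl dotpZr addrC; congr (_ + _).
  have e0 := enorm_ge0 (xi : 'rV[R]_n.+1).
  rewrite /dispersion exprMn powRM ?(ltW l0)//.
  have -> : (enorm (xi : 'rV[R]_n.+1) ^+ 2) `^ (- beta) = enorm (xi : 'rV[R]_n.+1) `^ (- (2 *
    beta)).
    by rewrite -powR_mulrn// -powRrM mulrN.
  rewrite /T /delta.
  by field; rewrite gt_eqF.
rewrite E normcM normc_real ger0_norm ?exprn_ge0 ?(ltW l0)//.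
have := HC T delta (lambda *: (z : 'rV[R]_n.+1)) T0 dd.
have -> : `|T| ^+ n.+1 = (lambda ^+ n.+1) ^+ 2 * `|t| ^+ n.+1.
  rewrite /T normrM [`|lambda ^+ 2|]ger0_norm ?exprn_ge0 ?(ltW l0)//.
  by rewrite exprMn -!exprM [(n.+1 * 2)%N]mulnC mulrC.
by rewrite exprMn mulrCA mulrA.
Qed.

End kernel.

Section schwartz.
Variables (R : realType) (n : nat).

Lemma schwartzR_continuous (f : 'rV[R]_n -> R) : schwartzR f -> continuous f.
Proof.
by move=> [h _] x; apply: differentiable_continuous; exact: (h [::] x).
Qed.

Lemma schwartz_cmeas (f : 'rV[R]_n -> R[i]) :
  schwartz f -> cmeas (f : 'rV[measurableTypeR R]_n -> R[i]).
Proof.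
by move=> [fr fi]; split; apply: continuous_measurable_rV; exact: schwartzR_continuous.
Qed.

End schwartz.

Theorem lemma1p5 (R : realType) (chi : R -> R) (hchi : cutoff chi)
    (n : nat) (hn : (1 <= n)%N)
    (beta : R) (hbeta : 0 < beta < 1)
    (eps : R) (heps : eps = 1 \/ eps = -1) :
  exists C lambda0 : R, 0 < C /\ 0 < lambda0 /\
    forall (k : int) (lambda : R), lambda = 2 ^ k -> lambda0 <= lambda ->
    forall (f : 'rV[R]_n -> R[i]), schwartz f ->
    forall t : R, t != 0 ->
      (LnormC +oo (propagator (dispersion eps beta) t (freq_proj chi lambda f))
         <= (C * `|t| `^ (- (n%:R / 2)))%:E * LnormC 1 f)%E.
Proof.
case: n hn => // n _.
have [C1 [lambda0 [C10 l00 HC]]] := @kernel_bound R chi n beta eps hchi hbeta heps.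
pose c2 : R := (2 * pi) ^- n.+1.
have c20 : 0 < c2 by rewrite invr_gt0 exprn_gt0// mulr_gt0// pi_gt0.
pose C := c2 * Num.sqrt C1 + 1.
have C0 : 0 < C by rewrite ltr_wpDl// mulr_ge0 ?sqrtr_ge0// ltW.
exists C, lambda0; split => //; split => // _ lambda _ ll f sf t t0.
have t0' : 0 < `|t| by rewrite normr_gt0.
have l0 : 0 < lambda by rewrite (lt_le_trans l00).
pose V := 'rV[measurableTypeR R]_n.+1.
pose tau := `|t| `^ (- (n.+1%:R / 2)).
have tau0 : 0 < tau by exact: powR_gt0.
have tau2 : tau ^+ 2 = `|t| ^- n.+1.
  rewrite -powR_mulrn ?(ltW tau0)// -powRrM mulNr -mulrA mulVf// mulr1.
  by rewrite powRN powR_mulrn ?(ltW t0').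
have mf := schwartz_cmeas sf.
have -> : LnormC 1 f = (\int[lebesgue_rV R n.+1]_x (normc (f x))%:E)%E.
  rewrite /LnormC Lnorm1; apply: eq_integral => x _.
  by rewrite gee0_abs// lee_fin normc_ge0.
have If0 : (0 <= \int[lebesgue_rV R n.+1]_x (normc (f x))%:E)%E.
  by apply: integral_ge0 => x _; rewrite lee_fin normc_ge0.
(* Without integrability of [f] the right-hand side is infinite. *)
have [Ify|Ify] := eqVneq (\int[lebesgue_rV R n.+1]_x (normc (f x))%:E)%E +oo%E.
  by rewrite Ify gt0_muley ?leey// lte_fin mulr_gt0.
have fi : cintegrable (lebesgue_rV R n.+1) (f : V -> R[i]).
  split => //; apply/integrableP; split.
    by apply/measurable_EFinP; exact: measurable_normc.
  under eq_integral => x _ do rewrite gee0_abs ?lee_fin ?normc_ge0//.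
  by rewrite ltey.
have IfE : (\int[lebesgue_rV R n.+1]_x (normc (f x))%:E =
    (\int[lebesgue_rV R n.+1]_x normc (f x))%:E)%E.
  by rewrite /Rintegral fineK// ge0_fin_numE// ltey.
have [M [ib cb bM iK]] := @integrable_symbol R chi n hchi lambda l0.
have freqE eta := fourier_multiplier ib fi iK (fourier_inversion cb bM ib iK) eta.
have iS : cintegrable (lebesgue_rV R n.+1) (propagator_symbol chi beta eps lambda t).
  exact: cintegrable_propagator_symbol.
have kB (z : V) : normc (ifourier (propagator_symbol chi beta eps lambda t) z) <= Num.sqrt C1
  * tau.
  rewrite -(@ler_pXn2r _ 2%N)// ?nnegrE ?normc_ge0 ?mulr_ge0 ?sqrtr_ge0 ?(ltW tau0)//.
  by rewrite exprMn (sqr_sqrtr C10) tau2 ler_pdivlMr ?exprn_gt0//; exact: HC.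
have bound x : normc (propagator (dispersion eps beta) t (freq_proj chi lambda f) x) <=
    C * tau * \int[lebesgue_rV R n.+1]_x normc (f x).
  have -> : propagator (dispersion eps beta) t (freq_proj chi lambda f) x =
      (c2%:C)%C * ifourier (fun xi : V => propagator_symbol chi beta eps lambda t xi * fourier
        f xi) x.
    rewrite [LHS]multiplierE.
    have -> // : (fun xi : V => expi (t * dispersion eps beta (enorm (xi : 'rV[R]_n.+1))) *
        fourier (freq_proj chi lambda f) xi) =
      (fun xi : V => propagator_symbol chi beta eps lambda t xi * fourier f xi).
    by apply/funext => xi; rewrite [fourier (freq_proj _ _ _) _]freqE mulrA.
  have [i1 ->] := ifourier_mul_fourier x iS fi.
  rewrite normcM normc_real (gtr0_norm c20).
  have n0 : 0 <= \int[lebesgue_rV R n.+1]_x normc (f x).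
    by apply: Rintegral_ge0 => y _; exact: normc_ge0.
  apply: (@le_trans _ _ (c2 * (Num.sqrt C1 * tau * \int[lebesgue_rV R n.+1]_x normc (f x)))).
    rewrite ler_pM2l// (le_trans (normc_cint i1))// -RintegralZl//; last exact: cintegrable_norm.
    apply: le_Rintegral => //; first exact: cintegrable_norm.
      by apply: integrableZ_EFin => //; exact: cintegrable_norm.
    by move=> y _; rewrite normcM ler_wpM2r// normc_ge0.
  rewrite mulrA ler_wpM2r// mulrA ler_pM2r// /C lerDl//.
rewrite /LnormC unlock; case: ifPn => _; last first.
  by rewrite mule_ge0// lee_fin mulr_ge0// ltW.
apply/ess_supP; apply: aeW => x /=.
by rewrite IfE -EFinM lee_fin ger0_norm ?normc_ge0//; exact: bound.
Qed.
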